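(* The following decision problem is strongly NP-complete: given an edge-weighted undirected bipartite planar graph $G=(V,E)$ with weight function $w:E\to\mathbb{Z}_{\ge 0}$, interdiction cost function $c:E\to\mathbb{Z}_{\ge 0}$, an integer budget $B>0$, and an integer $k\ge 0$, decide whether $\nu_B^E(G)<k$.
   Context: For an edge-weighted graph $H$, $\nu(H)$ is the maximum weight of a matching in $H$. $G\setminus I$ is $G$ with the edges of $I$ deleted and $c(I)=\sum_{e\in I}c(e)$. The Maximum Matching Edge Interdiction Problem asks for $I\subseteq E$ with $c(I)\le B$ minimizing $\nu(G\setminus I)$; $\nu_B^E(G)$ denotes this optimal value. Strongly NP-complete means NP-complete even when all numbers in the input are bounded by a polynomial in the input size. *)

(* Defs.v *)
From HB Require Import structures.
From mathcomp Require Import all_boot all_order all_algebra all_fingroup.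

Set Implicit Arguments.
Unset Strict Implicit.
Unset Printing Implicit Defensive.

(** Deterministic Turing machines with [(ntapes M).+1] two-way infinite tapes.
    The tape alphabet consists of the blank [None], the two input bits
    [Some (inl b)], and an arbitrary finite set [work M] of further symbols. *)

Inductive move := MoveL | Stay | MoveR.

Record TM := {
  ntapes : nat;
  state : finType;
  work : finType;
  start : state;
  halting : pred state;
  delta : state -> {ffun 'I_ntapes.+1 -> option (bool + work)} ->
          state * ('I_ntapes.+1 -> option (bool + work) * move)
}.

Section Semantics.
Variable M : TM.

Definition symbol : Type := option (bool + work M).

(** A tape [(l, r)] carries [r] from the head position rightwards and [l] from
    the cell to the left of the head leftwards; all other cells are blank. *)
Definition tape : Type := seq symbol * seq symbol.

Definition config : Type := state M * ('I_(ntapes M).+1 -> tape).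

Definition read (t : tape) : symbol := head None t.2.

Definition act (a : symbol * move) (t : tape) : tape :=
  match a.2 with
  | MoveL => (behead t.1, head None t.1 :: a.1 :: behead t.2)
  | Stay => (t.1, a.1 :: behead t.2)
  | MoveR => (a.1 :: t.1, behead t.2)
  end.

Definition step (c : config) : config :=
  if halting c.1 then c
  else let r := delta c.1 [ffun i => read (c.2 i)] in
       (r.1, fun i => act (r.2 i) (c.2 i)).

Definition init (s : seq bool) : config :=
  (start M, fun i => ([::], if i == ord0 then [seq Some (inl b) | b <- s]
                            else [::])).

Fixpoint leading_bits (r : seq symbol) : seq bool :=
  if r is Some (inl b) :: r' then b :: leading_bits r' else [::].

(** The output is the maximal bit string starting at the head of tape [0].
    As [step] fixes halted configurations, this says that [M] halts on [s]
    after at most [t] steps, with output [o]. *)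
Definition computes_within (s : seq bool) (t : nat) (o : seq bool) : Prop :=
  let c := iter t step (init s) in
  halting c.1 /\ leading_bits (c.2 ord0).2 = o.

End Semantics.

Definition poly_time (f : seq bool -> seq bool) : Prop :=
  exists (M : TM) (p : {poly nat}),
    forall s, computes_within M s p.[size s]%R (f s).

(** Self-delimiting copy of a string: every bit is preceded by [true], and the
    end is marked by [false]. *)
Definition delimit (s : seq bool) : seq bool :=
  flatten [seq [:: true; b] | b <- s] ++ [:: false].

Definition pair_string (s y : seq bool) : seq bool := delimit s ++ y.

Definition in_NP (L : seq bool -> Prop) : Prop :=
  exists (V : seq bool -> bool) (q : {poly nat}),
    poly_time (fun s => [:: V s]) /\
    forall s, L s <->
      exists y, (size y <= q.[size s]%R)%N /\ V (pair_string s y).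

Definition np_hard (L : seq bool -> Prop) : Prop :=
  forall L', in_NP L' ->
    exists f, poly_time f /\ forall s, L' s <-> L (f s).

Definition np_complete (L : seq bool -> Prop) : Prop := in_NP L /\ np_hard L.

Record problem := Problem {
  instance : Type;
  encode : instance -> seq bool;
  max_number : instance -> nat;
  yes : instance -> Prop
}.

Definition language (P : problem) (s : seq bool) : Prop :=
  exists x : instance P, encode x = s /\ yes x.

(** The subproblem on the instances [x] whose numbers are at most [p(|x|)]. *)
Definition bounded (P : problem) (p : {poly nat}) : problem :=
  {| instance := {x : instance P | (max_number x <= p.[size (encode x)]%R)%N};
     encode x := encode (sval x);
     max_number x := max_number (sval x);
     yes x := yes (sval x) |}.

Definition strongly_np_complete (P : problem) : Prop :=
  in_NP (language P) /\
  exists p : {poly nat}, np_complete (language (bounded P p)).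

Section Graph.

(** An undirected graph with edges indexed by [E]; the order of the two
    components of [ends e] is immaterial. *)
Variables (V E : finType) (ends : E -> V * V).

Definition incident (e : E) (v : V) : bool :=
  (v == (ends e).1) || (v == (ends e).2).

Definition simple_graph : bool :=
  [forall e, (ends e).1 != (ends e).2] &&
  [forall e, forall f, [forall v, incident e v == incident f v] ==> (e == f)].

Definition bipartite : bool :=
  [exists A : {set V}, forall e, ((ends e).1 \in A) != ((ends e).2 \in A)].

(** Each edge carries two darts, one leaving each of its ends. *)
Definition dart : finType := (E * bool)%type.
Definition tail (d : dart) : V := if d.2 then (ends d.1).2 else (ends d.1).1.
Definition flip (d : dart) : dart := (d.1, ~~ d.2).

(** A rotation system: [rot] permutes cyclically the darts leaving each
    vertex. *)
Definition rotation_system (rot : {perm dart}) : bool :=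
  [forall d, forall d', fconnect rot d d' == (tail d == tail d')].

(** The faces of the embedding described by [rot] are the orbits of
    [rot \o flip]; Euler's formula #V + #F = #E + 2 #C says that every component
    is embedded in the sphere.  Isolated vertices carry no dart and are counted
    neither in #V (the orbits of [rot]) nor in #C, and do not affect
    planarity. *)
Definition planar_rotation (rot : {perm dart}) : bool :=
  fcard rot predT + fcard (rot \o flip) predT ==
  #|E| + 2 * n_comp [rel d d' | (rot d == d') || (flip d == d')] predT.

Definition planar : bool :=
  [exists rot, rotation_system rot && planar_rotation rot].

Definition matching (M : {set E}) : bool :=
  [forall e in M, forall f in M,
     (e != f) ==> [forall v, ~~ (incident e v && incident f v)]].

Variables w c : E -> nat.

(** The maximum weight of a matching in the graph with edge set [F]. *)
Definition nu (F : {set E}) : nat :=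
  \max_(M : {set E} | matching M && (M \subset F)) \sum_(e in M) w e.

Definition cost (I : {set E}) : nat := \sum_(e in I) c e.

(** [set0] is feasible for every budget, so this is the optimal value. *)
Definition nuE (B : nat) : nat :=
  nu (~: [arg min_(I < set0 | cost I <= B) nu (~: I)]).

End Graph.

Record interdiction := Interdiction {
  nv : nat;
  ne : nat;
  ends : 'I_ne -> 'I_nv * 'I_nv;
  weight : 'I_ne -> nat;
  icost : 'I_ne -> nat;
  budget : nat;
  threshold : nat;
  _ : simple_graph ends;
  _ : bipartite ends;
  _ : planar ends;
  _ : 0 < budget
}.

(** Binary expansion, least significant bit first; [up_log 2 n.+1] is the
    binary length of [n]. *)
Definition bits (n : nat) : seq bool :=
  mkseq (fun i => odd (n %/ 2 ^ i)) (up_log 2 n.+1).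

(** The number of vertices is written in unary, so that the input size is at
    least #V + #E; all other numbers are written in binary. *)
Definition interdiction_encode (x : interdiction) : seq bool :=
  nseq (nv x) true ++ false ::
  flatten [seq delimit (bits n) | n <-
    [:: budget x, threshold x &
      flatten [seq [:: (ends e).1 : nat; (ends e).2 : nat; weight e; icost e]
              | e <- enum 'I_(ne x)]]].

Definition interdiction_max (x : interdiction) : nat :=
  maxn (maxn (budget x) (threshold x))
       (\max_(e < ne x) maxn (weight e) (icost e)).

Definition planar_matching_interdiction : problem :=
  {| instance := interdiction;
     encode := interdiction_encode;
     max_number := interdiction_max;
     yes x := nuE (@ends x) (@weight x) (@icost x) (budget x) < threshold x |}.

(* Main.v *)
(** Hardness. By Egerváry's duality, [nuE < k] on a bipartite graph holds iff some
    potential [y] on the vertices has [\sum y < k] while the edges [e] with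
    [y u + y v < w e] cost at most [B] together. On a grid, heavy edges of
    prohibitive cost group the vertices into dominoes of known sum, and [k] leaves
    no slack over the sum of the dominoes, so that every domino carries a value in
    a small range. Every block of four rows and four columns has four gadgets each
    of which violates at least one edge of cost 1, and [B] allows no more, so that
    the gadgets become constraints between neighbouring dominoes. They encode a
    CNF formula: rows of blocks are clauses and columns are variables, the value
    of a variable travels down its column, and one bit, telling whether a literal
    on the left was true, travels along the row of a clause. The grid is cut open
    into a helix, whose vertices form a single path 0, 1, ..., N - 1 with the
    additional edges [v, v + W], so that the weights are given by arithmetic on
    [v]. All numbers are polynomial in the size of the formula, which is the one of
    Cook and Levin, with tapes indexed by the distance to the head.

    Membership. A certificate consists of a rotation system, a side for every
    vertex, an interdiction set and a potential. Computations are programs over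
    four stacks of bits that are compiled to Turing machines; typed data are stored
    as serialized binary trees. *)

From mathcomp Require Import all_fingroup all_algebra all_boot zify.
Require Import Defs.

Set Implicit Arguments.
Unset Strict Implicit.
Unset Printing Implicit Defensive.

(** * Weighted matchings and potentials *)

(** On dominoes of known sum every cover inequality is a bound on the difference of two values, and
    systems of such bounds alone are easy to solve. The missing alternative comes from the budget:
    the two edges of a gadget bound the same quantity from opposite sides and cannot both be
    covered; one of them is paid for, and as nothing is left to pay for the other, the quantity must
    avoid the gap between the two bounds. In this way a bit in 0, ..., 2 is confined to 0 or 2 and a
    bus value in 0, ..., 4 to 0 or 4. The block value lies in 0, ..., 3 and stands, in this order,
    for false and seen, false and unseen, true and unseen, true and seen. The two unseen states are
    in the middle, so that a bus carrying 4 to the right excludes an interval of block values: {1,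
    2} without literals, while a positive literal readmits 2 and a negative one readmits 1.
    Subtracting 1 from one weight is therefore all that a literal has to do. *)

Section Duality.
Variables (V E : finType) (ends : E -> V * V) (F : {set E}).
Implicit Types (M N : {set E}) (w : E -> nat) (v x : V) (e f : E).

Notation inc := (incident ends).

Lemma incident1 e : inc e (ends e).1. Proof. by rewrite /incident eqxx. Qed.
Lemma incident2 e : inc e (ends e).2. Proof. by rewrite /incident eqxx orbT. Qed.

Lemma matchingP M :
  reflect (forall e f v, e \in M -> f \in M -> inc e v -> inc f v -> e = f)
          (matching ends M).
Proof.
apply: (iffP forall_inP) => [H e f v eM fM ev fv|H e eM].
  apply/eqP; apply: contraT => ef.
  have /forall_inP/(_ f fM) := H e eM.
  by rewrite ef /= => /forallP/(_ v); rewrite ev fv.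
apply/forall_inP => f fM; apply/implyP => ef; apply/forallP => v.
by apply: contra ef => /andP[ev fv]; rewrite (H e f v).
Qed.

Lemma sub_matching M N : N \subset M -> matching ends M -> matching ends N.
Proof.
move=> /subsetP NM /matchingP H; apply/matchingP => e f v eN fN.
exact: H (NM _ eN) (NM _ fN).
Qed.

Lemma nu_leq w M :
  matching ends M -> M \subset F -> \sum_(e in M) w e <= nu ends w F.
Proof. by move=> mM MF; apply: (@bigmax_sup _ M) => //; rewrite mM MF. Qed.

Lemma nu_attained w :
  exists M, [/\ matching ends M, M \subset F & \sum_(e in M) w e = nu ends w F].
Proof.
have m0 : matching ends set0 && (set0 \subset F).
  by rewrite sub0set andbT; apply/matchingP => e f v; rewrite inE.
have [M /andP[mM MF] HM] := @eq_bigmax_cond _ [pred M | matching ends M && (M \subset F)]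
  (fun M : {set E} => \sum_(e in M) w e) (ltac:(by apply/card_gt0P; exists set0; rewrite inE)).
by exists M; split.
Qed.

Hypothesis bip : bipartite ends.

Lemma incidentP e v : inc e v -> v = (ends e).1 \/ v = (ends e).2.
Proof. by case/orP => /eqP; [left|right]. Qed.

Lemma weak_duality w (y : V -> nat) :
  (forall e, e \in F -> w e <= y (ends e).1 + y (ends e).2) ->
  nu ends w F <= \sum_v y v.
Proof.
move=> cover; have [M [/matchingP mM MF <-]] := nu_attained w.
have [A /forallP HA] := existsP bip.
apply: (@leq_trans (\sum_(e in M) \sum_(v | inc e v) y v)).
  apply: leq_sum => e eM; apply: leq_trans (cover e (subsetP MF _ eM)) _.
  rewrite (bigD1 (ends e).1) ?incident1 //= leq_add2l.
  rewrite (bigD1 (ends e).2) ?leq_addr // incident2 /=.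
  by apply: contraNneq (HA e) => ->.
rewrite (exchange_big_dep predT) //=; apply: leq_sum => v _.
case: (pickP [pred e | (e \in M) && inc e v]) => [e /andP[eM ev]|none]; last first.
  by rewrite big_pred0.
rewrite (big_pred1 e) // => f; apply/andP/eqP => [[fM fv]|->] //.
exact: mM fM eM fv ev.
Qed.

Definition pos_cover w M v := [exists e in M, inc e v && (0 < w e)].

(** Arcs leave [A] along [N] and return along [M], so that a directed path alternates between the
    matchings by itself. *)
Definition alternating (A : {set V}) M N : rel V := fun x y =>
  (x != y) && [exists e in (if x \in A then N else M), inc e x && inc e y].

Lemma connect_pred (r : rel V) x y :
  connect r x y -> y = x \/ exists2 z, connect r x z & r z y.
Proof.
case/connectP => p; case/lastP: p => [|p z]; first by left.
rewrite rcons_path last_rcons => /andP[pth rz] ->; right.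
by exists (last x p) => //; apply/connectP; exists p.
Qed.

(** de Caen's argument: otherwise swapping two maximum matchings along an
    alternating path frees both ends of [e0]. *)
Lemma essential_vertex w e0 : e0 \in F -> 0 < w e0 ->
  exists2 v, inc e0 v &
  forall M, matching ends M -> M \subset F ->
    \sum_(e in M) w e = nu ends w F -> pos_cover w M v.
Proof.
move=> e0F we0; have [A /forallP HA] := existsP bip.
have HAB e x y : inc e x -> inc e y -> x != y -> (x \in A) = ~~ (y \in A).
  move=> /incidentP [] -> /incidentP [] ->; rewrite ?eqxx // => _;
  by move: (HA e); do 2 case: (_ \in A).
have inc_other e x y z : inc e x -> inc e y -> x != y -> inc e z -> z = x \/ z = y.
  by move=> /incidentP [] -> /incidentP [] -> + /incidentP [] ->; rewrite ?eqxx //; auto.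
have [u [v [e0u e0v uA vA]]] : exists u v, [/\ inc e0 u, inc e0 v, u \in A & v \notin A].
  have := HA e0; case: (boolP ((ends e0).1 \in A)) => H1 H2.
    exists (ends e0).1, (ends e0).2; rewrite incident1 incident2 H1; split=> //.
  exists (ends e0).2, (ends e0).1; rewrite incident1 incident2 (negbTE H1); split=> //.
  by move: H2; case: (_ \in A).
have uv : u != v by apply: contraNneq vA => <-.
pose maxm M := [&& matching ends M, M \subset F & \sum_(e in M) w e == nu ends w F].
have noC x : ~~ [exists M, maxm M && ~~ pos_cover w M x] ->
   forall M, matching ends M -> M \subset F -> \sum_(e in M) w e = nu ends w F -> pos_cover w M x.
  move=> H M mM MF EM; apply: contraNT H => np; apply/existsP; exists M.
  by rewrite np /maxm mM MF EM eqxx.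
case: (boolP [exists M, maxm M && ~~ pos_cover w M u]) => [|/noC H]; last by exists u.
case: (boolP [exists M, maxm M && ~~ pos_cover w M v]) => [|/noC H]; last by exists v.
(* Dropping the edges of weight 0 keeps the matching maximum and leaves no edge at all at [x]. *)
have reduce x : [exists M, maxm M && ~~ pos_cover w M x] ->
   exists M, [/\ matching ends M, M \subset F, \sum_(e in M) w e = nu ends w F &
              forall e, e \in M -> ~~ inc e x].
  case/existsP => M /andP[/and3P[mM MF /eqP EM] np].
  exists [set e in M | 0 < w e].
  have sM : [set e in M | 0 < w e] \subset M by apply/subsetP => e; rewrite inE => /andP[].
  split; [exact: sub_matching mM|exact: subset_trans MF| |].
    rewrite -EM [RHS](bigID (fun e => 0 < w e)) /= [X in _ + X]big1 ?addn0.
      by apply: eq_bigl => e; rewrite inE.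
    by move=> e /andP[_]; rewrite lt0n negbK => /eqP.
  move=> e; rewrite inE => /andP[eM we]; apply: contra np => ex.
  by apply/existsP; exists e; rewrite eM ex we.
move=> /reduce [N [/matchingP mN NF EN Nv]] /reduce [M [/matchingP mM MF EM Mu]].
pose R := [pred x | connect (alternating A M N) u x].
have uR : u \in R by rewrite inE connect0.
have stepR x y : x \in R -> alternating A M N x y -> y \in R.
  by rewrite !inE => xR /connect1; exact: connect_trans.
(* [R] is also closed against the direction of the arcs: a vertex of [R] outside [A] was entered
   along an edge of [N], and this is the only edge of [N] at it. *)
have RN e x y : e \in N -> x \in R -> inc e x -> inc e y -> y \in R.
  move=> eN xR ex ey; case: (eqVneq x y) => [<- //|xy].
  case: (boolP (x \in A)) => xA.
    apply: (stepR x) => //; rewrite /alternating xy xA /=.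
    by apply/existsP; exists e; rewrite eN ex ey.
  case: (connect_pred xR) => [E1|[z zR]]; first by rewrite E1 uA in xA.
  case/andP=> zx /existsP[f /andP[+ /andP[fz fx]]].
  rewrite (HAB f z x) // xA /= => fN.
  rewrite (mN f e x) // in fz.
  by case: (inc_other e x z y) => // [|->|->] //; rewrite eq_sym.
have RM e x y : e \in M -> x \in R -> inc e x -> inc e y -> y \in R.
  move=> eM xR ex ey; case: (eqVneq x y) => [<- //|xy].
  case: (boolP (x \in A)) => xA; last first.
    apply: (stepR x) => //; rewrite /alternating xy (negbTE xA) /=.
    by apply/existsP; exists e; rewrite eM ex ey.
  case: (connect_pred xR) => [E1|[z zR]]; first by move: (Mu e eM); rewrite -E1 ex.
  case/andP=> zx /existsP[f /andP[+ /andP[fz fx]]].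
  rewrite (HAB f z x) // xA /= => fM.
  rewrite (mM f e x) // in fz.
  by case: (inc_other e x z y) => // [|->|->] //; rewrite eq_sym.
(* As [v] is outside [A], a path could enter it only along an edge of [N], and [N] misses [v]. *)
have vR : v \notin R.
  apply/negP => /connect_pred [E1|[z zR]]; first by rewrite E1 uA in vA.
  case/andP=> zx /existsP[f /andP[+ /andP[fz fv]]].
  by rewrite (HAB f z v) // vA /= => fN; move: (Nv f fN); rewrite fv.
pose inR e := (ends e).1 \in R.
have inRN e x : e \in N -> inc e x -> (x \in R) = inR e.
  by move=> eN ex; apply/idP/idP => H; apply: (RN e) H _ _; rewrite ?incident1.
have inRM e x : e \in M -> inc e x -> (x \in R) = inR e.
  by move=> eM ex; apply/idP/idP => H; apply: (RM e) H _ _; rewrite ?incident1.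
(* No edge of [M] or [N] crosses the boundary of [R], so the matchings can be exchanged inside [R].
   Then [N'] misses [u], which is in [R] and missed by [M], and also [v], which is outside and
   missed by [N]. *)
pose M' := [set e in M | ~~ inR e] :|: [set e in N | inR e].
pose N' := [set e in N | ~~ inR e] :|: [set e in M | inR e].
have mM' : matching ends M'.
  apply/matchingP => e f x; rewrite !inE.
  case/orP => /andP[eX eR] /orP[] /andP[fX fR] ex fx.
  - exact: mM ex fx.
  - by rewrite -(inRM e x) // (inRN f x) // fR in eR.
  - by rewrite -(inRM f x) // (inRN e x) // eR in fR.
  - exact: mN ex fx.
have mN' : matching ends N'.
  apply/matchingP => e f x; rewrite !inE.
  case/orP => /andP[eX eR] /orP[] /andP[fX fR] ex fx.
  - exact: mN ex fx.
  - by rewrite -(inRN e x) // (inRM f x) // fR in eR.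
  - by rewrite -(inRN f x) // (inRM e x) // eR in fR.
  - exact: mM ex fx.
have sub (X Y : {set E}) : X \subset F -> Y \subset F ->
    [set e in X | ~~ inR e] :|: [set e in Y | inR e] \subset F.
  move=> /subsetP XF /subsetP YF; apply/subsetP => e; rewrite !inE.
  by case/orP => /andP[H _]; [exact: XF|exact: YF].
have sumU (X Y : {set E}) : \sum_(e in [set e in X | ~~ inR e] :|: [set e in Y | inR e]) w e =
    \sum_(e in X | ~~ inR e) w e + \sum_(e in Y | inR e) w e.
  rewrite big_mkcond [X in _ = X + _]big_mkcond [X in _ = _ + X]big_mkcond -big_split.
  by apply: eq_bigr => e _ /=; rewrite !inE; case: (e \in X); case: (e \in Y); case: (inR e); rewrite ?addn0.
have LM' := nu_leq w mM' (sub _ _ MF NF).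
have uN' e : e \in N' -> ~~ inc e u.
  rewrite !inE => /orP[] /andP[eX eR]; last exact: Mu.
  by apply: contra eR => eu; rewrite -(inRN e u).
have vN' e : e \in N' -> ~~ inc e v.
  rewrite !inE => /orP[] /andP[eX eR]; first exact: Nv.
  by apply: contra vR => ev; rewrite (inRM e v).
have e0N' : e0 \notin N' by apply/negP => /uN'; rewrite e0u.
have mN0 : matching ends (e0 |: N').
  have away f x : f \in N' -> inc e0 x -> ~~ inc f x.
    by move=> fN' e0x; case: (inc_other e0 u v x) => // ->; [exact: uN'|exact: vN'].
  apply/matchingP => e f x; rewrite !in_setU1.
  case/orP => [/eqP ->|eX] /orP[/eqP ->|fX] //.
  - by move=> ex; move/negP: (away f x fX ex).
  - by move=> ex fx; case/negP: (away e x eX fx).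
  - by move/matchingP: mN'; apply.
(* [M'] and [N'] together weigh twice the optimum and [M'] at most the optimum, so [N'] is maximum
   too and adding [e0] exceeds the optimum. *)
have := nu_leq w mN0; rewrite subUset sub1set e0F sub // => /(_ isT).
rewrite big_setU1 //= sumU; move: LM'; rewrite sumU.
have EM2 := EM; have EN2 := EN; rewrite (bigID inR) /= in EM2.
rewrite (bigID inR) /= in EN2; move: EM2 EN2 we0; clear.
move: (\sum_(e in M | inR e) _) (\sum_(e in M | ~~ inR e) _) => a b.
move: (\sum_(e in N | inR e) _) (\sum_(e in N | ~~ inR e) _) => c d.
by lia.
Qed.

(** Induction on the total weight: lowering by one the positive weights at an essential vertex
    lowers the optimum strictly, and one more unit of potential at that vertex pays for the
    difference. Integrality comes for free. *)
Lemma weighted_cover w : exists y : V -> nat,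
  \sum_v y v <= nu ends w F /\
  forall e, e \in F -> w e <= y (ends e).1 + y (ends e).2.
Proof.
have [n] := ubnP (\sum_(e in F) w e); elim: n w => // n IH w wn.
case: (pickP [pred e in F | 0 < w e]) => [e0 /andP[/= e0F we0]|none]; last first.
  exists (fun=> 0); split=> [|e eF]; first by rewrite big1.
  by have := none e; rewrite /= eF /= lt0n => /negbFE/eqP ->.
have [v e0v Hv] := essential_vertex e0F we0.
pose w' e := w e - inc e v.
have lew e : w' e <= w e by exact: leq_subr.
have [|y [ysum ycov]] := IH w'.
  apply: leq_trans (_ : \sum_(e in F) w e <= n); last by rewrite -ltnS.
  rewrite (bigD1 e0) //= [X in _ < X](bigD1 e0) //= -addSn leq_add //.
    by rewrite /w' e0v subn1 prednK.
  by apply: leq_sum => e _.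
have nu' : nu ends w' F < nu ends w F.
  have [M [mM MF <-]] := nu_attained w'.
  have le_w : \sum_(e in M) w' e <= \sum_(e in M) w e by apply: leq_sum => e _.
  have := nu_leq w mM MF; rewrite leq_eqVlt => /orP[/eqP EM|]; last exact: leq_ltn_trans.
  have /existsP[e /and3P[eM ev we]] := Hv M mM MF EM.
  rewrite -EM (bigD1 e) //= [X in _ < X](bigD1 e) //= -addSn leq_add //.
    by rewrite /w' ev subn1 prednK.
  by apply: leq_sum => f _.
exists (fun x => y x + (x == v)); split.
  rewrite big_split /= [X in _ + X](bigD1 v) //= eqxx [X in _ + (_ + X)]big1 ?addn0; last by move=> x /negbTE ->.
  by rewrite addn1; apply: leq_ltn_trans nu'.
move=> e eF; have := ycov e eF; rewrite /w' /incident ![v == _]eq_sym.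
by case: eqP; case: eqP; lia.
Qed.

Lemma nu_ltP w k :
  nu ends w F < k <-> exists y : V -> nat,
    \sum_v y v < k /\
    forall e, e \in F -> w e <= y (ends e).1 + y (ends e).2.
Proof.
split=> [lt_k|[y [ysum ycov]]].
  by have [y [ysum ycov]] := weighted_cover w; exists y; split=> //; exact: leq_ltn_trans lt_k.
exact: leq_ltn_trans (weak_duality ycov) ysum.
Qed.
End Duality.

(** After duality both levels of the problem are minimizations, so that min-max collapses to one
    existential statement. It serves both as the certificate and as the starting point of the
    hardness proof. *)
Lemma nuE_ltP (V E : finType) (ends : E -> V * V) w c B k :
  bipartite ends ->
  nuE ends w c B < k <-> exists (I : pred E) (y : V -> nat),
    [/\ \sum_(e | I e) c e <= B, \sum_v y v < k &
      forall e, ~~ I e -> w e <= y (ends e).1 + y (ends e).2].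
Proof.
move=> bip; rewrite /nuE; case: arg_minnP => [|I0 cI0 min0].
  by rewrite /cost big_set0.
split=> [/(nu_ltP _ bip)[y [ysum ycov]]|[I [y [cI ysum ycov]]]].
  exists [in I0], y; split=> // e eI0; apply: ycov.
  by rewrite inE.
have cI' : cost c [set e | I e] <= B.
  by rewrite /cost (eq_bigl I) // => e; rewrite inE.
apply: leq_ltn_trans (min0 _ cI') _; apply/(nu_ltP _ bip).
by exists y; split=> // e; rewrite !inE; exact: ycov.
Qed.

(** * The helix *)

Lemma connect_sym_of (T : finType) (e : rel T) :
  (forall x y, e x y -> connect e y x) -> connect_sym e.
Proof.
move=> H; have Hc x y : connect e x y -> connect e y x.
  case/connectP => p; elim: p x => [|z p IH] x /=; first by move=> _ ->.
  by case/andP=> /H xz pth Ey; apply: connect_trans (IH _ pth Ey) xz.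
by move=> x y; apply/idP/idP; exact: Hc.
Qed.

(** Euler's formula is checked by exhibiting the components as the fibres of an
    explicit labelling. *)
Lemma n_comp_labels (T : finType) (e : rel T) m (lab : T -> nat) :
  connect_sym e -> (forall x y, connect e x y = (lab x == lab y)) ->
  (forall x, lab x < m) -> (forall i, i < m -> exists x, lab x = i) ->
  n_comp e predT = m.
Proof.
move=> sym_e labE lab_lt lab_onto; rewrite -[RHS](card_ord m) -cardsT.
pose l x : 'I_m := Ordinal (lab_lt x).
have -> : setT = [set l x | x in roots e].
  apply/setP => i; rewrite inE; apply/esym/imsetP.
  have [x Ex] := lab_onto i (ltn_ord i).
  exists (root e x); first exact: roots_root.
  by apply: val_inj; rewrite /= -Ex; apply/eqP; rewrite -labE connect_root.
rewrite card_in_imset.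
  by apply: eq_card => x; rewrite !inE andbT.
move=> x y; rewrite !inE => /eqP rx /eqP ry [/eqP].
by rewrite -labE => /(rootP sym_e); rewrite rx ry.
Qed.

Section Helix.
Variables (n' W : nat).
Hypotheses (W3 : 2 < W) (oddW : odd W) (Wn : W <= n').
Let N := n'.+1.
Let ne := n' + (N - W).

(** Vertices 0, 1, ..., n' along a spiral whose turns have length [W]: edge
    [e < n'] joins [e] to [e + 1], edge [n' + v] joins [v] to [v + W]. *)
Definition helix_tail e := if e < n' then e else e - n'.
Definition helix_head e := if e < n' then e.+1 else e - n' + W.
Definition helix_ends (e : 'I_ne) : 'I_N * 'I_N :=
  (inord (helix_tail e), inord (helix_head e)).

Lemma ne_lt (e : 'I_ne) : e < n' + (n'.+1 - W). Proof. exact: ltn_ord. Qed.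

Lemma helix_tail_lt (e : 'I_ne) : helix_tail e < N.
Proof. by rewrite /helix_tail /N; case: (ltnP e n') => H; have := ne_lt e; lia. Qed.
Lemma helix_head_lt (e : 'I_ne) : helix_head e < N.
Proof. by rewrite /helix_head /N; case: (ltnP e n') => H; have := ne_lt e; lia. Qed.
Lemma helix_ends1 (e : 'I_ne) : (helix_ends e).1 = helix_tail e :> nat.
Proof. by rewrite inordK // helix_tail_lt. Qed.
Lemma helix_ends2 (e : 'I_ne) : (helix_ends e).2 = helix_head e :> nat.
Proof. by rewrite inordK // helix_head_lt. Qed.

(** The steps 1 and [W] are both odd, so every edge changes the parity of the vertex number. *)
Lemma helix_bipartite : bipartite helix_ends.
Proof.
apply/existsP; exists [set v : 'I_N | odd v]; apply/forallP => e.
rewrite !inE helix_ends1 helix_ends2 /helix_tail /helix_head.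
case: (ltnP e n') => _ /=; first by case: (odd e).
by rewrite oddD oddW; case: (odd _).
Qed.

Lemma helix_simple : simple_graph helix_ends.
Proof.
apply/andP; split.
  apply/forallP => e; apply/eqP => /(congr1 (@nat_of_ord _)).
  rewrite helix_ends1 helix_ends2 /helix_tail /helix_head.
  by case: (ltnP e n'); lia.
apply/forallP => e; apply/forallP => f; apply/implyP => /forallP H.
apply/eqP/val_inj; rewrite /=.
have := H (helix_ends e).1; have := H (helix_ends e).2.
have := H (helix_ends f).1; have := H (helix_ends f).2.
have E (x y : 'I_N) : (x == y) = (x == y :> nat) by [].
rewrite /incident !E !(helix_ends1, helix_ends2) /helix_tail /helix_head {E H}.
have := ne_lt e; have := ne_lt f; move: (nat_of_ord e) (nat_of_ord f) => i j.
by case: (ltnP i n'); case: (ltnP j n'); lia.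
Qed.

(** * A spherical embedding of the helix, described by its faces *)

Section Rotation.
Variable e0 : 'I_ne.
Notation D := (dart 'I_ne).

Definition mk (k : nat) (b : bool) : D := (insubd e0 k, b).
(** Darts are named by compass directions, with the turns of the helix drawn as rows from west to
    east; [v] is always the smaller end of the edge, not the tail of the dart. *)
Definition dE v := mk v false.
Definition dW v := mk v true.
Definition dS v := mk (n' + v) false.
Definition dN v := mk (n' + v) true.

(** The faces are the quadrilaterals [v], [v + W], [v + W + 1], [v + 1] and two caps: one bounded by
    the path from 0 to [W] and the edge back to 0, the other by the path from [n' - W] to [n'] and
    the edge joining its ends. *)
Definition face_next (d : D) : D :=
  let k := nat_of_ord d.1 in
  let v := k - n' in
  if k < n' then
    if ~~ d.2 then (if W <= k.+1 then dN (k.+1 - W) else dE k.+1)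
    else (if k + W < N then dS k else dW k.-1)
  else
    if ~~ d.2 then (if v + W < n' then dE (v + W) else dW (v + W).-1)
    else (if 0 < v then dW v.-1 else dE 0).

Lemma mk_val k b : k < ne -> nat_of_ord (mk k b).1 = k.
Proof. by move=> H; have := val_insubd e0 k; rewrite H. Qed.

Lemma face_E v : v < n' ->
  face_next (dE v) = if W <= v.+1 then dN (v.+1 - W) else dE v.+1.
Proof. by move=> H; rewrite /face_next mk_val ?H //; rewrite /ne; lia. Qed.
Lemma face_W v : v < n' ->
  face_next (dW v) = if v + W < N then dS v else dW v.-1.
Proof. by move=> H; rewrite /face_next mk_val ?H //; rewrite /ne; lia. Qed.
Lemma face_S v : v + W < N ->
  face_next (dS v) = if v + W < n' then dE (v + W) else dW (v + W).-1.
Proof.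
move=> H; rewrite /face_next mk_val; last by rewrite /ne; lia.
by rewrite ltnNge leq_addr /= addKn.
Qed.
Lemma face_N v : v + W < N ->
  face_next (dN v) = if 0 < v then dW v.-1 else dE 0.
Proof.
move=> H; rewrite /face_next mk_val; last by rewrite /ne; lia.
by rewrite ltnNge leq_addr /= addKn.
Qed.

Variant dart_spec : D -> Prop :=
| SpecE v of v < n' : dart_spec (dE v)
| SpecW v of v < n' : dart_spec (dW v)
| SpecS v of v + W < N : dart_spec (dS v)
| SpecN v of v + W < N : dart_spec (dN v).

Lemma dartP d : dart_spec d.
Proof.
case: d => k b; case: (ltnP k n') => H.
  have -> : k = insubd e0 k by apply: val_inj; rewrite val_insubd ltn_ord.
  by case: b; [exact: SpecW|exact: SpecE].
have L := ne_lt k.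
have -> : k = insubd e0 (n' + (k - n')).
  by apply: val_inj; rewrite val_insubd subnKC // ltn_ord.
have H' : k - n' + W < N by rewrite /N; lia.
by case: b; [exact: SpecN|exact: SpecS].
Qed.

Lemma flip_E v : flip (dE v) = dW v. Proof. by []. Qed.
Lemma flip_W v : flip (dW v) = dE v. Proof. by []. Qed.
Lemma flip_S v : flip (dS v) = dN v. Proof. by []. Qed.
Lemma flip_N v : flip (dN v) = dS v. Proof. by []. Qed.
Lemma flipK : involutive (@flip 'I_ne). Proof. by case=> e b; rewrite /flip /= negbK. Qed.

Lemma mk_inj k b k' b' : k < ne -> k' < ne -> mk k b = mk k' b' -> k = k' /\ b = b'.
Proof. by move=> H H' E; rewrite -(mk_val b H) -(mk_val b' H') E; case: E. Qed.

Lemma face_next_inj : injective face_next.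
Proof.
move=> d d'; case: (dartP d) => v Hv; case: (dartP d') => u Hu;
rewrite !(face_E, face_W, face_S, face_N) //;
repeat (case: ifP => ?);
(case/mk_inj; [rewrite /ne /N; lia|rewrite /ne /N; lia|]) => // Ek _;
solve [congr mk; lia | exfalso; rewrite /N in Hu Hv *; lia].
Qed.

(** The rotation is derived from the faces, which are easier to describe. *)
Definition rot_fun d := face_next (flip d).
Lemma rot_fun_inj : injective rot_fun.
Proof. by move=> d d' /face_next_inj /(can_inj flipK). Qed.
Definition helix_rot : {perm D} := perm rot_fun_inj.

Definition tl (d : D) : nat := tail helix_ends d.
Lemma tl_E v : v < n' -> tl (dE v) = v.
Proof.
move=> H; have Hk : v < ne by rewrite /ne; lia.
by rewrite /tl /tail helix_ends1 (mk_val false Hk) /helix_tail H.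
Qed.
Lemma tl_W v : v < n' -> tl (dW v) = v.+1.
Proof.
move=> H; have Hk : v < ne by rewrite /ne; lia.
by rewrite /tl /tail helix_ends2 (mk_val true Hk) /helix_head H.
Qed.
Lemma tl_S v : v + W < N -> tl (dS v) = v.
Proof.
move=> H; have Hk : n' + v < ne by rewrite /ne; lia.
by rewrite /tl /tail helix_ends1 (mk_val false Hk) /helix_tail ltnNge leq_addr addKn.
Qed.
Lemma tl_N v : v + W < N -> tl (dN v) = v + W.
Proof.
move=> H; have Hk : n' + v < ne by rewrite /ne; lia.
by rewrite /tl /tail helix_ends2 (mk_val true Hk) /helix_head ltnNge leq_addr addKn.
Qed.

Lemma tl_rot d : tl (rot_fun d) = tl d.
Proof.
rewrite /rot_fun; case: (dartP d) => v H; rewrite ?(flip_E, flip_W, flip_S, flip_N).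
- rewrite face_W // tl_E //; case: ifP => H1; first by rewrite tl_S.
  by rewrite tl_W; lia.
- rewrite face_E // tl_W //; case: ifP => H1; first by rewrite tl_N; lia.
  by rewrite tl_E; lia.
- rewrite face_N // tl_S //; case: ifP => H1; first by rewrite tl_W; lia.
  by rewrite tl_E; lia.
- rewrite face_S // tl_N //; case: ifP => H1; first by rewrite tl_E.
  by rewrite tl_W; lia.
Qed.

Definition rep_vertex x := if x < n' then dE x else dW x.-1.

(** The rotation at a vertex is east, south, west, north, where missing directions are skipped.
    Every vertex except the last has an east dart, which is its representative. *)
Lemma fconnect_rep d : fconnect rot_fun d (rep_vertex (tl d)).
Proof.
have step d' : fconnect rot_fun (rot_fun d') (rep_vertex (tl (rot_fun d'))) ->
    fconnect rot_fun d' (rep_vertex (tl d')).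
  by rewrite tl_rot; apply: connect_trans; exact: fconnect1.
have cE v : v < n' -> fconnect rot_fun (dE v) (rep_vertex (tl (dE v))).
  by move=> H; rewrite tl_E // /rep_vertex H connect0.
have cN v : v + W < N -> fconnect rot_fun (dN v) (rep_vertex (tl (dN v))).
  move=> H; apply: step; rewrite /rot_fun flip_N face_S //; case: ifP => H1; first exact: cE.
  rewrite tl_W; last lia.
  rewrite /rep_vertex; have -> : (v + W).-1.+1 = n' by lia.
  by rewrite ltnn; have -> : n'.-1 = (v + W).-1 by lia.
have cW v : v < n' -> fconnect rot_fun (dW v) (rep_vertex (tl (dW v))).
  move=> H; case: (ltnP v.+1 n') => H2; last first.
    by rewrite tl_W // /rep_vertex ltnNge H2.
  apply: step; rewrite /rot_fun flip_W face_E //; case: ifP => H1; first by apply: cN; lia.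
  exact: cE.
case: (dartP d) => v H; [exact: cE|exact: cW| |exact: cN].
apply: step; rewrite /rot_fun flip_S face_N //; case: ifP => H1; first by apply: cW; lia.
by apply: cE; lia.
Qed.

Lemma fconnect_rotE d d' : fconnect rot_fun d d' = (tl d == tl d').
Proof.
apply/idP/eqP => [|E].
  case/connectP => p + ->; elim: p d => //= x p IH d /andP[/eqP <- pth].
  by rewrite -(IH _ pth) tl_rot.
apply: connect_trans (fconnect_rep d) _; rewrite E fconnect_sym; last exact: rot_fun_inj.
exact: fconnect_rep.
Qed.

Let Q := n' - W.
(** A quadrilateral is labelled by its smallest vertex, which is below [Q]; [Q] and [Q.+1] are the
    caps at the start and at the end of the helix. This gives the [Q.+2] faces that Euler's formula
    requires. *)
Definition face_label (d : D) : nat :=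
  let k := nat_of_ord d.1 in
  let v := k - n' in
  if k < n' then
    if ~~ d.2 then (if k < W then Q else k - W)
    else (if k < Q then k else Q.+1)
  else if ~~ d.2 then (if v < Q then v else Q.+1)
  else (if 0 < v then v.-1 else Q).

Lemma label_E v : v < n' -> face_label (dE v) = if v < W then Q else v - W.
Proof. by move=> H; rewrite /face_label mk_val ?H //; rewrite /ne; lia. Qed.
Lemma label_W v : v < n' -> face_label (dW v) = if v < Q then v else Q.+1.
Proof. by move=> H; rewrite /face_label mk_val ?H //; rewrite /ne; lia. Qed.
Lemma label_S v : v + W < N -> face_label (dS v) = if v < Q then v else Q.+1.
Proof.
move=> H; rewrite /face_label mk_val; last by rewrite /ne; lia.
by rewrite ltnNge leq_addr /= addKn.
Qed.
Lemma label_N v : v + W < N -> face_label (dN v) = if 0 < v then v.-1 else Q.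
Proof.
move=> H; rewrite /face_label mk_val; last by rewrite /ne; lia.
by rewrite ltnNge leq_addr /= addKn.
Qed.

Lemma label_face_next d : face_label (face_next d) = face_label d.
Proof.
case: (dartP d) => v H; rewrite ?(face_E, face_W, face_S, face_N) //; case: ifP => H1;
rewrite !(label_E, label_W, label_S, label_N);
  rewrite /N /Q in H *; try lia;
by repeat (case: ifP => ?); lia.
Qed.

Definition rep_face j := if j < Q then dW j else if j == Q then dN 0 else dS Q.

Lemma fconnect_rep_face d : fconnect face_next d (rep_face (face_label d)).
Proof.
have QW : Q + W = n' by rewrite /Q; lia.
have step d' : fconnect face_next (face_next d') (rep_face (face_label (face_next d'))) ->
    fconnect face_next d' (rep_face (face_label d')).
  by rewrite label_face_next; apply: connect_trans; exact: fconnect1.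
have cN v : v + W < N -> fconnect face_next (dN v) (rep_face (face_label (dN v))).
  case: v => [|v] H; first by rewrite label_N // /rep_face !ltnn eqxx connect0.
  apply: step; rewrite face_N // label_W; last by rewrite /N in H; lia.
  have E : v.+1.-1 < Q by rewrite /N in H; lia.
  by rewrite E /rep_face E connect0.
have cE v : v < n' -> fconnect face_next (dE v) (rep_face (face_label (dE v))).
  have [k] := ubnP (n' - v); elim: k v => // k IH v kv H.
  apply: step; rewrite face_E //; case: ifP => H1; first by apply: cN; lia.
  by apply: IH; lia.
have cS v : v + W < N -> fconnect face_next (dS v) (rep_face (face_label (dS v))).
  move=> H; case: (ltnP v Q) => H1.
    apply: step; rewrite face_S //; have -> : v + W < n' by lia.
    by apply: cE; lia.
  have -> : v = Q by lia.
  rewrite label_S ?ltnn; last lia.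
  have -> : rep_face Q.+1 = dS Q by rewrite /rep_face; case: ltngtP => //; lia.
  exact: connect0.
have cW v : v < n' -> fconnect face_next (dW v) (rep_face (face_label (dW v))).
  elim: v => [|v IH] H; apply: step; rewrite face_W //; case: ifP => H1; try exact: cS.
    by lia.
  by apply: IH; lia.
by case: (dartP d) => v H; [exact: cE|exact: cW|exact: cS|exact: cN].
Qed.

Lemma fconnect_faceE d d' : fconnect face_next d d' = (face_label d == face_label d').
Proof.
apply/idP/eqP => [|E].
  case/connectP => p + ->; elim: p d => //= x p IH d /andP[/eqP <- pth].
  by rewrite -(IH _ pth) label_face_next.
apply: connect_trans (fconnect_rep_face d) _; rewrite E fconnect_sym; last exact: face_next_inj.
exact: fconnect_rep_face.
Qed.

Lemma helix_planar0 : planar helix_ends.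
Proof.
apply/existsP; exists helix_rot; apply/andP; split.
  apply/forallP => d; apply/forallP => d'; apply/eqP.
  rewrite (eq_fconnect (f' := rot_fun)); last by move=> x; rewrite permE.
  exact: fconnect_rotE.
rewrite /planar_rotation.
have QW : Q + W = n' by rewrite /Q; lia.
have -> : fcard helix_rot predT = N.
  rewrite (eq_fcard (f' := rot_fun)); last by move=> x; rewrite permE.
  apply: (n_comp_labels (lab := tl)) => [||d|i iN].
  - by apply: fconnect_sym; exact: rot_fun_inj.
  - exact: fconnect_rotE.
  - exact: ltn_ord.
  - case: (ltnP i n') => H; first by exists (dE i); rewrite tl_E.
    exists (dW i.-1); rewrite tl_W; lia.
have -> : fcard (helix_rot \o @flip _) predT = Q.+2.
  rewrite (eq_fcard (f' := face_next)); last first.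
    by move=> x; rewrite /= permE /rot_fun flipK.
  apply: (n_comp_labels (lab := face_label)) => [||d|i iQ].
  - by apply: fconnect_sym; exact: face_next_inj.
  - exact: fconnect_faceE.
  - case: (dartP d) => v H; rewrite !(label_E, label_W, label_S, label_N) //;
    rewrite /N in H; case: ifP; lia.
  - case: (ltngtP i Q) => H.
    + by exists (dW i); rewrite label_W ?H //; lia.
    + exists (dS Q); rewrite label_S ?ltnn; lia.
    + by exists (dN 0); rewrite label_N //; lia.
set e := [rel d d' | _ || _].
have sym_e : connect_sym e.
  apply: connect_sym_of => x y /orP[/eqP <-|/eqP <-].
    have : fconnect rot_fun (rot_fun x) x.
      by rewrite fconnect_sym ?fconnect1 //; exact: rot_fun_inj.
    rewrite permE; apply: connect_sub => a b /eqP <-.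
    by apply: connect1; rewrite /= permE eqxx.
  by apply: connect1; rewrite /= flipK eqxx orbT.
have rotc d d' : tl d = tl d' -> connect e d d'.
  move/eqP; rewrite -fconnect_rotE; apply: connect_sub => a b /eqP <-.
  by apply: connect1; rewrite /= permE eqxx.
have all0 d : connect e (dE 0) d.
  have [k] := ubnP (tl d); elim: k d => // k IH d kd.
  case: (posnP (tl d)) => H; first by apply: rotc; rewrite tl_E; lia.
  have Hl : tl d < N by exact: ltn_ord.
  apply: (@connect_trans _ _ (dE (tl d).-1)); first by apply: IH; rewrite tl_E; lia.
  apply: (@connect_trans _ _ (dW (tl d).-1)).
    by apply: connect1; rewrite /= eqxx orbT.
  by apply: rotc; rewrite tl_W; lia.
have -> : n_comp e predT = 1.
  apply: (n_comp_labels (lab := fun=> 0)) => // [x y|[|i] //]; last by exists (dE 0).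
  by rewrite eqxx (connect_trans _ (all0 y)) // sym_e.
by rewrite card_ord /ne /Q /N; lia.
Qed.
End Rotation.

Lemma helix_planar : planar helix_ends.
Proof.
have ne0 : 0 < ne by rewrite /ne; lia.
exact: helix_planar0 (Ordinal ne0).
Qed.
End Helix.

(** * Formulas as weighted grids *)

Lemma sum_mul a b (F : nat -> nat) :
  \sum_(p < a * b) F p = \sum_(i < a) \sum_(j < b) F (i * b + j).
Proof.
elim: a => [|a IH]; first by rewrite mul0n !big_ord0.
by rewrite big_ord_recr -IH /= mulSnr big_split_ord.
Qed.

Definition sum4 (f : nat -> nat) := f 0 + f 1 + f 2 + f 3.

Lemma sum_ord4 (f : nat -> nat) : \sum_(i < 4) f i = sum4 f.
Proof. by rewrite !big_ord_recr big_ord0. Qed.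

Lemma sum_cols n (G : nat -> nat) :
  \sum_(j < 4 * n + 3) G j =
  \sum_(i < n) sum4 (fun k => G (4 * i + k)) +
  (G (4 * n) + G (4 * n + 1) + G (4 * n + 2)).
Proof.
rewrite big_split_ord /= 3!big_ord_recr big_ord0 /= addn0; congr (_ + _).
rewrite mulnC sum_mul; apply: eq_bigr => i _.
by rewrite (sum_ord4 (fun j => G (i * 4 + j))) /sum4 [i * 4]mulnC.
Qed.

(** This is how a global bound without slack, on the labels or on the cost, becomes an equality in
    every block. *)
Lemma sum_ord_tight k (f g : 'I_k -> nat) :
  (forall i, f i <= g i) -> \sum_i g i <= \sum_i f i -> forall i, g i = f i.
Proof.
move=> H S i; apply/eqP; rewrite eqn_leq H andbT.
move: S; rewrite (bigD1 i) //= [X in _ <= X](bigD1 i) //=.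
move=> S; rewrite -(leq_add2r (\sum_(j < k | j != i) g j)).
by apply: leq_trans S _; rewrite leq_add2l; exact: leq_sum.
Qed.

Section Layout.
Variables (m n : nat) (pos neg : nat -> nat -> bool).
Let W := 4 * n + 3.

(** Row [4 * R + r], column [4 * i + k] of the grid: block [(R, i)] stands for
    variable [i] in clause [R]. The three columns [4 * n + k] have no variable:
    only [k = 0, 1] carry weights, and [k = 2] makes [W] odd. *)
Definition place R r i k := (4 * R + r) * W + (4 * i + k).

Lemma W_gt0 : 0 < W. Proof. by rewrite /W; lia. Qed.

Definition clause_of p := p %/ (4 * W).
Definition row_of p := p %/ W %% 4.
Definition var_of p := p %% W %/ 4.
Definition col_of p := p %% W %% 4.

Lemma place_decode R r i k : r < 4 -> k < 4 -> 4 * i + k < W ->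
  [/\ clause_of (place R r i k) = R, row_of (place R r i k) = r,
      var_of (place R r i k) = i & col_of (place R r i k) = k].
Proof.
move=> r4 k4 H; have E1 : place R r i k %/ W = 4 * R + r.
  by rewrite divnMDl ?W_gt0 // (divn_small H) addn0.
have E2 : place R r i k %% W = 4 * i + k by rewrite modnMDl modn_small.
rewrite /clause_of /row_of /var_of /col_of [4 * W]mulnC divnMA E1 E2.
by rewrite ![4 * _]mulnC !divnMDl // !modnMDl !(divn_small, modn_small) // !addn0.
Qed.

Lemma sum_place (F : nat -> nat) :
  \sum_(p < m * (4 * W)) F p =
  \sum_(R < m) (\sum_(i < n) sum4 (fun r => sum4 (fun k => F (place R r i k))) +
    sum4 (fun r => F (place R r n 0) + F (place R r n 1) + F (place R r n 2))).
Proof.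
rewrite sum_mul; apply: eq_bigr => R _.
rewrite (sum_mul _ _ (fun x => F (R * (4 * W) + x))).
have row (r : 'I_4) : \sum_(j < W) F (R * (4 * W) + (r * W + j)) =
    \sum_(i < n) sum4 (fun k => F (place R r i k)) +
    (F (place R r n 0) + F (place R r n 1) + F (place R r n 2)).
  have E j : R * (4 * W) + (r * W + j) = (4 * R + r) * W + j by lia.
  under eq_bigr => j _ do rewrite E.
  by rewrite /W (sum_cols n (fun j => F ((4 * R + r) * (4 * n + 3) + j))) /place addn0.
under eq_bigr => r _ do rewrite row.
by rewrite big_split /= exchange_big /=; congr (_ + _); [apply: eq_bigr => i _|];
  rewrite -sum_ord4.
Qed.

(** Dominoes are the pairs of columns [(0, 1)] in rows 1 to 3 (sum 4) and
    [(2, 3)] in rows 0 to 3 (sums 2, 3, 3, 3): 23 in every block, and 12 in the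
    last columns. *)
Definition budget_of := m * (4 * n + 1).
Definition threshold_of := (m * (23 * n + 12)).+1.
Let hard := budget_of.+1.

(** The tables list column [k] = 0, ..., 3, each with its rows 0, ..., 3; entries
    13 and 14 are the gadgets for the literals of variable [i]. *)
Definition hweight R r i k : nat :=
  if (k == 0) || (i < n) then
    nth 0 [:: 0; 4; 4; 4; 2; 4; 5; 1; 2; 3; 3; 3; 2; 3; 7; 0] (4 * k + r) -
    (if 4 * k + r == 13 then (pos R i : nat) else
     if 4 * k + r == 14 then (neg R i : nat) else 0)
  else 0.
Definition hcost (r k : nat) : nat :=
  if nth false [:: false; false; false; false; true; true; true; false;
                 false; false; false; false; true; true; true; false] (4 * k + r)
  then 1 else hard.
(** Between rows 1, 2, 3 the weight equals the domino sum and forces complementary dominoes. The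
    weight 2 above and below row 0 of a variable leaves a slack of 1 between the bit and the block
    value. The weight 0 below row 3 of the bus separates the clauses. *)
Definition vweight r i k : nat :=
  if (k < 2) || (i < n) then
    nth 0 [:: 4; 4; 4; 0; 4; 4; 4; 0; 2; 3; 3; 2; 2; 3; 3; 2] (4 * k + r)
  else 0.
(** Row 0 carries the bus gadget. At either end of a clause one of its two edges is hard, which
    forces the bus to start at 0 and to end at 4. *)
Definition vcost (r i k : nat) : nat :=
  if (r == 0) && ((k == 0) && (0 < i) || (k == 1) && (i < n)) then 1 else hard.

Definition hw p := hweight (clause_of p) (row_of p) (var_of p) (col_of p).
Definition hc p := hcost (row_of p) (col_of p).
Definition vw p := vweight (row_of p) (var_of p) (col_of p).
Definition vc p := vcost (row_of p) (var_of p) (col_of p).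

Definition pay (c x w : nat) := if x < w then c else 0.
Definition viol (y : nat -> nat) p :=
  pay (hc p) (y p + y p.+1) (hw p) + pay (vc p) (y p + y (p + W)) (vw p).

(** Positions outside the grid get the label 9, which satisfies every edge. *)
Definition solution (y : nat -> nat) :=
  [/\ forall p, m * (4 * W) <= p -> y p = 9,
      \sum_(p < m * (4 * W)) y p < threshold_of &
      \sum_(p < m * (4 * W)) viol y p <= budget_of].

Lemma placeS R r i k : (place R r i k).+1 = place R r i k.+1.
Proof. by rewrite /place !addnS. Qed.
Lemma place4 R r i : place R r i 4 = place R r i.+1 0.
Proof. by rewrite /place; congr (_ + _); lia. Qed.
Lemma placeW R r i k : place R r i k + W = place R r.+1 i k.
Proof. by rewrite /place !addnS mulSn; lia. Qed.
Lemma place4r R i k : place R 4 i k = place R.+1 0 i k.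
Proof. by rewrite /place; congr (_ * _ + _); lia. Qed.

Lemma viol_place y R r i k : r < 4 -> k < 4 -> 4 * i + k < W ->
  viol y (place R r i k) =
  pay (hcost r k) (y (place R r i k) + y (place R r i k.+1)) (hweight R r i k) +
  pay (vcost r i k) (y (place R r i k) + y (place R r.+1 i k)) (vweight r i k).
Proof.
move=> r4 k4 H; have [E1 E2 E3 E4] := place_decode R r4 k4 H.
by rewrite /viol /hw /hc /vw /vc E1 E2 E3 E4 placeS placeW.
Qed.

Section Weights.
Hypothesis m_gt0 : 0 < m.
Let n' := (m * (4 * W)).-1.

Lemma cells_gt0 : m * (4 * W) = n'.+1.
Proof. by rewrite /n' prednK // !muln_gt0 m_gt0 W_gt0. Qed.
Lemma W_le : W <= n'.
Proof. by rewrite -ltnS -cells_gt0; have := leq_mul m_gt0 (leqnn (4 * W)); have := W_gt0; lia. Qed.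
Lemma W_gt2 : 2 < W. Proof. by rewrite /W addn3. Qed.
Lemma W_odd : odd W. Proof. by rewrite /W oddD oddM. Qed.

Definition eweight (e : 'I_(n' + (n'.+1 - W))) := if e < n' then hw e else vw (e - n').
Definition ecost (e : 'I_(n' + (n'.+1 - W))) := if e < n' then hc e else vc (e - n').

Lemma hw_le p : hw p <= 7.
Proof.
rewrite /hw /hweight; case: ifP => // _; apply: leq_trans (leq_subr _ _) _.
by move: (4 * _ + _); do 16 (case=> //); move=> j; rewrite /= nth_nil.
Qed.
Lemma vw_le p : vw p <= 4.
Proof.
rewrite /vw /vweight; case: ifP => // _.
by move: (4 * _ + _); do 16 (case=> //); move=> j; rewrite /= nth_nil.
Qed.

Lemma pay_ge c x w : w <= x -> pay c x w = 0.
Proof. by rewrite /pay ltnNge => ->. Qed.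

(** Summing over cells also counts edges that the helix does not have, namely those leaving the
    grid. They end at a label 9, which exceeds every weight, so they cost nothing. *)
Lemma sum_viol y : (forall p, m * (4 * W) <= p -> y p = 9) ->
  \sum_(p < m * (4 * W)) viol y p =
  \sum_(e < n' + (n'.+1 - W)) pay (ecost e)
    (y (helix_tail n' e) + y (helix_head n' W e)) (eweight e).
Proof.
move=> y9; rewrite big_split_ord /= big_split /=; congr (_ + _).
  rewrite cells_gt0 big_ord_recr /= [X in _ + X]pay_ge ?addn0; last first.
    by rewrite (y9 n'.+1) ?cells_gt0 //; have := hw_le n'; lia.
  apply: eq_bigr => p _.
  by rewrite /eweight /ecost /helix_tail /helix_head /= ltn_ord.
have E : m * (4 * W) = (n'.+1 - W) + W by rewrite cells_gt0; have := W_le; lia.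
rewrite E big_split_ord /= [X in _ + X]big1 ?addn0; last first.
  move=> i _; rewrite pay_ge // (y9 (_ + W)); last by rewrite E; lia.
  by have := vw_le (n'.+1 - W + i); lia.
apply: eq_bigr => p _.
by rewrite /eweight /ecost /helix_tail /helix_head /= ltnNge leq_addr /= !addKn.
Qed.

(** The interdiction set may be taken to consist of exactly the uncovered edges, so that only the
    labels remain to be chosen. *)
Lemma layout_nuE :
  nuE (@helix_ends n' W) eweight ecost budget_of < threshold_of <->
  exists y, solution y.
Proof.
have bip := helix_bipartite W_gt2 W_odd W_le.
split=> [/(nuE_ltP _ _ _ _ bip)[I [y0 [cI sy cov]]]|[y [y9 sy sv]]].
  pose y p := if p < n'.+1 then y0 (inord p) else 9.
  have yE (v : 'I_n'.+1) : y v = y0 v by rewrite /y ltn_ord inord_val.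
  exists y; split.
  - by move=> p; rewrite cells_gt0 => H; rewrite /y ltnNge H.
  - by rewrite cells_gt0; under eq_bigr => p _ do rewrite yE.
  rewrite sum_viol; last by move=> p; rewrite cells_gt0 => H; rewrite /y ltnNge H.
  apply: leq_trans cI; rewrite [X in _ <= X]big_mkcond /=; apply: leq_sum => e _.
  rewrite -(helix_ends1 W_gt2 W_odd W_le) -(helix_ends2 W_gt2 W_odd W_le) !yE.
  case: (boolP (I e)) => [_|/cov H]; first by rewrite /pay; case: ifP.
  by rewrite pay_ge.
apply/(nuE_ltP _ _ _ _ bip).
exists (fun e : 'I_(n' + (n'.+1 - W)) => y (helix_tail n' e) + y (helix_head n' W e) < eweight e).
exists (fun v : 'I_n'.+1 => y v); split.
- by rewrite big_mkcond /= -sum_viol.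
- by move: sy; rewrite cells_gt0.
- move=> e; rewrite -leqNgt.
  by rewrite -(helix_ends1 W_gt2 W_odd W_le) -(helix_ends2 W_gt2 W_odd W_le).
Qed.
End Weights.

Definition lit (a : nat -> bool) R i := pos R i && a i || neg R i && ~~ a i.
Definition satisfies a := forall R, R < m -> exists2 i, i < n & lit a R i.

(** * From a satisfying assignment to labels *)

Section Completeness.
Variable a : nat -> bool.
Hypothesis sat_a : satisfies a.

Definition seen R i := has (lit a R) (iota 0 i).
Definition busv R i := if seen R i then 4 else 0.
(** A domino of sum 3 holds the value of the variable together with the bit
    [seen] that enters the block. *)
Definition blockv R i := if a i then 2 + seen R i else ~~ seen R i : nat.
(** Dominoes are mirrored from each row to the next, as the hard vertical edges demand: below row 0
    the value is in the right cell of odd rows and in the left cell of even rows. *)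
Definition labelv R r i k :=
  if r == 0 then
    if i < n then nth 0 [:: 0; 0; 2 * a i; 2 - 2 * a i] k else 0
  else if k == 0 then (if odd r then 4 - busv R i else busv R i)
  else if k == 1 then (if odd r then busv R i else 4 - busv R i)
  else if i < n then
    (if k == 2 then (if odd r then 3 - blockv R i else blockv R i)
     else (if odd r then blockv R i else 3 - blockv R i))
  else 0.
Definition labels p :=
  if p < m * (4 * W) then labelv (clause_of p) (row_of p) (var_of p) (col_of p)
  else 9.

Lemma place_lt R r i k : r < 4 -> 4 * i + k < W ->
  (place R r i k < m * (4 * W)) = (R < m).
Proof.
move=> r4 H; rewrite /place [m * _]mulnA -ltn_divLR ?W_gt0 //.
by rewrite divnMDl ?W_gt0 // (divn_small H) addn0; lia.
Qed.

Lemma labels_place R r i k : r < 4 -> k < 4 -> 4 * i + k < W ->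
  labels (place R r i k) = if R < m then labelv R r i k else 9.
Proof.
move=> r4 k4 H; rewrite /labels place_lt //.
by have [-> -> -> ->] := place_decode R r4 k4 H.
Qed.

Lemma W_col i k : i < n -> k < 4 -> 4 * i + k < W. Proof. by rewrite /W; lia. Qed.
Lemma W_last k : k < 3 -> 4 * n + k < W. Proof. by rewrite /W; lia. Qed.
Lemma W_next i : i < n -> 4 * i.+1 + 0 < W. Proof. by rewrite /W; lia. Qed.

Lemma seenS R i : seen R i.+1 = seen R i || lit a R i.
Proof. by rewrite /seen -addn1 iotaD has_cat /= orbF. Qed.

Lemma block_cost R i : R < m -> i < n ->
  sum4 (fun r => sum4 (fun k => viol labels (place R r i k))) <= 4.
Proof.
move=> Rm lt_in.
have C k : k < 4 -> 4 * i + k < W by exact: W_col.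
have C' := W_next lt_in.
rewrite /sum4 !viol_place ?C // !place4 !place4r !labels_place ?C ?C' //.
rewrite Rm /labelv /= lt_in /busv /blockv seenS /lit.
(* The first column is special: one of its bus edges is hard, and it is covered because nothing has
   been seen yet. *)
have s0 : 0 < i \/ i = 0 /\ seen R i = false by case: (i) => [|j]; [right|left].
rewrite /pay /hweight /hcost /vweight /vcost /= lt_in /=.
have [-> |[-> s0']] := s0.
  by case: (i.+1 < n); case: (R.+1 < m); case: (a i); case: (pos R i); case: (neg R i); case: (seen R i); vm_compute.
by rewrite s0' /=; case: (1 < n); case: (R.+1 < m); case: (a 0); case: (pos R 0); case: (neg R 0); vm_compute.
Qed.

Lemma viol_last y R r : r < 4 -> viol y (place R r n 2) = 0.
Proof.
move=> r4; rewrite viol_place //; last exact: W_last.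
by rewrite /hweight /vweight ltnn.
Qed.

(** The only place where satisfaction of the clause matters: a true literal brings the bus to 4,
    which covers the hard edge at the right end and leaves a single edge of cost 1 to pay for. *)
Lemma last_cost R : R < m ->
  sum4 (fun r => viol labels (place R r n 0) + viol labels (place R r n 1) +
                 viol labels (place R r n 2)) <= 1.
Proof.
move=> Rm.
have C k : k < 3 -> 4 * n + k < W by exact: W_last.
have seenR : seen R n.
  have [i lt_in li] := sat_a Rm; apply/hasP; exists i => //.
  by rewrite mem_iota.
have n0 : 0 < n by case: (n) seenR.
rewrite /sum4 !viol_last // !viol_place ?C // !place4r !labels_place ?C //.
rewrite Rm /labelv /= ltnn /busv seenR /pay /hweight /hcost /vweight /vcost /= ltnn n0.
by case: (R.+1 < m); vm_compute.
Qed.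

Lemma block_labels R i : R < m -> i < n ->
  sum4 (fun r => sum4 (fun k => labels (place R r i k))) = 23.
Proof.
move=> Rm lt_in.
have C k : k < 4 -> 4 * i + k < W by exact: W_col.
rewrite /sum4 !labels_place ?C // Rm /labelv /= lt_in /busv /blockv.
by case: (a i); case: (seen R i); vm_compute.
Qed.

Lemma last_labels R : R < m ->
  sum4 (fun r => labels (place R r n 0) + labels (place R r n 1) +
                 labels (place R r n 2)) = 12.
Proof.
move=> Rm.
have C k : k < 3 -> 4 * n + k < W by exact: W_last.
rewrite /sum4 !labels_place ?C // Rm /labelv /= ltnn /busv.
by case: (seen R n); vm_compute.
Qed.

Lemma solution_labels : solution labels.
Proof.
split=> [p|| ].
- by rewrite /labels ltnNge => ->.
- rewrite sum_place /threshold_of ltnS.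
  rewrite (eq_bigr (fun=> 23 * n + 12)) => [|R _]; first by rewrite sum_nat_const card_ord.
  rewrite (eq_bigr (fun=> 23)) => [|i _]; last by rewrite block_labels.
  by rewrite sum_nat_const card_ord last_labels // mulnC.
- rewrite sum_place /budget_of.
  apply: (@leq_trans (\sum_(R < m) (4 * n + 1))); last by rewrite sum_nat_const card_ord.
  apply: leq_sum => R _; apply: leq_add; last exact: last_cost.
  apply: (@leq_trans (\sum_(i < n) 4)); last by rewrite sum_nat_const card_ord mulnC.
  by apply: leq_sum => i _; exact: block_cost.
Qed.
End Completeness.

(** * From labels to a satisfying assignment *)

Section Soundness.
Variable y : nat -> nat.
Hypothesis sol_y : solution y.

Definition Y R r i k := y (place R r i k).

Lemma viol_le R r i k : R < m -> r < 4 -> k < 4 -> 4 * i + k < W ->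
  viol y (place R r i k) <= budget_of.
Proof.
move=> Rm r4 k4 H; have [_ _] := sol_y; apply: leq_trans.
have L : place R r i k < m * (4 * W) by rewrite place_lt.
by rewrite (bigD1 (Ordinal L)) //= leq_addr.
Qed.

Lemma hard_h R r i k : R < m -> r < 4 -> k < 4 -> 4 * i + k < W ->
  hcost r k = hard -> hweight R r i k <= Y R r i k + Y R r i k.+1.
Proof.
move=> Rm r4 k4 H E; have := viol_le Rm r4 k4 H; rewrite viol_place // E {1}/pay.
by case: ltnP => // _; rewrite /hard => H'; exfalso; move: H'; lia.
Qed.

Lemma hard_v R r i k : R < m -> r < 4 -> k < 4 -> 4 * i + k < W ->
  vcost r i k = hard -> vweight r i k <= Y R r i k + Y R r.+1 i k.
Proof.
move=> Rm r4 k4 H E; have := viol_le Rm r4 k4 H; rewrite viol_place // E {2}/pay.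
by case: ltnP => // _; rewrite /hard => H'; exfalso; move: H'; lia.
Qed.

Lemma domino0 R i : R < m -> i < n -> 2 <= Y R 0 i 2 + Y R 0 i 3.
Proof.
move=> Rm lt_in; have := @hard_h R 0 i 2 Rm isT isT (@W_col i 2 lt_in isT) erefl.
by rewrite /hweight lt_in.
Qed.

Lemma domino_bus R r i : R < m -> 0 < r < 4 -> 4 * i < W ->
  4 <= Y R r i 0 + Y R r i 1.
Proof.
move=> Rm r4 H; rewrite -[4 * i]addn0 in H.
have := @hard_h R r i 0 Rm _ isT H; case: r r4 => [|[|[|[|r]]]] //= _ h; exact: (h isT erefl).
Qed.

Lemma domino_block R r i : R < m -> 0 < r < 4 -> i < n ->
  3 <= Y R r i 2 + Y R r i 3.
Proof.
move=> Rm r4 lt_in.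
have := @hard_h R r i 2 Rm _ isT (@W_col i 2 lt_in isT); rewrite /hweight lt_in.
by case: r r4 => [|[|[|[|r]]]] //= _ h; exact: (h isT erefl).
Qed.

Lemma bus_lt i : i <= n -> 4 * i < W. Proof. by rewrite /W; lia. Qed.

(** The hard domino edges are disjoint and their weights add up to one less than the threshold, so
    no block can exceed its lower bound. *)
Lemma tight R : R < m ->
  (forall i, i < n -> sum4 (fun r => sum4 (Y R r i)) = 23) /\
  sum4 (fun r => Y R r n 0 + Y R r n 1 + Y R r n 2) = 12.
Proof.
have B S i : S < m -> i < n -> 23 <= sum4 (fun r => sum4 (Y S r i)).
  move=> Sm lt_in; have := domino0 Sm lt_in.
  have := @domino_bus S 1 i Sm isT (bus_lt (ltnW lt_in)).
  have := @domino_bus S 2 i Sm isT (bus_lt (ltnW lt_in)).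
  have := @domino_bus S 3 i Sm isT (bus_lt (ltnW lt_in)).
  have := @domino_block S 1 i Sm isT lt_in.
  have := @domino_block S 2 i Sm isT lt_in.
  have := @domino_block S 3 i Sm isT lt_in.
  by rewrite /sum4; clear; lia.
have L S : S < m -> 12 <= sum4 (fun r => Y S r n 0 + Y S r n 1 + Y S r n 2).
  move=> Sm.
  have := @domino_bus S 1 n Sm isT (bus_lt (leqnn n)).
  have := @domino_bus S 2 n Sm isT (bus_lt (leqnn n)).
  have := @domino_bus S 3 n Sm isT (bus_lt (leqnn n)).
  by rewrite /sum4; clear; lia.
move=> Rm; have [_ + _] := sol_y; rewrite sum_place /threshold_of ltnS => T.
pose f (S : 'I_m) := 23 * n + 12.
pose g (S : 'I_m) := \sum_(i < n) sum4 (fun r => sum4 (Y S r i)) +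
   sum4 (fun r => Y S r n 0 + Y S r n 1 + Y S r n 2).
have B' (S : 'I_m) : 23 * n <= \sum_(i < n) sum4 (fun r => sum4 (Y S r i)).
  apply: (@leq_trans (\sum_(i < n) 23)); first by rewrite sum_nat_const card_ord mulnC.
  by apply: leq_sum => i _; exact: B.
have fg S : f S <= g S by apply: leq_add; [exact: B'|exact: L].
have T' : \sum_S g S <= \sum_S f S by rewrite sum_nat_const card_ord.
have E := sum_ord_tight fg T' (Ordinal Rm).
have LR := L R Rm; have BR := B' (Ordinal Rm).
have E1 : sum4 (fun r => Y R r n 0 + Y R r n 1 + Y R r n 2) = 12.
  by move: E LR BR; rewrite /g /f /=; clear; lia.
split=> // i lt_in.
have E2 : \sum_(j < n) sum4 (fun r => sum4 (Y R r j)) <= \sum_(j < n) 23.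
  move: E; rewrite /g /f /= E1 sum_nat_const card_ord => /eqP.
  by rewrite eqn_add2r mulnC => /eqP ->.
exact: (@sum_ord_tight n (fun=> 23) (fun j => sum4 (fun r => sum4 (Y R r j)))
   (fun j => B R j Rm (ltn_ord j)) E2 (Ordinal lt_in)).
Qed.

(** The three values are read in cells where [labels] stores them without complement. *)
Definition bus R i := Y R 1 i 1.
Definition block R i := Y R 1 i 3.
Definition bit R i := Y R 0 i 2.

(** Without slack the cells outside the dominoes are 0, and the vertical edges in the two columns
    bound the value of a row by that of the next row from both sides. *)
Lemma bus_column R i : R < m -> i <= n ->
  [/\ Y R 0 i 0 = 0, Y R 0 i 1 = 0, Y R 1 i 0 + bus R i = 4,
      Y R 2 i 0 = bus R i /\ Y R 2 i 1 + bus R i = 4 &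
      Y R 3 i 0 + bus R i = 4 /\ Y R 3 i 1 = bus R i].
Proof.
move=> Rm le_in; have [T1 T2] := tight Rm.
have D1 := @domino_bus R 1 i Rm isT (bus_lt le_in).
have D2 := @domino_bus R 2 i Rm isT (bus_lt le_in).
have D3 := @domino_bus R 3 i Rm isT (bus_lt le_in).
have C k : k < 2 -> 4 * i + k < W by rewrite /W; lia.
have V10 := @hard_v R 1 i 0 Rm isT isT (C 0 isT) erefl.
have V11 := @hard_v R 1 i 1 Rm isT isT (C 1 isT) erefl.
have V20 := @hard_v R 2 i 0 Rm isT isT (C 0 isT) erefl.
have V21 := @hard_v R 2 i 1 Rm isT isT (C 1 isT) erefl.
rewrite /vweight /= in V10 V11 V20 V21.
have [S00 S01 S1 S2 S3] : [/\ Y R 0 i 0 = 0, Y R 0 i 1 = 0, Y R 1 i 0 + Y R 1 i 1 = 4,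
   Y R 2 i 0 + Y R 2 i 1 = 4 & Y R 3 i 0 + Y R 3 i 1 = 4].
  move: le_in D1 D2 D3; rewrite leq_eqVlt => /orP[/eqP E|lt_in].
    by rewrite E; move: T2; rewrite /sum4; clear=> *; split; lia.
  have := T1 i lt_in; have := domino0 Rm lt_in.
  have := @domino_block R 1 i Rm isT lt_in.
  have := @domino_block R 2 i Rm isT lt_in.
  have := @domino_block R 3 i Rm isT lt_in.
  by rewrite /sum4; clear=> *; split; lia.
rewrite /bus; move: S00 S01 S1 S2 S3 V10 V11 V20 V21; clear=> *; split; lia.
Qed.

Lemma block_column R i : R < m -> i < n ->
  [/\ bit R i + Y R 0 i 3 = 2, Y R 1 i 2 + block R i = 3,
      Y R 2 i 2 = block R i /\ Y R 2 i 3 + block R i = 3,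
      Y R 3 i 2 + block R i = 3 /\ Y R 3 i 3 = block R i &
      bit R i <= block R i <= (bit R i).+1].
Proof.
move=> Rm lt_in; have [T1 _] := tight Rm.
have le_in := ltnW lt_in.
have D1 := @domino_bus R 1 i Rm isT (bus_lt le_in).
have D2 := @domino_bus R 2 i Rm isT (bus_lt le_in).
have D3 := @domino_bus R 3 i Rm isT (bus_lt le_in).
have C k : k < 4 -> 4 * i + k < W by exact: W_col.
have V02 := @hard_v R 0 i 2 Rm isT isT (C 2 isT) erefl.
have V03 := @hard_v R 0 i 3 Rm isT isT (C 3 isT) erefl.
have V10 := @hard_v R 1 i 2 Rm isT isT (C 2 isT) erefl.
have V11 := @hard_v R 1 i 3 Rm isT isT (C 3 isT) erefl.
have V20 := @hard_v R 2 i 2 Rm isT isT (C 2 isT) erefl.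
have V21 := @hard_v R 2 i 3 Rm isT isT (C 3 isT) erefl.
rewrite /vweight /= lt_in /= in V02 V03 V10 V11 V20 V21.
have [S0 S1 S2 S3] : [/\ Y R 0 i 2 + Y R 0 i 3 = 2, Y R 1 i 2 + Y R 1 i 3 = 3,
   Y R 2 i 2 + Y R 2 i 3 = 3 & Y R 3 i 2 + Y R 3 i 3 = 3].
  have := T1 i lt_in; have := domino0 Rm lt_in.
  have := @domino_block R 1 i Rm isT lt_in.
  have := @domino_block R 2 i Rm isT lt_in.
  have := @domino_block R 3 i Rm isT lt_in.
  by move: D1 D2 D3; rewrite /sum4; clear=> *; split; lia.
rewrite /bit /block; move: S0 S1 S2 S3 V02 V03 V10 V11 V20 V21; clear=> *; split; lia.
Qed.

Lemma bus_first R : R < m -> bus R 0 = 0.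
Proof.
move=> Rm; have [H _ + _ _] := bus_column Rm (leq0n n).
have C : 4 * 0 + 0 < W by rewrite /W; lia.
have := @hard_v R 0 0 0 Rm isT isT C erefl; rewrite /vweight /= H; clear; lia.
Qed.

Lemma bus_last R : R < m -> bus R n = 4.
Proof.
move=> Rm; have [_ H E _ _] := bus_column Rm (leqnn n).
have C : 4 * n + 1 < W by rewrite /W; lia.
have := @hard_v R 0 n 1 Rm isT isT C; rewrite /vcost ltnn => /(_ erefl).
by rewrite /vweight /= H; move: E; rewrite /bus; clear; lia.
Qed.

(** In terms of the three values, a gadget has only one violation iff, respectively, [bit] is 0 or
    2; [bus] is 0 or 4; [block] differs from the bus on its left; and the bus on the right minus
    [block] is at most [1 + pos] or at least [4 - neg]. *)
Definition soft_bit R i : nat :=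
  (Y R 0 i 1 + Y R 0 i 2 < 2) + (Y R 0 i 3 + Y R 0 i 4 < 2).
Definition soft_bus R i : nat :=
  (Y R 0 i 0 + Y R 1 i 0 < 4) + (Y R 0 i 1 + Y R 1 i 1 < 4).
Definition soft_left R i : nat :=
  (Y R 1 i 1 + Y R 1 i 2 < 4) + (Y R 2 i 1 + Y R 2 i 2 < 5).
Definition soft_right R i : nat :=
  (Y R 1 i 3 + Y R 1 i 4 < 3 - pos R i) + (Y R 2 i 3 + Y R 2 i 4 < 7 - neg R i).

Lemma pay_ge1 c x w : 0 < c -> (x < w : nat) <= pay c x w.
Proof. by rewrite /pay; case: ifP. Qed.

Lemma vcost_gt0 r i k : 0 < vcost r i k.
Proof. by rewrite /vcost; case: ifP. Qed.

(** Positive costs suffice here, so the hard bus edge of the first column needs no separate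
    treatment. *)
Lemma soft_le R i : R < m -> i < n ->
  soft_bit R i + soft_bus R i + (soft_left R i + soft_right R i) <=
  sum4 (fun r => sum4 (fun k => viol y (place R r i k))).
Proof.
move=> Rm lt_in.
have C k : k < 4 -> 4 * i + k < W by exact: W_col.
have H r k : r < 4 -> k < 4 -> hcost r k = 1 ->
    (Y R r i k + Y R r i k.+1 < hweight R r i k : nat) <= 
    pay (hcost r k) (Y R r i k + Y R r i k.+1) (hweight R r i k).
  by move=> _ _ E; apply: pay_ge1; rewrite E.
have V k := pay_ge1 (Y R 0 i k + Y R 1 i k) (vweight 0 i k) (vcost_gt0 0 i k).
have h01 := H 0 1 isT isT erefl; have h03 := H 0 3 isT isT erefl.
have h11 := H 1 1 isT isT erefl; have h13 := H 1 3 isT isT erefl.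
have h21 := H 2 1 isT isT erefl; have h23 := H 2 3 isT isT erefl.
have v0 := V 0; have v1 := V 1.
have E r k : r < 4 -> k < 4 -> viol y (place R r i k) =
   pay (hcost r k) (Y R r i k + Y R r i k.+1) (hweight R r i k) +
   pay (vcost r i k) (Y R r i k + Y R r.+1 i k) (vweight r i k).
  by move=> r4 k4; rewrite viol_place ?C.
rewrite /sum4 (E 0 0) // (E 0 1) // (E 0 3) // (E 1 1) // (E 1 3) // (E 2 1) // (E 2 3) //.
have e01 : hweight R 0 i 1 = 2 by rewrite /hweight lt_in.
have e03 : hweight R 0 i 3 = 2 by rewrite /hweight lt_in.
have e11 : hweight R 1 i 1 = 4 by rewrite /hweight lt_in.
have e21 : hweight R 2 i 1 = 5 by rewrite /hweight lt_in.
have e13 : hweight R 1 i 3 = 3 - pos R i by rewrite /hweight lt_in.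
have e23 : hweight R 2 i 3 = 7 - neg R i by rewrite /hweight lt_in.
have w0 : vweight 0 i 0 = 4 by [].
have w1 : vweight 0 i 1 = 4 by [].
rewrite e01 in h01 *; rewrite e03 in h03 *; rewrite e11 in h11 *.
rewrite e21 in h21 *; rewrite e13 in h13 *; rewrite e23 in h23 *.
rewrite w0 in v0 *; rewrite w1 in v1 *.
rewrite /soft_bit /soft_bus /soft_left /soft_right.
move: h01 h03 h11 h13 h21 h23 v0 v1.
do 8 (move: (nat_of_bool _) (pay _ _ _); move=> ? ?).
by clear; lia.
Qed.

Lemma soft_min R i : R < m -> i < n ->
  [/\ 1 <= soft_bit R i, 1 <= soft_bus R i, 1 <= soft_left R i & 1 <= soft_right R i].
Proof.
move=> Rm lt_in.
have [A1 A2 A3 [A4 A5] [A6 A7]] := bus_column Rm (ltnW lt_in).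
have [B1 B2 B3 [B4 B5] [B6 B7]] := bus_column Rm (lt_in : i.+1 <= n).
have [C1 C2 [C3 C4] [C5 C6] C7] := block_column Rm lt_in.
rewrite /soft_bit /soft_bus /soft_left /soft_right /Y !place4 -!/(Y R _ _ _).
rewrite -!/(bus R i) A1 A2 B1.
split.
- by move: C1; rewrite /bit; clear; lia.
- by move: A3; rewrite /bus; clear; lia.
- by rewrite -/(bus R i); move: A5 C2 C3; clear; lia.
- rewrite -/(block R i) -/(bus R i.+1) B4; move: C4 B3; clear.
  by case: (pos R i); case: (neg R i); lia.
Qed.

(** With the bus at 4 the left cell below row 0 holds 0, and the edge of weight 4 above it is lost.
    This is the summand 1 in [4 * n + 1]. *)
Lemma soft_last R : R < m ->
  1 <= sum4 (fun r => viol y (place R r n 0) + viol y (place R r n 1) +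
                      viol y (place R r n 2)).
Proof.
move=> Rm; have C : 4 * n + 0 < W by rewrite /W; lia.
have [A1 A2 A3 _ _] := bus_column Rm (leqnn n).
have E := bus_last Rm.
rewrite /sum4 (viol_place y R (isT : 0 < 4) (isT : 0 < 4) C) -!/(Y R _ _ _) A1.
have -> : Y R 1 n 0 = 0 by move: A3 E; clear; lia.
have : 1 <= pay (vcost 0 n 0) (0 + 0) (vweight 0 n 0).
  by apply: leq_trans (pay_ge1 _ _ (vcost_gt0 0 n 0)).
by clear; lia.
Qed.

Lemma soft_tight R i : R < m -> i < n ->
  [/\ soft_bit R i = 1, soft_bus R i = 1, soft_left R i = 1 & soft_right R i = 1].
Proof.
move=> Rm lt_in.
have B S j : S < m -> j < n -> 4 <= sum4 (fun r => sum4 (fun k => viol y (place S r j k))).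
  move=> Sm lt_jn; apply: leq_trans (soft_le Sm lt_jn).
  by have [] := soft_min Sm lt_jn; clear; lia.
have [_ _] := sol_y; rewrite sum_place /budget_of => T.
pose f (S : 'I_m) := 4 * n + 1.
pose g (S : 'I_m) := \sum_(i < n) sum4 (fun r => sum4 (fun k => viol y (place S r i k))) +
   sum4 (fun r => viol y (place S r n 0) + viol y (place S r n 1) + viol y (place S r n 2)).
have B' (S : 'I_m) : 4 * n <= \sum_(i < n) sum4 (fun r => sum4 (fun k => viol y (place S r i k))).
  apply: (@leq_trans (\sum_(i < n) 4)); first by rewrite sum_nat_const card_ord mulnC.
  by apply: leq_sum => j _; exact: B.
have fg S : f S <= g S by apply: leq_add; [exact: B'|exact: soft_last].
have T' : \sum_S g S <= \sum_S f S by rewrite sum_nat_const card_ord.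
have E := sum_ord_tight fg T' (Ordinal Rm).
have LR := soft_last Rm; have BR := B' (Ordinal Rm).
have E2 : \sum_(j < n) sum4 (fun r => sum4 (fun k => viol y (place R r j k))) <= \sum_(j < n) 4.
  rewrite sum_nat_const card_ord mulnC.
  by move: E LR BR; rewrite /g /f /=; clear; lia.
have E3 := @sum_ord_tight n (fun=> 4)
   (fun j => sum4 (fun r => sum4 (fun k => viol y (place R r j k))))
   (fun j => B R j Rm (ltn_ord j)) E2 (Ordinal lt_in).
have := soft_le Rm lt_in; rewrite /= in E3; rewrite E3.
by have [] := soft_min Rm lt_in; clear=> *; split; lia.
Qed.

(** Both bits are [block] or [block - 1], hence differ by at most 1; being 0 or 2, they agree. *)
Lemma bit_next R i : R.+1 < m -> i < n -> bit R.+1 i = bit R i.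
Proof.
move=> Rm lt_in; have Rm' := ltnW Rm.
have V2 := @hard_v R 3 i 2 Rm' isT isT (@W_col i 2 lt_in isT) erefl.
have V3 := @hard_v R 3 i 3 Rm' isT isT (@W_col i 3 lt_in isT) erefl.
rewrite /vweight /= lt_in /Y !place4r -!/(Y _ _ _ _) /= in V2 V3.
have [C1 C2 _ [C5 C6] C7] := block_column Rm' lt_in.
have [D1 _ _ _ _] := block_column Rm lt_in.
have [S1 _ _ _] := soft_tight Rm' lt_in; have [S2 _ _ _] := soft_tight Rm lt_in.
have [_ A1 _ _ _] := bus_column Rm' (ltnW lt_in).
have [A0 _ _ _ _] := bus_column Rm' (lt_in : i.+1 <= n).
have [_ B1 _ _ _] := bus_column Rm (ltnW lt_in).
have [B0 _ _ _ _] := bus_column Rm (lt_in : i.+1 <= n).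
rewrite /soft_bit A1 /Y place4 -!/(Y _ _ _ _) A0 in S1.
rewrite /soft_bit B1 /Y place4 -!/(Y _ _ _ _) B0 in S2.
by move: C1 C5 C6 C7 D1 S1 S2 V2 V3; rewrite /bit; clear; lia.
Qed.

Lemma bit_const R i : R < m -> i < n -> bit R i = bit 0 i.
Proof.
by move=> + lt_in; elim: R => // R IH Rm; rewrite bit_next // IH // ltnW.
Qed.

(** If no literal of the clause were true, the bus would stay at 0 up to the right end, where it is
    4. With bus 0 on the left, [soft_left] excludes block 0 and the hard edge [H31] excludes block
    3; from the unseen states 1 and 2, [soft_right] admits bus 4 on the right only through a true
    literal. *)
Lemma solution_satisfies : satisfies (fun i => bit 0 i == 2).
Proof.
move=> R Rm; pose a i := bit 0 i == 2.
case: (boolP (has (lit a R) (iota 0 n))) => [/hasP[i]|/hasPn none].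
  by rewrite mem_iota => lt_in li; exists i.
suff : bus R n = 0 by rewrite bus_last.
suff H i : i <= n -> bus R i = 0 by exact: H.
elim: i => [|i IH] lt_in; first exact: bus_first.
have bus0 := IH (ltnW lt_in).
have : ~~ lit a R i by apply: none; rewrite mem_iota.
rewrite /lit /a -(bit_const Rm lt_in).
have [A1 A2 A3 [A4 A5] [A6 A7]] := bus_column Rm (ltnW lt_in).
have [B1 B2 B3 [B4 B5] [B6 B7]] := bus_column Rm lt_in.
have [C1 C2 [C3 C4] [C5 C6] C7] := block_column Rm lt_in.
have [S1 _ S3 S4] := soft_tight Rm lt_in.
(* Column [n] has no block and hence no tight gadget; there the value of the bus is known from the
   hard edge. *)
have [_ S2 _ _] : [/\ true, soft_bus R i.+1 = 1 \/ i.+1 = n, true & true].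
  split=> //; move: lt_in; rewrite leq_eqVlt => /orP[/eqP|lt_in']; first by right.
  by left; have [] := soft_tight Rm lt_in'.
have Z4 : bus R i.+1 = 0 \/ bus R i.+1 = 4.
  case: S2 => [|->]; last by right; exact: bus_last.
  by rewrite /soft_bus B1 B2 -/(bus R i.+1); move: B3; clear; lia.
have H31 := @hard_h R 3 i 1 Rm isT isT (@W_col i 1 lt_in isT) erefl.
rewrite /hweight lt_in /= A7 bus0 in H31.
rewrite /soft_left -/(bus R i) bus0 C3 in S3; rewrite bus0 in A5.
rewrite /soft_bit A2 /Y place4 -!/(Y _ _ _ _) B1 in S1.
rewrite /soft_right /Y !place4 -!/(Y _ _ _ _) B4 -/(block R i) in S4.
rewrite -/(bit R i) in S1.
move: Z4 S1 S3 S4 A5 B3 C1 C2 C4 C5 C7 H31; clear.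
move: (bit R i) (block R i) (bus R i.+1) => b x z.
by case: (pos R i); case: (neg R i) => /=; rewrite ?andbF ?andbT ?orbF; lia.
Qed.
End Soundness.

Lemma layout_correct : (exists y, solution y) <-> exists a, satisfies a.
Proof.
split=> [[y Hy]|[a Ha]].
  by exists (fun i => bit y 0 i == 2); exact: solution_satisfies.
by exists (labels a); exact: solution_labels.
Qed.
End Layout.

(** * Cook-Levin formulas *)

Definition sat_cnf (a : nat -> bool) (phi : seq (seq (bool * nat))) :=
  all (has (fun l => a l.2 == l.1)) phi.

Section CookLevin.
Variable M : TM.
Let K := (ntapes M).+1.
Let sym : finType := option (bool + work M).
Let Cell : finType := (state M * {ffun 'I_K -> sym * sym})%type.

(** Cell [i] of a configuration holds the state and, for every tape, the
    symbols at distance [i] to the left and to the right of the head. *)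
Definition cell_at (c : config M) i : Cell :=
  (c.1, [ffun j => (nth None (c.2 j).1 i, nth None (c.2 j).2 i)]).

(** In head-centred coordinates every move shifts the whole tape, so that the new
    cell depends on the scanned cell [head] as well as on its neighbours.
    [p] is [0], [1] or [2], for the cells 0, 1 and all others. *)
Definition next_cell (p : nat) (head left here right : Cell) : Cell :=
  if halting head.1 then here else
  let r := delta head.1 [ffun j => (head.2 j).2] in
  (r.1, [ffun j => let a := r.2 j in
     match a.2 with
     | MoveL => ((right.2 j).1,
         match p with 0 => (here.2 j).1 | 1 => a.1 | _ => (left.2 j).2 end)
     | Stay => ((here.2 j).1, if p is 0 then a.1 else (here.2 j).2)
     | MoveR => (if p is 0 then a.1 else (left.2 j).1, (right.2 j).2)
     end]).

(** Three kinds of positions suffice: whatever the move, the written symbol ends at distance 0 or 1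
    from the head. *)
Lemma cell_at_step c i :
  cell_at (step c) i =
  next_cell (minn i 2) (cell_at c 0) (cell_at c i.-1) (cell_at c i) (cell_at c i.+1).
Proof.
rewrite /step /next_cell /=; case: ifP => // _.
have -> : [ffun j => ((cell_at c 0).2 j).2] = [ffun j => read (c.2 j)].
  by apply/ffunP => j; rewrite !ffunE /read nth0.
rewrite /cell_at /=; congr (_, _); apply/ffunP => j; rewrite !ffunE /act /=.
have -> : minn i 2 = if i is i'.+1 then (if i' is 0 then 1 else 2) else 0.
  by case: i => [|[|i]] //; apply/minn_idPr.
case: (_.2) => /=; rewrite ?nth_behead.
- by case: i => [|[|i]] //=; rewrite ?nth0 ?nth_behead.
- by case: i => [|i] //=; rewrite nth_behead; case: i.
- by case: i => [|i] //=; case: i.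
Qed.

Definition code (x : Cell) : nat := enum_rank x.
Let G := #|Cell|.

Lemma code_lt x : code x < G. Proof. exact: ltn_ord. Qed.
Lemma code_inj : injective code.
Proof. by move=> x y /ord_inj /enum_rank_inj. Qed.

Definition init_cell (o : option bool) : Cell :=
  (start M, [ffun j => (None, if j == ord0 then omap inl o else None)]).

Lemma cell_at_init x i :
  cell_at (init M x) i = init_cell (nth None [seq Some b | b <- x] i).
Proof.
rewrite /cell_at /init_cell /=; congr (_, _); apply/ffunP => j; rewrite !ffunE nth_nil.
congr (_, _); case: (j == ord0); last by rewrite nth_nil.
by elim: x i => [|b x IH] [|i] //=.
Qed.

(** The templates depend on the machine only. For the reduction they are constants, so neither their
    number nor the way to compute [code] matters. *)
Definition templates p : seq (seq nat) :=
  [seq [:: code q.1.1.1; code q.1.1.2; code q.1.2; code q.2;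
           code (next_cell p q.1.1.1 q.1.1.2 q.1.2 q.2)]
  | q : (Cell * Cell * Cell * Cell)%type].
Definition template_table := [:: templates 0; templates 1; templates 2].
(** Only the first output symbol is inspected; halting is guaranteed later by the choice of [T]. *)
Definition rejecting : seq nat :=
  [seq code x | x <- enum Cell & (fun x : Cell => (x.2 ord0).2 != Some (inl true) :> sym) x].

Variables (T Q : nat) (D : seq bool).
Hypothesis T_large : size D + Q <= T.

Definition variable t i a := (t * T.+1 + i) * G + a.

(** Transitions are Horn clauses: they propagate the computation forwards, and
    soundness does not need that a cell has a single content. *)
Definition transition t i (q : seq nat) : seq (bool * nat) :=
  [:: (false, variable t 0 (nth 0 q 0)); (false, variable t i.-1 (nth 0 q 1));
      (false, variable t i (nth 0 q 2)); (false, variable t i.+1 (nth 0 q 3));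
      (true, variable t.+1 i (nth 0 q 4))].
(** The input bit selects between two constants instead of being passed to [code], which keeps the
    clause within reach of the polynomial-time combinators. *)
Definition initial i : seq (bool * nat) :=
  if i < size D then
    [:: (true, variable 0 i
                 (if nth false D i then code (init_cell (Some true))
                  else code (init_cell (Some false))))]
  else if i < size D + Q then
    [:: (true, variable 0 i (code (init_cell (Some true))));
        (true, variable 0 i (code (init_cell (Some false))));
        (true, variable 0 i (code (init_cell None)))]
  else [:: (true, variable 0 i (code (init_cell None)))].
(** The guessed string ends at the first blank. *)
Definition contiguous i : seq (bool * nat) :=
  [:: (false, variable 0 i (code (init_cell None)));
      (true, variable 0 i.+1 (code (init_cell None)))].

Definition cnf : seq (seq (bool * nat)) :=
  flatten [seq flatten [seq [seq transition t i q | q <- nth [::] template_table (minn i 2)]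
                       | i <- iota 0 T] | t <- iota 0 T] ++
  ([seq initial i | i <- iota 0 T.+1] ++
   ([seq contiguous (size D + i) | i <- iota 0 (T - size D)] ++
    [seq [:: (false, variable T 0 a)] | a <- rejecting])).

Definition run_from y t := iter t (@step M) (init M (D ++ y)).
Definition accepts y := ((cell_at (run_from y T) 0).2 ord0).2 = Some (inl true).

Lemma mem_template p x0 x1 x2 x3 :
  [:: code x0; code x1; code x2; code x3; code (next_cell p x0 x1 x2 x3)] \in templates p.
Proof. by apply/imageP; exists (x0, x1, x2, x3). Qed.

Lemma template_minn i : nth [::] template_table (minn i 2) = templates (minn i 2).
Proof. by case: i => [|[|i]] //; rewrite /minn ltnNge. Qed.

Lemma sat_cnfP (a : nat -> bool) : reflect
  [/\ forall t i x0 x1 x2 x3, t < T -> i < T ->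
        a (variable t 0 (code x0)) -> a (variable t i.-1 (code x1)) ->
        a (variable t i (code x2)) -> a (variable t i.+1 (code x3)) ->
        a (variable t.+1 i (code (next_cell (minn i 2) x0 x1 x2 x3))),
      forall i, i <= T -> has (fun l => a l.2 == l.1) (initial i),
      forall i, size D <= i < T -> a (variable 0 i (code (init_cell None))) ->
        a (variable 0 i.+1 (code (init_cell None))) &
      forall x : Cell, a (variable T 0 (code x)) -> (x.2 ord0).2 = Some (inl true)]
  (sat_cnf a cnf).
Proof.
rewrite /sat_cnf /cnf !all_cat; apply: (iffP and4P) => -[H1 H2 H3 H4]; split.
- move=> t i x0 x1 x2 x3 tT iT a0 a1 a2 a3.
  have /allP/(_ (transition t i [:: code x0; code x1; code x2; code x3;
     code (next_cell (minn i 2) x0 x1 x2 x3)])) := H1.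
  rewrite /= a0 a1 a2 a3 /= orbF eqb_id; apply.
  apply/flattenP; exists (flatten [seq [seq transition t i q | q <- nth [::] template_table (minn i 2)]
                       | i <- iota 0 T]); first by apply: map_f; rewrite mem_iota.
  apply/flattenP; exists [seq transition t i q | q <- nth [::] template_table (minn i 2)].
    by apply/mapP; exists i; rewrite ?mem_iota.
  by rewrite template_minn; apply: map_f; exact: mem_template.
- move=> i iT; have /allP := H2; apply; apply: map_f; by rewrite mem_iota.
- move=> i /andP[Di iT] ai.
  have /allP/(_ (contiguous i)) := H3; rewrite /= ai /= orbF eqb_id; apply.
  by rewrite -(subnKC Di); apply: (map_f (fun i => contiguous (size D + i))); rewrite mem_iota; lia.
- move=> x ax; apply/eqP; apply: contraTT ax => nx.
  have /allP/(_ [:: (false, variable T 0 (code x))]) := H4; rewrite /= orbF => H.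
  rewrite -eqbF_neg; apply: H; apply: (map_f (fun a => [:: (false, variable T 0 a)])).
  by apply: map_f; rewrite mem_filter nx mem_enum.
- apply/allP => cl /flattenP[s1 /mapP[t]]; rewrite mem_iota add0n => /andP[_ tT] ->.
  move=> /flattenP[s2 /mapP[i]]; rewrite mem_iota add0n => /andP[_ iT] ->.
  rewrite template_minn => /mapP[q /imageP[[[[x0 x1] x2] x3] _ ->] ->] /=.
  have := H1 t i x0 x1 x2 x3 tT iT; rewrite orbF eqb_id !eqbF_neg.
  by do 4 (case: (a _) => //=; try (by move=> _; rewrite ?orbT)); move=> ->.
- apply/allP => cl /mapP[i]; rewrite mem_iota add0n => /andP[_ iT] ->; exact: H2.
- apply/allP => cl /mapP[i]; rewrite mem_iota add0n => /andP[_ iT] -> /=.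
  rewrite orbF eqb_id eqbF_neg -implybE; apply/implyP; apply: H3; lia.
- apply/allP => cl /mapP[b /mapP[x]]; rewrite mem_filter => /andP[nx _] -> -> /=.
  by rewrite orbF eqbF_neg; apply: contra nx => /H4 ->.
Qed.

(** The guess is cut at the first position whose blank variable holds. Before it one of the two bit
    variables holds, and [true] is preferred if both do; the run on this guess is then among the
    contents that [a] declares. *)
Lemma cnf_sound a : sat_cnf a cnf -> exists2 y, size y <= Q & accepts y.
Proof.
case/sat_cnfP => Htrans Hinit Hcontig Hfinal.
pose blank i := a (variable 0 i (code (init_cell None))).
pose len := find (fun k => blank (size D + k)) (iota 0 Q).
pose y := mkseq (fun k => a (variable 0 (size D + k) (code (init_cell (Some true))))) len.
have lenQ : len <= Q by rewrite -[Q](size_iota 0) find_size.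
have szy : size y = len by rewrite size_mkseq.
have blank_len : blank (size D + len).
  move: lenQ; rewrite leq_eqVlt => /orP[/eqP E|lt].
    have := Hinit (size D + len); rewrite E => /(_ T_large).
    by rewrite /initial ltnNge leq_addr /= ltnn /= orbF eqb_id.
  have : has (fun k => blank (size D + k)) (iota 0 Q) by rewrite has_find size_iota.
  by move/(nth_find 0); rewrite -/len nth_iota.
have blank_from i : size D + len <= i <= T -> blank i.
  elim: i => [|i IH] /andP[H1 H2]; first by move: H1 blank_len; rewrite leqn0 => /eqP ->.
  move: H1; rewrite leq_eqVlt => /orP[/eqP <- //|H1].
  by apply: Hcontig; [lia|apply: IH; lia].
have row0 i : i <= T -> a (variable 0 i (code (cell_at (run_from y 0) i))).
  move=> iT; rewrite cell_at_init; case: (ltnP i (size (D ++ y))) => H; last first.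
    rewrite nth_default ?size_map //; apply: blank_from.
    by rewrite iT andbT -szy -size_cat.
  rewrite (nth_map false) // nth_cat; have := Hinit i iT; rewrite /initial.
  case: (ltnP i (size D)) => HD.
    by rewrite /= orbF eqb_id; case: (nth false D i).
  have kl : i - size D < len by rewrite -szy; move: H; rewrite size_cat; lia.
  have -> : i < size D + Q by lia.
  rewrite /= orbF !eqb_id nth_mkseq // subnKC //.
  have /negbTE : ~~ blank i.
    have := before_find 0 kl; rewrite nth_iota ?add0n; last exact: leq_trans lenQ.
    by rewrite subnKC // => ->.
  by rewrite /blank => ->; rewrite orbF; case E: (a _); rewrite ?E //= => ->.
(* A cell depends on its right neighbour one step earlier and rows stop at [T], so the claim loses
   one cell per step. The remaining triangle just contains cell 0 at time [T]. *)
have rows t i : t + i <= T -> a (variable t i (code (cell_at (run_from y t) i))).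
  elim: t i => [|t IH] i H; first exact: row0.
  rewrite /run_from iterS cell_at_step -/(run_from y t).
  by apply: Htrans; try lia; apply: IH; lia.
exists y; first by rewrite szy.
by apply: Hfinal; apply: rows; rewrite addn0.
Qed.

Lemma variable_decode t i b : i <= T -> b < G ->
  [/\ variable t i b %% G = b, variable t i b %/ G %/ T.+1 = t &
      variable t i b %/ G %% T.+1 = i].
Proof.
move=> iT bG; rewrite /variable modnMDl modn_small //.
have G0 : 0 < G by case: (G) bG.
by rewrite divnMDl // (divn_small bG) addn0 divnMDl // divn_small // addn0 modnMDl modn_small.
Qed.

Lemma cnf_complete y : size y <= Q -> accepts y -> exists a, sat_cnf a cnf.
Proof.
move=> yQ acc.
pose a x := x %% G == code (cell_at (run_from y (x %/ G %/ T.+1)) (x %/ G %% T.+1)).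
have aE t i x : i <= T -> a (variable t i (code x)) = (x == cell_at (run_from y t) i).
  move=> iT; rewrite /a; have [-> -> ->] := variable_decode t iT (code_lt x).
  by rewrite (inj_eq code_inj).
exists a; apply/sat_cnfP; split.
- move=> t i x0 x1 x2 x3 tT iT; rewrite !aE //; try lia.
  by move=> /eqP -> /eqP -> /eqP -> /eqP ->; rewrite /run_from iterS cell_at_step eqxx.
- move=> i iT; rewrite /initial.
  have ci : cell_at (run_from y 0) i = init_cell (nth None [seq Some b | b <- D ++ y] i).
    exact: cell_at_init.
  case: ltnP => iD.
    rewrite /= orbF eqb_id; have := aE 0 i (init_cell (Some (nth false D i))) iT.
    rewrite ci (nth_map false) ?size_cat; last lia.
    by rewrite nth_cat iD eqxx; case: (nth false D i).
  case: ltnP => iQ; last first.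
    by rewrite /= orbF eqb_id aE // ci nth_default ?eqxx // size_map size_cat; lia.
  rewrite /= !orbF !eqb_id !aE // ci.
  by case: (nth None _ i) => [[]|]; rewrite eqxx ?orbT.
- move=> i /andP[Di iT]; rewrite !aE //; last lia.
  rewrite /run_from /= !cell_at_init.
  set s := map _ _; case: (ltnP i (size s)) => H.
    rewrite (nth_map false); last by move: H; rewrite size_map.
    move=> /eqP /(congr1 (fun x : Cell => (x.2 ord0).2)); rewrite !ffunE eqxx //.
  by rewrite !nth_default //; apply: leq_trans H _.
- by move=> x; rewrite aE // => /eqP ->.
Qed.

Definition num_vars := (T.+1 * T.+1) * G.

Lemma variable_lt t i b : t <= T -> i <= T -> b < G -> variable t i b < num_vars.
Proof.
move=> tT iT bG; rewrite /variable /num_vars.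
apply: (@leq_trans ((t * T.+1 + i).+1 * G)); first by rewrite mulSn; lia.
rewrite leq_mul2r; apply/orP; right.
by have := leq_mul tT (leqnn T.+1); rewrite mulSn; lia.
Qed.

Lemma cnf_vars cl l : cl \in cnf -> l \in cl -> l.2 < num_vars.
Proof.
have C x : code x < G := code_lt x.
rewrite /cnf !mem_cat => /or4P[].
- move=> /flattenP[s1 /mapP[t]]; rewrite mem_iota add0n => /andP[_ tT] ->.
  move=> /flattenP[s2 /mapP[i]]; rewrite mem_iota add0n => /andP[_ iT] ->.
  rewrite template_minn => /mapP[q /imageP[[[[x0 x1] x2] x3] _ ->] ->] /=.
  rewrite !inE; repeat case/orP; move/eqP ->; apply: variable_lt => //=; lia.
- move=> /mapP[i]; rewrite mem_iota add0n => /andP[_ iT] ->; rewrite /initial.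
  case: ifP => _; [|case: ifP => _]; rewrite !inE.
  + by move/eqP ->; apply: variable_lt => //; case: ifP.
  + by case/or3P => /eqP ->; apply: variable_lt.
  + by move/eqP ->; apply: variable_lt.
- move=> /mapP[i]; rewrite mem_iota add0n => /andP[_ iT] ->.
  by rewrite !inE => /orP[] /eqP ->; apply: variable_lt => //; lia.
- move=> /mapP[b /mapP[x _ ->] ->]; rewrite inE => /eqP ->.
  exact: variable_lt.
Qed.

(** A grid needs at least one row of blocks, and the budget has to be positive. *)
Lemma cnf_size_gt0 : 0 < size cnf.
Proof. by rewrite /cnf !size_cat [size [seq initial _ | _ <- _]]size_map size_iota; lia. Qed.
End CookLevin.

(** * Deciding planarity of a rotation system *)

(** Components of the graph of [f] and [g] on [0, ..., N - 1], found by propagating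
    the smallest number; they are counted by the numbers that keep their label. *)
Definition min_step N (f g : nat -> nat) (l : seq nat) :=
  [seq minn (nth 0 l d) (minn (nth 0 l (f d)) (nth 0 l (g d))) | d <- iota 0 N].
Definition min_labels N f g := iter N (min_step N f g) (iota 0 N).
Definition fixed_points N (l : seq nat) := count (fun d => nth 0 l d == d) (iota 0 N).

Section MinLabels.
Variables (D : finType) (N : nat) (num : D -> nat).
Hypothesis num_lt : forall d, num d < N.
Hypothesis num_inj : injective num.
Hypothesis num_onto : forall k, k < N -> exists d, num d = k.
Variables (F G : D -> D) (f g : nat -> nat).
Hypothesis fE : forall d, f (num d) = num (F d).
Hypothesis gE : forall d, g (num d) = num (G d).
Let e := [rel d d' | (F d == d') || (G d == d')].
Hypothesis sym_e : connect_sym e.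

Let lab i d := nth 0 (iter i (min_step N f g) (iota 0 N)) (num d).

Lemma lab0 d : lab 0 d = num d.
Proof. exact: (nth_iota 0 0 (num_lt d)). Qed.
Lemma labS i d : lab i.+1 d = minn (lab i d) (minn (lab i (F d)) (lab i (G d))).
Proof.
rewrite /lab iterS {1}/min_step (nth_map 0) ?size_iota ?num_lt //.
by rewrite (nth_iota 0 0 (num_lt d)) add0n fE gE.
Qed.

Lemma lab_reached i d : exists2 d', connect e d d' & lab i d = num d'.
Proof.
elim: i d => [|i IH] d; first by exists d; rewrite ?connect0 ?lab0.
have [d1 c1 E1] := IH d; have [d2 c2 E2] := IH (F d); have [d3 c3 E3] := IH (G d).
have cF : connect e d (F d) by apply: connect1; rewrite /= eqxx.
have cG : connect e d (G d) by apply: connect1; rewrite /= eqxx orbT.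
rewrite labS E1 E2 E3.
case: (leqP (num d1) (minn (num d2) (num d3))) => _; first by exists d1.
case: (leqP (num d2) (num d3)) => _.
- by exists d2 => //; exact: connect_trans cF c2.
- by exists d3 => //; exact: connect_trans cG c3.
Qed.

Lemma lab_le_path i d p : path e d p -> size p <= i -> lab i d <= num (last d p).
Proof.
elim: i d p => [|i IH] d [|d' p] //=.
- by rewrite lab0.
- move=> _ _; rewrite labS geq_min; apply/orP; left; exact: (IH d [::]).
- case/andP => /orP[/eqP <-|/eqP <-] pth sp; rewrite labS !geq_min.
    by rewrite (IH _ _ pth sp) orbT.
  by rewrite (IH _ _ pth sp) !orbT.
Qed.

Lemma perm_num : perm_eq [seq num d | d <- enum D] (iota 0 N).
Proof.
apply: uniq_perm => [||k]; [|exact: iota_uniq|].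
  by rewrite (map_inj_uniq num_inj); exact: enum_uniq.
rewrite mem_iota add0n; apply/mapP/idP => [[d _ ->]|/num_onto[d Ed]]; first exact: num_lt.
by exists d; rewrite ?mem_enum.
Qed.

Lemma card_num : #|D| = N.
Proof. by rewrite cardE -(size_map num) (perm_size perm_num) size_iota. Qed.

(** A path without repetitions has fewer than [N] edges, so [N] rounds reach everything. *)
Lemma lab_min d d' : connect e d d' -> lab N d <= num d'.
Proof.
case/connectP => p /shortenP[p' pth' up _] ->; apply: lab_le_path => //.
have := card_uniqP up; rewrite /= => E.
by have := max_card [in d :: p']; rewrite E card_num; exact: ltnW.
Qed.

Lemma lab_connect d d' : connect e d d' = (lab N d == lab N d').
Proof.
have le x y : connect e x y -> lab N x <= lab N y.
  move=> cxy; have [z cz ->] := lab_reached N y.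
  by apply: lab_min; exact: connect_trans cz.
apply/idP/eqP => [c|E].
  by apply/eqP; rewrite eqn_leq !le // sym_e.
have [x cx Ex] := lab_reached N d; have [y cy Ey] := lab_reached N d'.
have xy : x = y by apply: num_inj; rewrite -Ex E.
by apply: connect_trans cx _; rewrite xy sym_e.
Qed.

(** Each component contains exactly one element labelled by its own number, the smallest one; these
    are matched with the roots. *)
Lemma n_comp_min_labels : n_comp e predT = fixed_points N (min_labels N f g).
Proof.
rewrite /fixed_points -(seq.permP perm_num) count_map.
have -> : count (preim num (fun k => nth 0 (min_labels N f g) k == k)) (enum D) =
    #|[set d | lab N d == num d]|.
  rewrite cardE -size_filter; congr size.
  by rewrite {2}/enum_mem -enumT; apply: eq_filter => d; rewrite /= inE.
have rootlab d d' : root e d = root e d' -> lab N d = lab N d'.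
  by move/eqP; rewrite root_connect // lab_connect => /eqP.
have inj : {in [set d | lab N d == num d] &, injective (root e)}.
  move=> d d'; rewrite !inE => /eqP E /eqP E' /rootlab.
  by rewrite E E'; exact: num_inj.
rewrite -(card_in_imset inj); apply: eq_card => r; rewrite !inE andbT.
apply/idP/imsetP => [|[d _ ->]]; last exact: roots_root.
move=> rr; have [d cd Ed] := lab_reached N r; exists d.
  by rewrite inE -Ed eq_sym -lab_connect.
by apply/esym; rewrite -(eqP rr); apply/eqP; rewrite root_connect // sym_e.
Qed.
End MinLabels.

(** * Graph conditions as tests on edge and dart numbers *)

Section GraphChecks.
Variables (v m : nat) (ends : 'I_m -> 'I_v * 'I_v) (u w : nat -> nat).
Hypothesis uE : forall e : 'I_m, u e = (ends e).1.
Hypothesis wE : forall e : 'I_m, w e = (ends e).2.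

Lemma all_ord (P : nat -> bool) n : all P (iota 0 n) = [forall i : 'I_n, P i].
Proof.
apply/allP/forallP => [H i|H k]; first by apply: H; rewrite mem_iota add0n ltn_ord.
by rewrite mem_iota add0n => kn; exact: (H (Ordinal kn)).
Qed.

Definition simple_check (m : nat) (u w : nat -> nat) :=
  all (fun e => (u e != w e) && all (fun f => ((u e == u f) && (w e == w f) ||
     (u e == w f) && (w e == u f)) ==> (e == f)) (iota 0 m)) (iota 0 m).

Lemma ord_eqE n (i j : 'I_n) : (i == j) = (i == j :> nat). Proof. by []. Qed.

Lemma simple_checkE : simple_check m u w = simple_graph ends.
Proof.
rewrite /simple_check /simple_graph all_ord.
apply/forallP/andP => [H|[/forallP L /forallP H] e].
  split; apply/forallP => e; have /andP[L Hf] := H e.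
    by rewrite ord_eqE -uE -wE.
  apply/forallP => f; apply/implyP => /forallP I.
  rewrite all_ord in Hf; have /forallP/(_ f)/implyP := Hf; apply.
  have := I (ends e).1; have := I (ends e).2.
  by rewrite /incident !ord_eqE -!uE -!wE; move: L; lia.
apply/andP; split; first by rewrite uE wE -ord_eqE; exact: L.
rewrite all_ord; apply/forallP => f; apply/implyP => E.
have /forallP/(_ f)/implyP := H e; apply; apply/forallP => x.
by move: E; rewrite /incident !ord_eqE -!uE -!wE; lia.
Qed.

Definition bipartite_check (m : nat) (u w : nat -> nat) (col : seq bool) :=
  all (fun e => nth false col (u e) != nth false col (w e)) (iota 0 m).

Lemma bipartite_check_sound col : bipartite_check m u w col -> bipartite ends.
Proof.
rewrite /bipartite_check all_ord => /forallP H.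
apply/existsP; exists [set x : 'I_v | nth false col x]; apply/forallP => e.
by rewrite !inE -uE -wE.
Qed.

Lemma bipartite_check_complete : bipartite ends ->
  exists2 col, size col = v & bipartite_check m u w col.
Proof.
case/existsP => A /forallP H; exists [seq x \in A | x <- enum 'I_v].
  by rewrite size_map size_enum_ord.
rewrite /bipartite_check all_ord; apply/forallP => e; have := H e.
rewrite uE wE; have E (x : 'I_v) : nth false [seq x \in A | x <- enum 'I_v] x = (x \in A).
  by rewrite (nth_map x) ?size_enum_ord // nth_ord_enum.
by rewrite !E.
Qed.

(** Dart [(e, b)] gets the number [2 * e + b], so flipping toggles the parity. *)
Definition flip_num d := if odd d then d.-1 else d.+1.
Definition tail_num (u w : nat -> nat) d := if odd d then w d./2 else u d./2.

Definition perm_check (m : nat) (R : nat -> nat) :=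
  all (fun d => R d < m.*2) (iota 0 m.*2) &&
  all (fun d => all (fun d' => (R d == R d') ==> (d == d')) (iota 0 m.*2)) (iota 0 m.*2).

Definition rotation_check (m : nat) (u w : nat -> nat) (lab : seq nat) :=
  all (fun d => all (fun d' => (nth 0 lab d == nth 0 lab d') ==
    (tail_num u w d == tail_num u w d')) (iota 0 m.*2)) (iota 0 m.*2).

Definition euler_check (m : nat) (R : nat -> nat) :=
  fixed_points m.*2 (min_labels m.*2 R R) +
  fixed_points m.*2 (min_labels m.*2 (fun d => R (flip_num d)) (fun d => R (flip_num d))) ==
  m + 2 * fixed_points m.*2 (min_labels m.*2 R flip_num).

Definition planar_check (m : nat) (u w : nat -> nat) (R : nat -> nat) :=
  [&& perm_check m R, rotation_check m u w (min_labels m.*2 R R) & euler_check m R].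

Notation D := (dart 'I_m).
Definition dart_num (d : D) : nat := (nat_of_ord d.1).*2 + d.2.

Lemma dart_num_lt d : dart_num d < m.*2.
Proof. by case: d => e b; rewrite /dart_num /=; have := ltn_ord e; case: b; lia. Qed.
Lemma odd_dart_num d : odd (dart_num d) = d.2.
Proof. by rewrite /dart_num oddD odd_double; case: d.2. Qed.
Lemma half_dart_num d : (dart_num d)./2 = d.1 :> nat.
Proof. by rewrite /dart_num addnC half_bit_double. Qed.
Lemma dart_num_inj : injective dart_num.
Proof.
move=> d d' E; have := half_dart_num d; have := odd_dart_num d.
rewrite E odd_dart_num half_dart_num; case: d d' {E} => [e b] [e' b'] /= -> E.
by congr (_, _); apply: val_inj.
Qed.
Lemma dart_num_onto k : k < m.*2 -> exists d, dart_num d = k.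
Proof.
move=> H; have Hk : k./2 < m by rewrite ltn_half_double.
by exists (Ordinal Hk, odd k); rewrite /dart_num /= addnC odd_double_half.
Qed.
Lemma flip_dart_num d : flip_num (dart_num d) = dart_num (flip d).
Proof. by rewrite /flip_num odd_dart_num /dart_num; case: d => e [] /=; lia. Qed.
Lemma tail_dart_num d d' :
  (tail_num u w (dart_num d) == tail_num u w (dart_num d')) = (tail ends d == tail ends d').
Proof.
rewrite /tail_num !odd_dart_num !half_dart_num /tail ord_eqE.
by case: d.2; case: d'.2; rewrite ?uE ?wE.
Qed.

Lemma all_dart (P : nat -> bool) : all P (iota 0 m.*2) = [forall d : D, P (dart_num d)].
Proof.
apply/allP/forallP => [H d|H k]; first by apply: H; rewrite mem_iota add0n dart_num_lt.
by rewrite mem_iota add0n => /dart_num_onto[d <-].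
Qed.

Section WithRotation.
Variables (rot : {perm D}) (R : nat -> nat).
Hypothesis RE : forall d, R (dart_num d) = dart_num (rot d).

Lemma connect_sym_inj (F : D -> D) : injective F ->
  connect_sym [rel d d' | (F d == d') || (F d == d')].
Proof.
move=> iF x y; have E := fconnect_sym iF x y.
by rewrite -!(eq_connect (e := frel F)) // => a b /=; rewrite orbb.
Qed.

Lemma connect_sym_rot_flip :
  connect_sym [rel d d' | (rot d == d') || (flip d == d')].
Proof.
apply: relU_sym; first by apply: fconnect_sym; exact: perm_inj.
apply: fconnect_sym; apply: (@inv_inj _ (@flip 'I_m)) => -[x b].
by rewrite /flip /= negbK.
Qed.

Lemma fcard_labels (F : D -> D) f : injective F ->
  (forall d, f (dart_num d) = dart_num (F d)) ->
  fcard F predT = fixed_points m.*2 (min_labels m.*2 f f).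
Proof.
move=> iF fE; rewrite -(n_comp_min_labels dart_num_lt dart_num_inj dart_num_onto fE fE).
  by apply: eq_n_comp => x; apply: eq_connect => a b /=; rewrite orbb.
exact: connect_sym_inj.
Qed.

Lemma rotation_checkE :
  rotation_check m u w (min_labels m.*2 R R) = rotation_system ends rot.
Proof.
rewrite /rotation_check all_dart; apply: eq_forallb => d; rewrite all_dart.
apply: eq_forallb => d'; rewrite tail_dart_num; congr (_ == _).
have sR := connect_sym_inj (@perm_inj _ rot).
rewrite -(lab_connect dart_num_lt dart_num_inj dart_num_onto RE RE sR).
by apply: eq_connect => a b /=; rewrite orbb.
Qed.

Lemma euler_checkE : euler_check m R = planar_rotation rot.
Proof.
rewrite /euler_check /planar_rotation card_ord.
rewrite (fcard_labels (@perm_inj _ rot) RE).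
have iF : injective (rot \o @flip 'I_m).
  apply: inj_comp; first exact: perm_inj.
  by apply: (@inv_inj _ (@flip 'I_m)) => -[x b]; rewrite /flip /= negbK.
rewrite (fcard_labels (f := fun d => R (flip_num d)) iF); last first.
  by move=> d; rewrite flip_dart_num RE.
by rewrite (n_comp_min_labels dart_num_lt dart_num_inj dart_num_onto RE flip_dart_num connect_sym_rot_flip).
Qed.
End WithRotation.

Lemma planar_check_sound R : planar_check m u w R -> planar ends.
Proof.
case/and3P => /andP[]; rewrite !all_dart => /forallP Rlt /forallP Rinj.
have ex d : exists d' : D, dart_num d' == R (dart_num d).
  by have [d' <-] := dart_num_onto (Rlt d); exists d'.
pose F d := xchoose (ex d).
have FE d : R (dart_num d) = dart_num (F d) by apply/esym/eqP; exact: (xchooseP (ex d)).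
have iF : injective F.
  move=> d d' E; have := Rinj d; rewrite all_dart => /forallP/(_ d').
  by rewrite !FE E eqxx => /eqP/dart_num_inj.
have RE d : R (dart_num d) = dart_num (perm iF d) by rewrite permE.
rewrite (rotation_checkE RE) (euler_checkE RE) => rs pr.
by apply/existsP; exists (perm iF); rewrite rs pr.
Qed.

Lemma planar_check_complete : planar ends ->
  exists2 s : seq nat, size s = m.*2 /\ all (fun x => x < m.*2) s &
    planar_check m u w (nth 0 s).
Proof.
case/existsP => rot /andP[rs pr].
have ex k : k < m.*2 -> exists d : D, dart_num d == k.
  by move=> /dart_num_onto[d <-]; exists d.
pose R k := if k < m.*2 =P true is ReflectT H then dart_num (rot (xchoose (ex k H))) else 0.
have RE d : R (dart_num d) = dart_num (rot d).
  rewrite /R; case: eqP => [H|]; last by rewrite dart_num_lt.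
  congr (dart_num (rot _)); apply: dart_num_inj; apply/eqP; exact: (xchooseP (ex _ H)).
exists (mkseq R m.*2).
  split; first exact: size_mkseq.
  apply/allP => x /mapP[k]; rewrite mem_iota add0n => /dart_num_onto[d <-] ->.
  by rewrite RE dart_num_lt.
have RE' d : nth 0 (mkseq R m.*2) (dart_num d) = dart_num (rot d).
  by rewrite nth_mkseq ?dart_num_lt.
apply/and3P; split.
- apply/andP; rewrite !all_dart; split; apply/forallP => d; first by rewrite RE' dart_num_lt.
  rewrite all_dart; apply/forallP => d'; rewrite !RE'.
  by apply/implyP => /eqP/dart_num_inj/perm_inj ->.
- by rewrite (rotation_checkE RE').
- by rewrite (euler_checkE RE').
Qed.
End GraphChecks.

(** * Compiling stack programs to Turing machines *)

Inductive cmd :=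
| Push of 'I_4 & bool
| Pop of 'I_4
| Seq of cmd & cmd
| If of 'I_4 & (option bool -> bool) & cmd & cmd
| While of 'I_4 & (option bool -> bool) & cmd.

Definition store := seq (seq bool).

Notation stack st i := (nth [::] st (nat_of_ord i)).
Notation update st i v := (set_nth [::] st (nat_of_ord i) v).

(** The time is the exact number of steps of the compiled machine. *)
Inductive run : cmd -> store -> nat -> store -> Prop :=
| RPush i b st : run (Push i b) st 2 (update st i (b :: stack st i))
| RPop i st : run (Pop i) st 1 (update st i (behead (stack st i)))
| RSeq a b st t1 st1 t2 st2 :
    run a st t1 st1 -> run b st1 t2 st2 -> run (Seq a b) st (t1 + t2) st2
| RIf i f a b st t st' :
    run (if f (ohead (stack st i)) then a else b) st t st' ->
    run (If i f a b) st t.+1 st'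
| RWhileF i f a st : ~~ f (ohead (stack st i)) -> run (While i f a) st 1 st
| RWhileT i (f : option bool -> bool) a st t1 st1 t2 st2 :
    f (ohead (stack st i)) -> run a st t1 st1 ->
    run (While i f a) st1 t2 st2 -> run (While i f a) st (t1 + t2).+1 st2.

Definition sym : finType := option (bool + void).
Definition reads := {ffun 'I_4 -> sym}.
Definition action := 'I_4 -> sym * move.

Definition idle (r : reads) : action := fun i => (r i, Stay).
Definition act_on (r : reads) (j : 'I_4) (a : sym * move) : action :=
  fun i => if i == j then a else (r i, Stay).

Fixpoint St (c : cmd) : finType :=
  match c with
  | Push _ _ => bool
  | Pop _ => unit
  | Seq a b => (St a + St b)%type
  | If _ _ a b => (unit + (St a + St b))%type
  | While _ _ a => (unit + St a)%type
  end.

Fixpoint entry (c : cmd) : St c :=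
  match c return St c with
  | Push _ _ => false
  | Pop _ => tt
  | Seq a b => inl (entry a)
  | If _ _ a b => inl tt
  | While _ _ a => inl tt
  end.

Definition bit_of (s : sym) : option bool :=
  if s is Some (inl b) then Some b else None.

(** Next state [None] means leaving the command; the enclosing command decides where to continue.
    [Push] needs two steps, one to move left and one to write. *)
Fixpoint trans (c : cmd) : St c -> reads -> option (St c) * action :=
  match c return St c -> reads -> option (St c) * action with
  | Push i b => fun s r =>
      if s then (None, act_on r i (Some (inl b), Stay))
      else (Some true, act_on r i (r i, MoveL))
  | Pop i => fun _ r => (None, act_on r i (None, MoveR))
  | Seq a b => fun s r =>
      match s with
      | inl s => let: (o, x) := trans s r in
                 (if o is Some s' then Some (inl s') else Some (inr (entry b)), x)
      | inr s => let: (o, x) := trans s r in (omap inr o, x)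
      end
  | If i f a b => fun s r =>
      match s with
      | inl _ => (Some (inr (if f (bit_of (r i)) then inl (entry a)
                             else inr (entry b))), idle r)
      | inr (inl s) => let: (o, x) := trans s r in (omap (inr \o inl) o, x)
      | inr (inr s) => let: (o, x) := trans s r in (omap (inr \o inr) o, x)
      end
  | While i f a => fun s r =>
      match s with
      | inl _ => (if f (bit_of (r i)) then Some (inr (entry a)) else None, idle r)
      | inr s => let: (o, x) := trans s r in
                 (if o is Some s' then Some (inr s') else Some (inl tt), x)
      end
  end.

Definition machine (c : cmd) : TM :=
  @Build_TM 3 (option (St c)) void (Some (entry c)) (fun s => s == None)
    (fun s r => if s is Some s' then trans s' r else (None, idle r)).

Definition tapes := 'I_4 -> seq sym * seq sym.

Definition act_tape (a : sym * move) (t : seq sym * seq sym) :=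
  match a.2 with
  | MoveL => (behead t.1, head None t.1 :: a.1 :: behead t.2)
  | Stay => (t.1, a.1 :: behead t.2)
  | MoveR => (a.1 :: t.1, behead t.2)
  end.

Definition observe (T : tapes) : reads := [ffun i => head None (T i).2].
Definition apply_act (x : action) (T : tapes) : tapes :=
  fun i => act_tape (x i) (T i).

Fixpoint reach c (s : St c) (T : tapes) (n : nat) (T' : tapes) : Prop :=
  if n is n'.+1 then
    let o := trans s (observe T) in
    match o.1 with
    | None => n' = 0 /\ T' = apply_act o.2 T
    | Some s' => reach s' (apply_act o.2 T) n' T'
    end
  else False.

Definition cell (r : seq bool) i : sym := nth None [seq Some (inl b) | b <- r] i.

(** The cells left of the head stay blank: [Push] moves onto a fresh one and [Pop] leaves a blank
    behind. Tapes are compared cell by cell because trailing blanks may accumulate. *)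
Definition represents (T : tapes) (st : store) :=
  forall j, (forall i, nth None (T j).1 i = None) /\
            (forall i, nth None (T j).2 i = cell (stack st j) i).

Lemma represents_head T st j :
  represents T st -> bit_of (head None (T j).2) = ohead (stack st j).
Proof.
by move=> /(_ j) [_ /(_ 0)]; rewrite nth0 => ->; rewrite /cell; case: (stack st j).
Qed.

Lemma represents_idle T st :
  represents T st -> represents (apply_act (idle (observe T)) T) st.
Proof.
move=> H j; have [H1 H2] := H j; split=> //= i.
rewrite /observe ffunE -H2; case: i => [|i] /=; first by rewrite nth0.
by rewrite nth_behead.
Qed.

Lemma represents_update T T' st i v :
  represents T st ->
  (forall k, nth None (T' i).1 k = None) ->
  (forall k, nth None (T' i).2 k = cell v k) ->
  (forall j, j != i -> T' j = apply_act (idle (observe T)) T j) ->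
  represents T' (update st i v).
Proof.
move=> H H1 H2 H3 j; rewrite nth_set_nth /=.
case: (eqVneq (j : nat) i) => [/val_inj ->|ji]; first by split.
by have /H3 -> : j != i by []; exact: (represents_idle H j).
Qed.

Lemma reach_map a c (h : St a -> St c) :
  (forall s r, trans (h s) r = let: (o, x) := trans s r in (omap h o, x)) ->
  forall s T n T', reach s T n T' -> reach (h s) T n T'.
Proof.
move=> hE s T n T'; elim: n s T => [|n IH] s T //=; rewrite hE.
by case: (trans s (observe T)) => [[s'|] x] //=; exact: IH.
Qed.

Lemma reach_seq_l a b s T n T1 m T2 :
  reach (c := a) s T n T1 -> reach (entry b) T1 m T2 ->
  reach (c := Seq a b) (inl s) T (n + m) T2.
Proof.
elim: n s T => [|n IH] s T //=.
case E: (trans s (observe T)) => [[s'|] x] /=; first exact: IH.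
case=> -> -> R; rewrite add0n.
by apply: (@reach_map b (Seq a b) (fun s => inr s)) R.
Qed.

Lemma reach_while_body i f a s T n T1 m T2 :
  reach (c := a) s T n T1 ->
  reach (c := While i f a) (inl tt) T1 m T2 ->
  reach (c := While i f a) (inr s) T (n + m) T2.
Proof.
elim: n s T => [|n IH] s T //=.
case E: (trans s (observe T)) => [[s'|] x] /=; first exact: IH.
by case=> -> ->.
Qed.

Lemma run_reach c st t st' :
  run c st t st' -> forall T, represents T st ->
  exists2 T', reach (entry c) T t T' & represents T' st'.
Proof.
elim=> {c st t st'}.
- move=> i b st T H.
  pose T1 := apply_act (act_on (observe T) i (observe T i, MoveL)) T.
  exists (apply_act (act_on (observe T1) i (Some (inl b), Stay)) T1).
    by split.
  apply: (represents_update H) => [k|k|j ji].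
  + rewrite /T1 /apply_act /act_on eqxx /act_tape /= nth_behead.
    by case: (H i).
  + rewrite /T1 /apply_act /act_on eqxx /act_tape /=.
    case: k => [|k] //=; rewrite /observe ffunE.
    have [_ H2] := H i; rewrite /cell /= -[RHS]H2.
    by case: k => [|k]; rewrite /= ?nth0 ?nth_behead.
  + rewrite /T1 /apply_act /act_on (negbTE ji) /idle /act_tape /=.
    by rewrite /observe !ffunE /= (negbTE ji).
- move=> i st T H.
  exists (apply_act (act_on (observe T) i (None, MoveR)) T); first by split.
  apply: (represents_update H) => [k|k|j ji].
  + rewrite /apply_act /act_on eqxx /act_tape /=.
    by case: k => [|k] //=; case: (H i).
  + rewrite /apply_act /act_on eqxx /act_tape /= nth_behead.
    have [_ ->] := H i; rewrite /cell; by case: (stack st i) => //=; case: k.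
  + by rewrite /apply_act /act_on (negbTE ji).
- move=> a b st t1 st1 t2 st2 _ IH1 _ IH2 T /IH1 [T1 R1 /IH2 [T2 R2 H2]].
  by exists T2 => //; exact: (reach_seq_l R1 R2).
- move=> i f a b st t st' _ IH T H.
  have [T' R H'] := IH _ (represents_idle H).
  exists T' => //; rewrite /= {2}/observe ffunE (represents_head i H).
  case: (f _) R => R.
    by apply: (@reach_map a (If i f a b) (inr \o inl)) R.
  by apply: (@reach_map b (If i f a b) (inr \o inr)) R.
- move=> i f a st nf T H; exists (apply_act (idle (observe T)) T).
    by rewrite /= {1}/observe ffunE (represents_head i H) (negbTE nf).
  exact: represents_idle.
- move=> i f a st t1 st1 t2 st2 hf _ IH1 _ IH2 T H.
  have [T1 R1 /IH2 [T2 R2 H2]] := IH1 _ (represents_idle H).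
  exists T2 => //; rewrite /= {1}/observe ffunE (represents_head i H) hf.
  exact: (reach_while_body R1 R2).
Qed.

Lemma reach_iter c s T n T' :
  reach (c := c) s T n T' ->
  iter n (@step (machine c)) (Some s, T) = (None, T').
Proof.
elim: n s T => [|n IH] s T //; rewrite iterSr.
have -> : @step (machine c) (Some s, T) =
  ((trans s (observe T)).1, apply_act (trans s (observe T)).2 T) by [].
rewrite /=; case: (trans s (observe T)) => [[s'|] x]; first exact: IH.
by case=> -> ->.
Qed.

Lemma iter_halted (M : TM) n c : halting c.1 -> iter n (@step M) c = c.
Proof. by move=> h; elim: n => //= n ->; rewrite /step h. Qed.

Lemma leading_cells M (t : seq (symbol M)) b :
  (forall i, nth None t i = nth None [seq Some (inl x) | x <- b] i) ->
  leading_bits t = b.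
Proof.
elim: b t => [|x b IH] [|y t] //= H.
- by have := H 0 => /= ->.
- by have := H 0.
- by have /= -> := H 0; rewrite IH // => i; exact: (H i.+1).
Qed.

Definition ex c st n st' := exists2 t, t <= n & run c st t st'.

Lemma run_poly_time c k (f : seq bool -> seq bool) :
  (forall s, exists r, ex c [:: s; [::]; [::]; [::]] ((size s + 2) ^ k)
                            (f s :: r)) ->
  poly_time f.
Proof.
move=> H; exists (machine c), (('X + 2%N%:P) ^+ k)%R => s.
have -> : (('X + 2%N%:P) ^+ k).[size s]%R = (size s + 2) ^ k.
  by rewrite poly.horner_exp poly.hornerD poly.hornerX poly.hornerC.
have [r [t tle R]] := H s.
have H0 : represents (fun i => ([::], if i == ord0 then [seq Some (inl b) | b <- s] else [::]))
   [:: s; [::]; [::]; [::]].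
  move=> j; split=> i; first by rewrite nth_nil.
  by case: j => [[|[|[|[|j]]]]] Hj //=; rewrite /cell ?nth_nil.
have [T' /reach_iter E H'] := run_reach R H0.
have E2 : iter ((size s + 2) ^ k) (@step (machine c)) (init (machine c) s) = (None, T').
  rewrite -(subnK tle) iterD E iter_halted //.
rewrite /computes_within E2; split=> //.
apply: leading_cells => i.
by have [_ ->] := H' ord0.
Qed.

(** * Polynomial-time functions on trees *)

Inductive tree := Lf | Nd of tree & tree.

(** This is a prefix code, so that the end of the topmost tree on a stack can be found without
    separators. *)
Fixpoint ser (t : tree) : seq bool :=
  if t is Nd a b then true :: ser a ++ ser b else [:: false].

Class Enc (A : Type) := enc : A -> tree.

Definition sz A {_ : Enc A} (x : A) := size (ser (enc x)).

#[global] Instance Enc_bool : Enc bool := fun b => if b then Nd Lf Lf else Lf.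
(** Unary on purpose: polynomial time on [nat] means polynomial in the value, which suits indices
    and sizes. Binary numbers are handled as [seq bool]. *)
#[global] Instance Enc_nat : Enc nat := fun n => iter n (Nd Lf) Lf.
#[global] Instance Enc_prod A B {_ : Enc A} {_ : Enc B} : Enc (A * B) :=
  fun p => Nd (enc p.1) (enc p.2).
#[global] Instance Enc_seq A {_ : Enc A} : Enc (seq A) :=
  foldr (fun x t => Nd (enc x) t) Lf.

Notation t0 := (@Ordinal 4 0 isT).
Notation t1 := (@Ordinal 4 1 isT).
Notation t2 := (@Ordinal 4 2 isT).
Notation t3 := (@Ordinal 4 3 isT).

Definition is_true_bit (o : option bool) := o == Some true.

Lemma ex_weaken c st m n st' : m <= n -> ex c st m st' -> ex c st n st'.
Proof. by move=> mn [t tm R]; exists t => //; exact: leq_trans mn. Qed.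

Lemma ex_push i b st : ex (Push i b) st 2 (update st i (b :: stack st i)).
Proof. by exists 2 => //; exact: RPush. Qed.

Lemma ex_pop i st : ex (Pop i) st 1 (update st i (behead (stack st i))).
Proof. by exists 1 => //; exact: RPop. Qed.

Lemma ex_seq a b st m st1 n st2 :
  ex a st m st1 -> ex b st1 n st2 -> ex (Seq a b) st (m + n) st2.
Proof.
move=> [t tm R] [u un R']; exists (t + u); first exact: leq_add.
exact: RSeq R R'.
Qed.

Lemma ex_if i (f : option bool -> bool) a b st n st' :
  ex (if f (ohead (stack st i)) then a else b) st n st' ->
  ex (If i f a b) st n.+1 st'.
Proof. by move=> [t tn R]; exists t.+1 => //; exact: RIf. Qed.

Lemma ex_whileF i (f : option bool -> bool) a st :
  ~~ f (ohead (stack st i)) -> ex (While i f a) st 1 st.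
Proof. by move=> nf; exists 1 => //; exact: RWhileF. Qed.

Lemma ex_whileT i (f : option bool -> bool) a st m st1 n st2 :
  f (ohead (stack st i)) -> ex a st m st1 -> ex (While i f a) st1 n st2 ->
  ex (While i f a) st (m + n).+1 st2.
Proof.
move=> hf [t tm R] [u un R']; exists (t + u).+1; first exact: leq_add.
exact: RWhileT hf R R'.
Qed.

(** The main stack is [x], the other data stack is [y]; tapes 2 and 3 are
    scratch space. *)
Definition config2 (j : bool) (x y u v : seq bool) : store :=
  if j then [:: y; x; u; v] else [:: x; y; u; v].
Definition tape_no (j : bool) : 'I_4 := if j then t1 else t0.

Definition scan_loop j :=
  While t3 (@isSome _)
    (If (tape_no j) is_true_bit
       (Seq (Pop (tape_no j)) (Seq (Push t2 true) (Push t3 true)))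
       (Seq (Pop (tape_no j)) (Seq (Push t2 false) (Pop t3)))).
Definition scan j := Seq (Push t3 true) (scan_loop j).

(** Tape 3 counts the subtrees that remain to be read. *)
Lemma ex_scan_loop j x r y u v n st' :
  ex (scan_loop j) (config2 j r y (rev (ser x) ++ u) v) n st' ->
  ex (scan_loop j) (config2 j (ser x ++ r) y u (true :: v))
     (n + 8 * size (ser x)) st'.
Proof.
elim: x r u v n => [|a IHa b IHb] r u v n /= H.
  apply: (@ex_weaken _ _ (5 + n).+1); first lia.
  apply: ex_whileT H; first by case: (j).
  apply: ex_if; case: (j) => /=;
    exact: (ex_seq (ex_pop _ _) (ex_seq (ex_push _ _ _) (ex_pop _ _))).
apply: (@ex_weaken _ _ (6 + (n + 8 * size (ser b) + 8 * size (ser a))).+1).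
  by rewrite size_cat; lia.
apply: (@ex_whileT _ _ _ _ _ (config2 j (ser a ++ ser b ++ r) y (true :: u) (true :: true :: v))).
- by case: (j).
- apply: ex_if; case: (j) => /=; rewrite -?catA;
    exact: (ex_seq (ex_pop _ _) (ex_seq (ex_push _ _ _) (ex_push _ _ _))).
- apply: IHa; apply: IHb.
  by move: H; rewrite rev_cons rev_cat cat_rcons -catA.
Qed.

Lemma ex_scan j x r y :
  ex (scan j) (config2 j (ser x ++ r) y [::] [::]) (8 * size (ser x) + 3)
     (config2 j r y (rev (ser x)) [::]).
Proof.
apply: (@ex_weaken _ _ (2 + (1 + 8 * size (ser x)))); first lia.
apply: (@ex_seq _ _ _ _ (config2 j (ser x ++ r) y [::] [:: true])).
  by case: (j); exact: ex_push.
apply: ex_scan_loop; rewrite cats0; apply: ex_whileF; by case: (j).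
Qed.

Definition unload (put : bool -> cmd) :=
  While t2 (@isSome _)
    (If t2 is_true_bit (Seq (Pop t2) (put true)) (Seq (Pop t2) (put false))).

(** [F s u] is the store once [s] has been delivered while [u] remains on tape 2. The same loop thus
    covers moving, copying to both stacks and recoding. *)
Lemma ex_unload put k (F : seq bool -> seq bool -> store) s u :
  (forall s u, stack (F s u) t2 = u) ->
  (forall s u, update (F s u) t2 (behead u) = F s (behead u)) ->
  (forall b s u, ex (put b) (F s u) k (F (b :: s) u)) ->
  ex (unload put) (F s u) ((k + 3) * size u + 1) (F (rev u ++ s) [::]).
Proof.
move=> H1 H2 H3; elim: u s => [|b u IH] s.
  by rewrite muln0; apply: ex_whileF; rewrite H1.
rewrite rev_cons cat_rcons.
apply: (@ex_weaken _ _ ((1 + k).+1 + ((k + 3) * size u + 1)).+1) => /=; first lia.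
apply: ex_whileT (IH (b :: s)); first by rewrite H1.
apply: ex_if; rewrite H1.
have P : ex (Seq (Pop t2) (put b)) (F s (b :: u)) (1 + k) (F (b :: s) u).
  by apply: ex_seq (H3 _ _ _); have := ex_pop t2 (F s (b :: u)); rewrite H1 H2.
by case: b P.
Qed.

Definition mov j := Seq (scan j) (unload (Push (tape_no (~~ j)))).
Definition dup j :=
  Seq (scan j) (unload (fun b => Seq (Push t0 b) (Push t1 b))).
Definition drop_top j := Seq (scan j) (While t2 (@isSome _) (Pop t2)).

Lemma ex_mov j x r y :
  ex (mov j) (config2 j (ser x ++ r) y [::] [::]) (13 * size (ser x) + 4)
     (config2 j r (ser x ++ y) [::] [::]).
Proof.
apply: (@ex_weaken _ _ ((8 * size (ser x) + 3) + ((2 + 3) * size (rev (ser x)) + 1))).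
  by rewrite size_rev; lia.
apply: ex_seq (ex_scan _ _ _ _) _.
rewrite -{3}[ser x]revK.
apply: (@ex_unload _ 2 (fun s u => config2 j r s u [::])) => [s u|s u|b s u];
  by case: (j) => //; exact: ex_push.
Qed.

Lemma ex_dup j x r y :
  ex (dup j) (config2 j (ser x ++ r) y [::] [::]) (15 * size (ser x) + 4)
     (config2 j (ser x ++ r) (ser x ++ y) [::] [::]).
Proof.
apply: (@ex_weaken _ _ ((8 * size (ser x) + 3) + ((4 + 3) * size (rev (ser x)) + 1))).
  by rewrite size_rev; lia.
apply: ex_seq (ex_scan _ _ _ _) _.
rewrite -{3 4}[ser x]revK.
have := @ex_unload (fun b => Seq (Push t0 b) (Push t1 b)) 4
  (fun s u => config2 j (s ++ r) (s ++ y) u [::]) [::] (rev (ser x)).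
rewrite cats0; apply=> [s u|s u|b s u]; case: (j) => //=;
  exact: (ex_seq (ex_push _ _ _) (ex_push _ _ _)).
Qed.

Lemma ex_drop_top j x r y :
  ex (drop_top j) (config2 j (ser x ++ r) y [::] [::]) (10 * size (ser x) + 4)
     (config2 j r y [::] [::]).
Proof.
apply: (@ex_weaken _ _ ((8 * size (ser x) + 3) + (2 * size (rev (ser x)) + 1))).
  by rewrite size_rev; lia.
apply: ex_seq (ex_scan _ _ _ _) _.
elim: (rev _) => [|b u IH] /=; first by apply: ex_whileF; case: (j).
apply: (@ex_weaken _ _ (1 + (2 * size u + 1)).+1); first lia.
by apply: ex_whileT IH; case: (j) => //; exact: ex_pop.
Qed.

Definition nop := While t0 (fun=> false) (Pop t0).
Lemma ex_nop st : ex nop st 1 st.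
Proof. exact: ex_whileF. Qed.

Definition pushes (s : seq bool) := foldr (fun b c => Seq c (Push t0 b)) nop s.
Lemma ex_pushes s r y u v :
  ex (pushes s) (config2 false r y u v) (2 * size s + 1)
     (config2 false (s ++ r) y u v).
Proof.
elim: s => [|b s IH] /=; first exact: ex_nop.
apply: (@ex_weaken _ _ ((2 * size s + 1) + 2)); first lia.
exact: ex_seq IH (ex_push _ _ _).
Qed.

Lemma total_update (st : store) i v :
  sumn (map size (set_nth [::] st i v)) + size (nth [::] st i) =
  sumn (map size st) + size v.
Proof.
elim: st i => [|s st IH] [|i] /=; [lia| |lia|by have := IH i; lia].
by elim: i => [|i IHi] /=; lia.
Qed.

(** Time bounds output size; composition needs this to bound the time of the second program on the
    output of the first. *)
Lemma run_total c st t st' :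
  run c st t st' -> sumn (map size st') <= sumn (map size st) + t.
Proof.
elim=> {c st t st'}.
- by move=> i b st; have := total_update st i (b :: stack st i) => /=; lia.
- by move=> i st; have := total_update st i (behead (stack st i)); rewrite size_behead; lia.
- lia.
- lia.
- lia.
- lia.
Qed.

(** * Polynomial bounds in the size of the encoding *)

Section PolyBounds.
Context (A : Type) {EA : Enc A}.
Implicit Types g h : A -> nat.

(** A single power of a base that is at least 2 absorbs sums, products and constants by raising the
    exponent. *)
Definition pb g := exists k, forall x, g x <= (sz x + 2) ^ k.

Lemma leq_pexp2 n j k : j <= k -> (n + 2) ^ j <= (n + 2) ^ k.
Proof. by move=> jk; rewrite leq_exp2l //; lia. Qed.

Lemma pb_le g h : (forall x, g x <= h x) -> pb h -> pb g.
Proof. by move=> H [k Hk]; exists k => x; exact: leq_trans (H x) (Hk x). Qed.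

Lemma pb_add g h : pb g -> pb h -> pb (fun x => g x + h x).
Proof.
move=> [j Hj] [k Hk]; exists (maxn j k).+1 => x; rewrite expnS.
apply: (@leq_trans (2 * (sz x + 2) ^ maxn j k)); last by rewrite leq_mul2r; lia.
rewrite mul2n -addnn; apply: leq_add.
  by apply: leq_trans (Hj x) _; apply: leq_pexp2; lia.
by apply: leq_trans (Hk x) _; apply: leq_pexp2; lia.
Qed.

Lemma pb_mul g h : pb g -> pb h -> pb (fun x => g x * h x).
Proof.
move=> [j Hj] [k Hk]; exists (j + k) => x; rewrite expnD.
exact: leq_mul.
Qed.

Lemma pb_const n : pb (fun=> n).
Proof.
exists n => x; apply: leq_trans (ltnW (ltn_expl n (isT : 1 < 2))) _.
by case: n => // n; rewrite leq_exp2r //; lia.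
Qed.

Lemma pb_sz : pb (fun x => sz x).
Proof. by exists 1 => x; rewrite expn1; lia. Qed.

Lemma pb_exp g k : pb g -> pb (fun x => g x ^ k).
Proof.
move=> H; elim: k => [|k IH]; first exact: pb_const.
by apply: pb_le (pb_mul H IH) => x; rewrite expnS.
Qed.
End PolyBounds.

Arguments pb_sz {A EA}.
Arguments pb_const {A EA} n.

Lemma pb_comp A B {EA : Enc A} {EB : Enc B} (f : A -> B) g :
  pb (fun x => sz (f x)) -> pb g -> pb (fun x => g (f x)).
Proof.
move=> Hf [k Hk]; apply: (pb_le (h := fun x => (sz (f x) + 2) ^ k)) => //.
by apply: pb_exp; apply: pb_add => //; exact: pb_const.
Qed.

Section Computable.
Context (A B : Type) {EA : Enc A} {EB : Enc B}.

(** [f] is computed in polynomial time by a program that replaces the encoding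
    of its argument on top of stack 0, and restores everything else. *)
Definition computes c (f : A -> B) (b : A -> nat) :=
  forall x r y, ex c (config2 false (ser (enc x) ++ r) y [::] [::]) (b x)
                     (config2 false (ser (enc (f x)) ++ r) y [::] [::]).
Definition PT (f : A -> B) := exists c, exists2 b, pb b & computes c f b.

Lemma PT_pb f : PT f -> pb (fun x => sz (f x)).
Proof.
move=> [c [b Hb Hc]]; apply: pb_le (pb_add pb_sz Hb) => x.
have [t tb /run_total /=] := Hc x [::] [::].
by rewrite !cats0 -!/(sz _); lia.
Qed.

Lemma PT_ext f g : f =1 g -> PT f -> PT g.
Proof. by move=> E [c [b Hb Hc]]; exists c, b => // x r y; rewrite -E. Qed.
End Computable.

(** Values of different types can share a tree: a nonempty list is a pair, [n.+1] is the pair of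
    [false] and [n], and a boolean is the number 0 or 1. *)
Lemma PT_recode A B C {EA : Enc A} {EB : Enc B} {EC : Enc C} (f : A -> B) (g : A -> C) :
  (forall x, enc (f x) = enc (g x)) -> PT f -> PT g.
Proof. by move=> E [c [b Hb Hc]]; exists c, b => // x r y; rewrite -E. Qed.

Section Combinators.
Context (A B C : Type) {EA : Enc A} {EB : Enc B} {EC : Enc C}.

Lemma PT_id : PT (fun x : A => x).
Proof. by exists nop, (fun=> 1); [exact: pb_const|move=> x r y; exact: ex_nop]. Qed.

Lemma PT_comp (f : A -> B) (g : B -> C) : PT f -> PT g -> PT (fun x => g (f x)).
Proof.
move=> Hf [d [e He Hd]]; have [c [b Hb Hc]] := Hf.
exists (Seq c d), (fun x => b x + e (f x)).
  by apply: pb_add => //; apply: pb_comp He; exact: PT_pb.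
move=> x r y; exact: ex_seq (Hc _ _ _) (Hd _ _ _).
Qed.

Lemma PT_const (z : B) : PT (fun _ : A => z).
Proof.
exists (Seq (drop_top false) (pushes (ser (enc z)))).
exists (fun x => (10 * sz x + 4) + (2 * sz z + 1)).
  by apply: pb_add; [apply: pb_add; [apply: pb_mul|]|]; try exact: pb_const; exact: pb_sz.
move=> x r y; exact: ex_seq (ex_drop_top _ _ _ _) (ex_pushes _ _ _ _ _).
Qed.

(** A copy of [x] waits on stack 1 while [g] runs, then returns on top of [g x] and is turned into
    [f x]. The last push makes the node. *)
Lemma PT_pair (f : A -> B) (g : A -> C) : PT f -> PT g -> PT (fun x => (f x, g x)).
Proof.
move=> [c [b Hb Hc]] [d [e He Hd]].
exists (Seq (dup false) (Seq d (Seq (mov true) (Seq c (Push t0 true))))).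
exists (fun x => (15 * sz x + 4) + (e x + ((13 * sz x + 4) + (b x + 2)))).
  have P k : pb (fun x : A => k * sz x + 4).
    by apply: pb_add; [apply: pb_mul|]; try exact: pb_const; exact: pb_sz.
  by do 3 (apply: pb_add => //); apply: pb_add => //; exact: pb_const.
move=> x r y.
apply: ex_seq (ex_dup _ _ _ _) _; apply: ex_seq (Hd _ _ _) _.
apply: ex_seq (ex_mov true _ _ _) _; apply: ex_seq (Hc x _ _) _.
by have := ex_push t0 true (config2 false (ser (enc (f x)) ++ ser (enc (g x)) ++ r) y [::] [::]); rewrite /= -catA.
Qed.
End Combinators.

Section Projections.
Context (A B : Type) {EA : Enc A} {EB : Enc B}.

Lemma sz_pair (x : A) (y : B) : sz (x, y) = (sz x + sz y).+1.
Proof. by rewrite /sz /= size_cat. Qed.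

Lemma PT_fst_ : PT (fun p : A * B => p.1).
Proof.
exists (Seq (Pop t0) (Seq (mov false) (Seq (drop_top false) (mov true)))).
exists (fun p => 1 + ((13 * sz p.1 + 4) + ((10 * sz p.2 + 4) + (13 * sz p.1 + 4)))).
  apply: (pb_le (h := fun p => 40 * sz p + 40)) => [[x z] /=|].
    by rewrite sz_pair; lia.
  by apply: pb_add; [apply: pb_mul|]; try exact: pb_const; exact: pb_sz.
move=> [x z] r y /=; rewrite -catA.
apply: ex_seq (ex_pop _ _) _; apply: ex_seq (ex_mov false _ _ _) _.
apply: ex_seq (ex_drop_top false _ _ _) _; exact: (ex_mov true).
Qed.

Lemma PT_snd_ : PT (fun p : A * B => p.2).
Proof.
exists (Seq (Pop t0) (drop_top false)), (fun p => 1 + (10 * sz p.1 + 4)).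
  apply: (pb_le (h := fun p => 40 * sz p + 40)) => [[x z] /=|].
    by rewrite sz_pair; lia.
  by apply: pb_add; [apply: pb_mul|]; try exact: pb_const; exact: pb_sz.
move=> [x z] r y /=; rewrite -catA.
by apply: ex_seq (ex_pop _ _) _; exact: (ex_drop_top false).
Qed.
End Projections.

Section Primitives.
Context (A B : Type) {EA : Enc A} {EB : Enc B}.

Lemma pb_linear j k : pb (fun x : A => j * sz x + k).
Proof. by apply: pb_add; [apply: pb_mul => //|]; try exact: pb_const; exact: pb_sz. Qed.

Lemma PT_if (b : A -> bool) (f g : A -> B) :
  PT b -> PT f -> PT g -> PT (fun x => if b x then f x else g x).
Proof.
move=> Hb [c [u Hu Hc]] [d [v Hv Hd]].
have [e [w Hw He]] := PT_pair Hb (@PT_id A _).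
(* Under the node of the pair, the boolean is stored as the bits true, false, false or as the single
   bit false: its first bit decides, and three pops or one remove it. *)
exists (Seq e (Seq (Pop t0) (If t0 is_true_bit
  (Seq (Pop t0) (Seq (Pop t0) (Seq (Pop t0) c))) (Seq (Pop t0) d)))).
exists (fun x => w x + (u x + v x + 10)).
  by apply: pb_add => //; apply: pb_add; [exact: pb_add|exact: pb_const].
move=> x r y; apply: ex_seq (He _ _ _) _.
apply: (@ex_weaken _ _ (1 + (u x + v x + 6).+1)); first lia.
apply: ex_seq (ex_pop _ _) _; apply: ex_if; rewrite /= -catA.
case: (b x) => /=.
  apply: (@ex_weaken _ _ (1 + (1 + (1 + u x)))); first lia.
  do 3 apply: ex_seq (ex_pop _ _) _; exact: Hc.
apply: (@ex_weaken _ _ (1 + v x)); first lia.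
apply: ex_seq (ex_pop _ _) _; exact: Hd.
Qed.

Lemma PT_is_node (f : A -> bool) :
  (forall x, f x = if enc x is Nd _ _ then true else false) -> PT f.
Proof.
move=> E; exists (If t0 is_true_bit
  (Seq (drop_top false) (pushes (ser (enc true))))
  (Seq (drop_top false) (pushes (ser (enc false))))).
exists (fun x => 10 * sz x + 20); first exact: pb_linear.
move=> x r y; apply: (@ex_weaken _ _ ((10 * sz x + 4) + 10).+1); first lia.
apply: ex_if; rewrite E.
have P (b : bool) : ex (Seq (drop_top false) (pushes (ser (enc b))))
   (config2 false (ser (enc x) ++ r) y [::] [::]) (10 * sz x + 4 + 10)
   (config2 false (ser (enc b) ++ r) y [::] [::]).
  apply: ex_seq (ex_drop_top false _ _ _) _.
  by apply: ex_weaken (ex_pushes _ _ _ _ _); case: b.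
by move: P; case: (enc x) => [|h t] P; [exact: (P false)|exact: (P true)].
Qed.

Lemma PT_tail (f : A -> B) :
  (forall x, enc (f x) = if enc x is Nd _ t then t else Lf) -> PT f.
Proof.
move=> E; exists (If t0 is_true_bit (Seq (Pop t0) (drop_top false)) nop).
exists (fun x => 10 * sz x + 10); first exact: pb_linear.
move=> x r y; rewrite E /sz; case: (enc x) => [|h t].
  apply: (@ex_weaken _ _ 2); first by [].
  by apply: ex_if; exact: ex_nop.
apply: (@ex_weaken _ _ (1 + (10 * size (ser h) + 4)).+1).
  by rewrite /= size_cat; lia.
apply: ex_if; apply: ex_seq (ex_pop _ _) _; rewrite /= -catA.
exact: (ex_drop_top false).
Qed.

Lemma PT_first (f : A -> B) z :
  (forall x, enc (f x) = if enc x is Nd h _ then h else z) -> PT f.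
Proof.
move=> E; exists (If t0 is_true_bit
  (Seq (Pop t0) (Seq (mov false) (Seq (drop_top false) (mov true))))
  (Seq (Pop t0) (pushes (ser z)))).
exists (fun x => 40 * sz x + (2 * size (ser z) + 20)); first exact: pb_linear.
move=> x r y; rewrite E /sz; case: (enc x) => [|h t].
  apply: (@ex_weaken _ _ (1 + (2 * size (ser z) + 1)).+1); first lia.
  by apply: ex_if; apply: ex_seq (ex_pop _ _) _; exact: ex_pushes.
apply: (@ex_weaken _ _ (1 + ((13 * size (ser h) + 4) + ((10 * size (ser t) + 4) +
   (13 * size (ser h) + 4)))).+1).
  by rewrite /= size_cat; lia.
apply: ex_if; apply: ex_seq (ex_pop _ _) _; rewrite /= -catA.
apply: ex_seq (ex_mov false _ _ _) _; apply: ex_seq (ex_drop_top false _ _ _) _.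
exact: (ex_mov true).
Qed.
End Primitives.

Section Fold.
Context (X A E : Type) {EX : Enc X} {EA : Enc A} {EE : Enc E}.

Lemma sz_cons (e : E) l : sz (e :: l) = (sz e + sz l).+1.
Proof. by rewrite /sz /= size_cat. Qed.

Lemma sz_cat (l1 l2 : seq E) : (sz (l1 ++ l2)).+1 = sz l1 + sz l2.
Proof. by elim: l1 => //= e l1 IH; rewrite !sz_cons; lia. Qed.

Lemma sz_nil : sz ([::] : seq E) = 1.
Proof. by []. Qed.

Lemma sz_rcons (l : seq E) e : sz (rcons l e) = (sz l + sz e).+1.
Proof.
by move: (sz_cat l [:: e]); rewrite cats1 sz_cons sz_nil; lia.
Qed.

Lemma sz_rev (l : seq E) : sz (rev l) = sz l.
Proof.
by elim: l => // a l IH; rewrite rev_cons sz_rcons sz_cons IH addnC.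
Qed.

Lemma size_le_sz (l : seq E) : size l < sz l.
Proof. by elim: l => //= e l IH; rewrite sz_cons; lia. Qed.

Lemma sz_mid (l1 l2 : seq E) e : sz e < sz (l1 ++ e :: l2).
Proof.
have := sz_cat l1 (e :: l2); rewrite sz_cons; have := size_le_sz l1; lia.
Qed.

(** The list is consumed from its front on stack 1: a bit [true] announces an element, which is
    moved on top of the parameter and the accumulator on stack 0. *)
Definition fold_loop c :=
  While t1 is_true_bit (Seq (Pop t1) (Seq (mov true) (Seq (Push t0 true) c))).

Lemma ex_fold_loop c (g : E * (X * A) -> X * A) b x (f : A -> E -> A) l a T r y :
  computes c g b ->
  (forall a e, g (e, (x, a)) = (x, f a e)) ->
  (forall l1 e l2, l = l1 ++ e :: l2 ->
     b (e, (x, foldl f a l1)) + 13 * sz e + 8 <= T) ->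
  ex (fold_loop c)
     (config2 false (ser (enc (x, a)) ++ r) (ser (enc l) ++ y) [::] [::])
     (T * size l + 1)
     (config2 false (ser (enc (x, foldl f a l)) ++ r) (false :: y) [::] [::]).
Proof.
move=> Hc gE; elim: l a => [|e l IH] a HT.
  by rewrite muln0; apply: ex_whileF.
have HT' l1 e1 l2 : l = l1 ++ e1 :: l2 ->
    b (e1, (x, foldl f (f a e) l1)) + 13 * sz e1 + 8 <= T.
  by move=> El; apply: (HT (e :: l1) e1 l2); rewrite El.
have He := HT [::] e l erefl.
apply: (@ex_weaken _ _ ((1 + ((13 * sz e + 4) + (2 + b (e, (x, a))))) + (T * size l + 1)).+1).
  by move: He => /=; rewrite mulnS; lia.
apply: ex_whileT (IH _ HT'); first by [].
apply: ex_seq (ex_pop _ _) _; rewrite [ser (enc (e :: l))]/= cat_cons -catA.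
apply: ex_seq (ex_mov true _ _ _) _; apply: ex_seq (ex_push _ _ _) _.
have := Hc (e, (x, a)) r (ser (Enc_seq l) ++ y).
by rewrite gE /config2 /= -!catA /= -?catA.
Qed.

(** A polynomial-time step alone would not do, since iterating it may square the accumulator each
    time. Hence the bound [G] on its size after every prefix of the list. *)
Lemma PT_foldl (l : X -> seq E) (a0 : X -> A) (f : X -> A -> E -> A) (G : X -> nat) :
  PT l -> PT a0 -> PT (fun p : E * (X * A) => f p.2.1 p.2.2 p.1) ->
  pb G -> (forall x l1 l2, l x = l1 ++ l2 -> sz (foldl (f x) (a0 x) l1) <= G x) ->
  PT (fun x => foldl (f x) (a0 x) (l x)).
Proof.
move=> Hl Ha Hf HG bnd.
have Hg : PT (fun p : E * (X * A) => (p.2.1, f p.2.1 p.2.2 p.1)).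
  apply: PT_pair => //; apply: PT_comp (@PT_fst_ _ _ _ _).
  exact: PT_snd_.
have [c [b [k Hk] Hc]] := Hg.
have [d [v Hv Hd]] := PT_pair Hl (PT_pair (@PT_id X _) Ha).
have [e [w Hw He]] := @PT_snd_ X A _ _.
pose (T := fun x : X => (2 + sz (l x) + sz x + G x + 2) ^ k + (13 * sz (l x) + 8)).
exists (Seq d (Seq (Pop t0) (Seq (mov false) (Seq (fold_loop c) (Seq (Pop t1) e))))).
have szl := PT_pb Hl.
have pc n : pb (fun x : X => n * sz (l x)) by apply: pb_mul => //; exact: pb_const.
exists (fun x => v x + (1 + ((13 * sz (l x) + 4) + ((T x * sz (l x) + 1) +
   (1 + w (x, foldl (f x) (a0 x) (l x))))))).
  have C n := @pb_const X _ n.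
  have pT : pb T.
    apply: pb_add; last by apply: pb_add.
    apply: pb_exp; do 3 apply: pb_add => //; first exact: pb_add.
    exact: pb_sz.
  have pw : pb (fun x => w (x, foldl (f x) (a0 x) (l x))).
    apply: (pb_comp (f := fun x => (x, foldl (f x) (a0 x) (l x)))) Hw.
    apply: (pb_le (h := fun x => sz x + G x + 1)) => [x|].
      rewrite sz_pair; have := bnd x (l x) [::]; rewrite cats0 => /(_ erefl); lia.
    by apply: pb_add => //; apply: pb_add => //; exact: pb_sz.
  apply: pb_add => //; apply: pb_add => //; apply: pb_add; first exact: pb_add.
  apply: pb_add; last exact: pb_add.
  by apply: pb_add => //; exact: pb_mul.
move=> x r y; apply: ex_seq (Hd _ _ _) _.
apply: ex_seq (ex_pop _ _) _; rewrite [ser (enc (l x, _))]/= cat_cons -catA.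
apply: ex_seq (ex_mov false _ _ _) _.
apply: (@ex_seq _ _ _ _ (config2 false (ser (enc (x, foldl (f x) (a0 x) (l x))) ++ r) (false :: y) [::] [::])).
  apply: (@ex_weaken _ _ (T x * size (l x) + 1)).
    by rewrite leq_add2r leq_mul2l ltnW ?size_le_sz ?orbT.
  apply: (ex_fold_loop (g := fun p : E * (X * A) => (p.2.1, f p.2.1 p.2.2 p.1)) (b := b)) => //.
  move=> l1 e1 l2 El; rewrite /T.
  have B1 : sz e1 < sz (l x) by rewrite El sz_mid.
  have B2 := bnd x l1 (e1 :: l2) El.
  rewrite -addnA leq_add //; last lia.
  apply: leq_trans (Hk _) _.
  case: (k) => // k'; rewrite leq_exp2r // !sz_pair; lia.
apply: ex_seq (ex_pop _ _) _; exact: He.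
Qed.

Lemma PT_foldl_add (l : X -> seq E) (a0 : X -> A) (f : X -> A -> E -> A) (d : X -> nat) :
  PT l -> PT a0 -> PT (fun p : E * (X * A) => f p.2.1 p.2.2 p.1) ->
  pb d -> (forall x a l1 e l2, l x = l1 ++ e :: l2 -> sz (f x a e) <= sz a + d x) ->
  PT (fun x => foldl (f x) (a0 x) (l x)).
Proof.
move=> Hl Ha Hf Hd H.
apply: (@PT_foldl _ _ _ (fun x => sz (a0 x) + sz (l x) * d x)) => //.
  by apply: pb_add; [exact: PT_pb|apply: pb_mul => //; exact: PT_pb].
move=> x l1 l2 El.
have : sz (foldl (f x) (a0 x) l1) <= sz (a0 x) + size l1 * d x.
  elim/last_ind: l1 l2 El => [|l1 e IH] l2 El; first by rewrite addn0.
  rewrite foldl_rcons size_rcons mulSn; move: El; rewrite cat_rcons => El.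
  by apply: leq_trans (H _ _ _ _ _ El) _; have := IH _ El; lia.
move=> B; apply: leq_trans B _; rewrite leq_add2l leq_mul2r.
by apply/orP; right; have := size_le_sz (l x); rewrite El size_cat; lia.
Qed.

Lemma pb_in (l : X -> seq E) (g : E * X -> nat) :
  PT l -> pb g -> exists2 d, pb d &
  forall x l1 e l2, l x = l1 ++ e :: l2 -> g (e, x) <= d x.
Proof.
move=> Hl [k Hk]; exists (fun x => (sz (l x) + sz x + 3) ^ k).
  apply: pb_exp; apply: pb_add; last exact: pb_const.
  by apply: pb_add; [exact: PT_pb|exact: pb_sz].
move=> x l1 e l2 El; apply: leq_trans (Hk _) _.
have := sz_mid l1 l2 e; rewrite -El sz_pair => H.
by case: (k) => // k'; rewrite leq_exp2r //; lia.
Qed.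
End Fold.

Section OpenForms.
Context (X A B C : Type) {EX : Enc X} {EA : Enc A} {EB : Enc B} {EC : Enc C}.

Lemma PT_fst (f : X -> A * B) : PT f -> PT (fun x => (f x).1).
Proof. by move=> H; exact: PT_comp H (@PT_fst_ _ _ _ _). Qed.

Lemma PT_snd (f : X -> A * B) : PT f -> PT (fun x => (f x).2).
Proof. by move=> H; exact: PT_comp H (@PT_snd_ _ _ _ _). Qed.

Lemma PT_cons (f : X -> A) (g : X -> seq A) :
  PT f -> PT g -> PT (fun x => f x :: g x).
Proof. by move=> Hf Hg; apply: PT_recode (PT_pair Hf Hg). Qed.

Lemma PT_succ (f : X -> nat) : PT f -> PT (fun x => (f x).+1).
Proof. by move=> H; apply: PT_recode (PT_pair (PT_const false) H). Qed.

Lemma PT_pred (f : X -> nat) : PT f -> PT (fun x => (f x).-1).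
Proof. by move=> H; apply: PT_comp H _; apply: PT_tail; case. Qed.

Lemma PT_behead (f : X -> seq A) : PT f -> PT (fun x => behead (f x)).
Proof. by move=> H; apply: PT_comp H _; apply: PT_tail; case. Qed.

Lemma PT_head z (f : X -> seq A) : PT f -> PT (fun x => head z (f x)).
Proof. by move=> H; apply: PT_comp H _; apply: (PT_first (z := enc z)); case. Qed.

Lemma PT_nilp (f : X -> seq A) : PT f -> PT (fun x => nilp (f x)).
Proof.
move=> H; apply: (PT_ext (f := fun x => if 0 < size (f x) then false else true)).
  by move=> x; case: (f x).
apply: PT_if; [|exact: PT_const..].
apply: (PT_comp (g := fun l => 0 < size l)) H _.
by apply: PT_is_node; case.
Qed.

Lemma PT_pos (f : X -> nat) : PT f -> PT (fun x => 0 < f x).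
Proof. by move=> H; apply: (PT_comp (g := fun n => 0 < n)) H _; apply: PT_is_node; case. Qed.

Lemma PT_negb (f : X -> bool) : PT f -> PT (fun x => ~~ f x).
Proof. by move=> H; apply: PT_if => //; exact: PT_const. Qed.

Lemma PT_andb (f g : X -> bool) : PT f -> PT g -> PT (fun x => f x && g x).
Proof. by move=> H K; apply: PT_if => //; exact: PT_const. Qed.

Lemma PT_orb (f g : X -> bool) : PT f -> PT g -> PT (fun x => f x || g x).
Proof. by move=> H K; apply: PT_if => //; exact: PT_const. Qed.

Lemma PT_implb (f g : X -> bool) : PT f -> PT g -> PT (fun x => f x ==> g x).
Proof. by move=> H K; apply: PT_if => //; exact: PT_const. Qed.

Lemma PT_eqb (f g : X -> bool) : PT f -> PT g -> PT (fun x => f x == g x).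
Proof.
move=> H K; apply: (PT_ext (f := fun x => if f x then g x else ~~ g x)).
  by move=> x; case: (f x) (g x) => [] [].
by apply: PT_if => //; exact: PT_negb.
Qed.
End OpenForms.

Ltac pt_leaf := first [assumption | simple apply PT_id | simple apply PT_const
  | exact: PT_fst_ | exact: PT_snd_].
Ltac pt_lib := fail.
Ltac pt_step := first
  [ pt_leaf
  | simple apply PT_pair | simple apply PT_if | simple apply PT_cons
  | simple apply PT_succ | simple apply PT_pred | simple apply PT_behead
  | simple apply PT_head | simple apply PT_nilp | simple apply PT_pos
  | simple apply PT_negb | simple apply PT_andb | simple apply PT_orb
  | simple apply PT_implb | simple apply PT_eqb
  | lazymatch goal with
    | |- PT (fun x => fst (@?f x)) => apply: PT_fst
    | |- PT (fun x => snd (@?f x)) => apply: PT_snd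
    end
  | pt_lib ].
Ltac pt := repeat pt_step.

(** * Lists and unary arithmetic *)

Lemma sz_nat (n : nat) : sz n = n.*2.+1.
Proof.
rewrite /sz; elim: n => //= n IH.
by have -> : size (ser (iter n (Nd Lf) Lf)) = n.*2.+1 by exact: IH.
Qed.

Lemma sz_bool (b : bool) : sz b <= 3.
Proof. by case: b. Qed.

Lemma leq_sz_nat (n : nat) : n <= sz n.
Proof. by rewrite sz_nat; lia. Qed.

Section Lists.
Context (X A B : Type) {EX : Enc X} {EA : Enc A} {EB : Enc B}.

Lemma PT_rev (l : X -> seq A) : PT l -> PT (fun x => rev (l x)).
Proof.
move=> Hl; apply: (PT_ext (f := fun x => foldl (fun a e => e :: a) [::] (l x))).
  by move=> x; rewrite /rev; elim: (l x) [::] => //= e s IH a; exact: IH.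
apply: (@PT_foldl_add _ _ _ _ _ _ _ _ _ (fun x => sz (l x))) => //; try by pt.
  exact: PT_pb.
by move=> x a l1 e l2 ->; rewrite sz_cons; pose proof (sz_mid l1 l2 e); lia.
Qed.

End Lists.

Section Lists2.
Context (X A B : Type) {EX : Enc X} {EA : Enc A} {EB : Enc B}.

Lemma PT_cat (l1 l2 : X -> seq A) : PT l1 -> PT l2 -> PT (fun x => l1 x ++ l2 x).
Proof.
move=> H1 H2; have H3 := PT_rev H1.
apply: (PT_ext (f := fun x => foldl (fun a e => e :: a) (l2 x) (rev (l1 x)))).
  move=> x; rewrite -{2}[l1 x]revK; elim: (rev _) (l2 x) => //= e s IH a.
  by rewrite IH rev_cons cat_rcons.
apply: (@PT_foldl_add _ _ _ _ _ _ _ _ _ (fun x => sz (rev (l1 x)))) => //; try by pt.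
  exact: PT_pb.
by move=> x a s1 e s2 ->; rewrite sz_cons; pose proof (sz_mid s1 s2 e); lia.
Qed.

End Lists2.

Section Lists3.
Context (X A B : Type) {EX : Enc X} {EA : Enc A} {EB : Enc B}.

Lemma PT_map (f : X -> A -> B) (l : X -> seq A) :
  PT l -> PT (fun p : A * X => f p.2 p.1) -> PT (fun x => [seq f x e | e <- l x]).
Proof.
move=> Hl Hf.
apply: (PT_ext (f := fun x => rev (foldl (fun a e => f x e :: a) [::] (l x)))).
  move=> x; rewrite -[RHS]revK; congr rev; rewrite -[RHS]cats0.
  elim: (l x) [::] => //= e s IH a.
  by rewrite IH rev_cons cat_rcons.
apply: PT_rev.
have [d Hd Hd'] := pb_in Hl (PT_pb Hf).
apply: (@PT_foldl_add _ _ _ _ _ _ _ _ _ (fun x => (d x).+1)) => //; try by pt.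
- apply: PT_cons; last by pt.
  by apply: (PT_comp (f := fun p : A * (X * seq B) => (p.1, p.2.1))) Hf; pt.
- by apply: pb_le (pb_add Hd (pb_const 1)) => x; rewrite addn1.
- by move=> x a l1 e l2 /Hd'; rewrite sz_cons /=; lia.
Qed.

Lemma PT_flatten (l : X -> seq (seq A)) : PT l -> PT (fun x => flatten (l x)).
Proof.
move=> Hl.
apply: (PT_ext (f := fun x => foldl (fun a e => a ++ e) [::] (l x))).
  move=> x; rewrite -[RHS]cat0s; elim: (l x) [::] => /= [|e s IH] a.
    by rewrite cats0.
  by rewrite IH catA.
apply: (@PT_foldl_add _ _ _ _ _ _ _ _ _ (fun x => sz (l x))) => //.
- by pt.
- by apply: PT_cat; pt.
- exact: PT_pb.
- move=> x a l1 e l2 ->; pose proof (sz_mid l1 l2 e); pose proof (sz_cat a e); lia.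
Qed.

Lemma PT_size (l : X -> seq A) : PT l -> PT (fun x => size (l x)).
Proof.
move=> Hl.
apply: (PT_ext (f := fun x => foldl (fun n _ => n.+1) 0 (l x))).
  by move=> x; rewrite -[RHS]add0n; elim: (l x) 0 => [|e s IH] a /=; rewrite ?IH; lia.
apply: (@PT_foldl_add _ _ _ _ _ _ _ _ _ (fun=> 2)) => //; try by pt.
  exact: pb_const.
by move=> x a l1 e l2 _; rewrite !sz_nat; lia.
Qed.

Lemma PT_all (P : X -> A -> bool) (l : X -> seq A) :
  PT l -> PT (fun p : A * X => P p.2 p.1) -> PT (fun x => all (P x) (l x)).
Proof.
move=> Hl Hf.
apply: (PT_ext (f := fun x => foldl (fun a e => a && P x e) true (l x))).
  move=> x; rewrite -[RHS]andTb; elim: (l x) true => /= [|e s IH] a; first by rewrite andbT.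
  by rewrite IH andbA.
apply: (@PT_foldl_add _ _ _ _ _ _ _ _ _ (fun=> 3)) => //; try by pt.
- apply: PT_andb; first by pt.
  by apply: (PT_comp (f := fun p : A * (X * bool) => (p.1, p.2.1))) Hf; pt.
- exact: pb_const.
- by move=> x a l1 e l2 _; apply: leq_trans (sz_bool _) _; lia.
Qed.

Lemma PT_find (P : X -> A -> bool) (l : X -> seq A) :
  PT l -> PT (fun p : A * X => P p.2 p.1) -> PT (fun x => find (P x) (l x)).
Proof.
move=> Hl Hf; have Hr := PT_rev Hl.
apply: (PT_ext (f := fun x => foldl (fun n e => if P x e then 0 else n.+1) 0 (rev (l x)))).
  by move=> x; rewrite foldl_rev; elim: (l x) => //= e s ->.
apply: (@PT_foldl_add _ _ _ _ _ _ _ _ _ (fun=> 2)) => //; try by pt.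
- apply: PT_if; [|by pt|by pt].
  by apply: (PT_comp (f := fun p : A * (X * nat) => (p.1, p.2.1))) Hf; pt.
- exact: pb_const.
- by move=> x a l1 e l2 _; case: ifP => _; rewrite !sz_nat; lia.
Qed.

(** The tree of [n] is also that of a list of [n] times [false], so iteration is a fold over the
    counter. *)
Lemma PT_iter (f : X -> A -> A) (n : X -> nat) (a : X -> A) (G : X -> nat) :
  PT n -> PT a -> PT (fun p : A * X => f p.2 p.1) ->
  pb G -> (forall x i, i <= n x -> sz (iter i (f x) (a x)) <= G x) ->
  PT (fun x => iter (n x) (f x) (a x)).
Proof.
move=> Hn Ha Hf HG bnd.
have E x k : foldl (fun y (_ : bool) => f x y) (a x) (nseq k false) = iter k (f x) (a x).
  by elim: k (a x) => //= k IH y; rewrite IH -iterSr.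
apply: (PT_ext (f := fun x => foldl (fun y (_ : bool) => f x y) (a x) (nseq (n x) false))).
  by move=> x; rewrite E.
apply: (PT_foldl (G := G)) => //.
- by apply: PT_recode Hn => x; rewrite /enc /=; elim: (n x) => //= k ->.
- by apply: (PT_comp (f := fun p : bool * (X * A) => (p.2.2, p.2.1))) Hf; pt.
- move=> x l1 l2 El; have L : size l1 <= n x.
    by rewrite -(size_nseq (n x) false) El size_cat leq_addr.
  suff -> : l1 = nseq (size l1) false by rewrite E bnd.
  have := congr1 (take (size l1)) El.
  by rewrite take_size_cat // -{1}(subnKC L) nseqD take_size_cat ?size_nseq.
Qed.
End Lists3.

Section Arith.
Context (X A : Type) {EX : Enc X} {EA : Enc A}.
Implicit Types f g : X -> nat.

Lemma pb_nat f : PT f -> pb f.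
Proof. by move=> /PT_pb; apply: pb_le => x; exact: leq_sz_nat. Qed.

Lemma pb_sz_nat f : pb f -> pb (fun x => sz (f x)).
Proof.
move=> H; apply: (pb_le (h := fun x => 2 * f x + 1)).
  by move=> x; rewrite sz_nat; lia.
by apply: pb_add; [apply: pb_mul|]; try exact: pb_const.
Qed.

Lemma PT_addn f g : PT f -> PT g -> PT (fun x => f x + g x).
Proof.
move=> Hf Hg; apply: (PT_ext (f := fun x => iter (f x) succn (g x))).
  by move=> x; elim: (f x) => //= n ->.
apply: (PT_iter (G := fun x => sz (f x + g x))) => //; first by pt.
  by apply: pb_sz_nat; apply: pb_add; exact: pb_nat.
move=> x i; have -> : iter i succn (g x) = i + g x by elim: i => //= n ->.
by rewrite !sz_nat; lia.
Qed.

Lemma PT_subn f g : PT f -> PT g -> PT (fun x => f x - g x).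
Proof.
move=> Hf Hg; apply: (PT_ext (f := fun x => iter (g x) predn (f x))).
  by move=> x; elim: (g x) => /= [|n ->]; lia.
apply: (PT_iter (G := fun x => sz (f x))) => //; first by pt.
  exact: PT_pb.
move=> x i _; have -> : iter i predn (f x) = f x - i by elim: i => /= [|n ->]; lia.
by rewrite !sz_nat; lia.
Qed.
End Arith.

Lemma PT_muln X {EX : Enc X} (f g : X -> nat) : PT f -> PT g -> PT (fun x => f x * g x).
Proof.
move=> Hf Hg; apply: (PT_ext (f := fun x => iter (f x) (addn (g x)) 0)).
  by move=> x; elim: (f x) => //= n ->; rewrite mulSn.
apply: (PT_iter (G := fun x => sz (f x * g x))) => //; first by pt.
- apply: PT_addn; last by pt.
  by apply: (PT_comp (f := fun p : nat * X => p.2)) Hg; pt.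
- by apply: pb_sz_nat; apply: pb_mul; exact: pb_nat.
- move=> x i ile; have -> : iter i (addn (g x)) 0 = i * g x.
    by elim: i {ile} => //= n ->; rewrite mulSn.
  by have := leq_mul ile (leqnn (g x)); rewrite !sz_nat; lia.
Qed.

Section More.
Context (X A B : Type) {EX : Enc X} {EA : Enc A} {EB : Enc B}.
Implicit Types f g : X -> nat.

Lemma PT_leq f g : PT f -> PT g -> PT (fun x => f x <= g x).
Proof.
move=> Hf Hg; apply: (PT_ext (f := fun x => ~~ (0 < f x - g x))); first by move=> x; lia.
by apply: PT_negb; apply: PT_pos; exact: PT_subn.
Qed.

Lemma PT_eqn f g : PT f -> PT g -> PT (fun x => f x == g x).
Proof.
move=> Hf Hg; apply: (PT_ext (f := fun x => (f x <= g x) && (g x <= f x))).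
  by move=> x; lia.
by apply: PT_andb; exact: PT_leq.
Qed.

Lemma PT_minn f g : PT f -> PT g -> PT (fun x => minn (f x) (g x)).
Proof.
move=> Hf Hg; apply: (PT_ext (f := fun x => if f x <= g x then f x else g x)).
  by move=> x; rewrite /minn; case: ltngtP.
by apply: PT_if => //; exact: PT_leq.
Qed.

Lemma PT_drop (l : X -> seq A) f : PT l -> PT f -> PT (fun x => drop (f x) (l x)).
Proof.
move=> Hl Hf; apply: (PT_ext (f := fun x => iter (f x) behead (l x))).
  by move=> x; elim: (f x) => /= [|n ->]; rewrite ?drop0 // -drop1 drop_drop.
apply: (PT_iter (G := fun x => sz (l x))) => //; first by pt.
  exact: PT_pb.
move=> x i _; elim: i => //= i; apply: leq_trans.
by case: (iter _ _ _) => //= a s; rewrite sz_cons; lia.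
Qed.

Lemma PT_nth z (l : X -> seq A) f : PT l -> PT f -> PT (fun x => nth z (l x) (f x)).
Proof.
move=> Hl Hf; apply: (PT_ext (f := fun x => head z (drop (f x) (l x)))).
  by move=> x; rewrite -nth0 nth_drop addn0.
by apply: PT_head; exact: PT_drop.
Qed.

Lemma PT_iota0 f : PT f -> PT (fun x => iota 0 (f x)).
Proof.
move=> Hf.
have E n : iter n (fun l => size l :: l) [::] = rev (iota 0 n).
  by elim: n => // n IH; rewrite iterS IH size_rev size_iota -addn1 iotaD rev_cat.
apply: (PT_ext (f := fun x => rev (iter (f x) (fun l => size l :: l) [::]))).
  by move=> x; rewrite E revK.
apply: PT_rev.
apply: (PT_iter (G := fun x => f x * (sz (f x)).+1 + 1)) => //; first by pt.
- by apply: PT_cons; [apply: PT_size|]; pt.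
- apply: pb_add; last exact: pb_const; apply: pb_mul; first exact: pb_nat.
  by apply: pb_le (pb_add (PT_pb Hf) (pb_const 1)) => x; rewrite addn1.
- move=> x i ile; rewrite E sz_rev.
  apply: (@leq_trans (i * (sz (f x)).+1 + 1)); last by rewrite leq_add2r leq_mul2r ile orbT.
  elim: i ile => // i IH ile; rewrite -addn1 iotaD cats1 sz_rcons.
  by move: (IH (ltnW ile)); rewrite !sz_nat; lia.
Qed.

Lemma PT_mkseq (h : X -> nat -> A) f :
  PT f -> PT (fun p : nat * X => h p.2 p.1) -> PT (fun x => mkseq (h x) (f x)).
Proof. by move=> Hf Hh; apply: PT_map => //; exact: PT_iota0. Qed.

Lemma PT_sumn (l : X -> seq nat) : PT l -> PT (fun x => sumn (l x)).
Proof.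
move=> Hl; apply: (PT_ext (f := fun x => foldl addn 0 (l x))).
  by move=> x; rewrite -[RHS]add0n; elim: (l x) 0 => [|n s IH] a /=; rewrite ?IH; lia.
apply: (@PT_foldl_add _ _ _ _ _ _ _ _ _ (fun x => sz (l x))) => //; try by pt.
- by apply: PT_addn; pt.
- exact: PT_pb.
- by move=> x a l1 e l2 ->; pose proof (sz_mid l1 l2 e) as H; rewrite !sz_nat in H *; lia.
Qed.

Lemma PT_count (P : X -> A -> bool) (l : X -> seq A) :
  PT l -> PT (fun p : A * X => P p.2 p.1) -> PT (fun x => count (P x) (l x)).
Proof.
move=> Hl HP.
apply: (PT_ext (f := fun x => sumn [seq (if P x e then 1 else 0) | e <- l x])).
  by move=> x; elim: (l x) => //= e s ->; case: (P x e).
by apply: PT_sumn; apply: PT_map => //; apply: PT_if; pt.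
Qed.

End More.

Section Division.
Context (X : Type) {EX : Enc X}.
Implicit Types f g : X -> nat.

(** The quotient is the number of positive multiples of [g x] up to [f x]; trying all candidates is
    affordable in unary. *)
Lemma PT_divn f g : PT f -> PT g -> PT (fun x => f x %/ g x).
Proof.
move=> Hf Hg; apply: (PT_ext (f := fun x =>
  if 0 < g x then count (fun i => i.+1 * g x <= f x) (iota 0 (f x)) else 0)).
  move=> x; case: (posnP (g x)) => [->|gx]; first by rewrite divn0.
  rewrite (eq_count (a2 := fun i => i < f x %/ g x)); last first.
    by move=> i; rewrite /= leq_divRL.
  have : f x %/ g x <= f x by exact: leq_div.
  move: (f x %/ g x) => q; move: (f x) => m /subnKC <-.
  rewrite iotaD count_cat (@eq_in_count _ _ predT); last by move=> i; rewrite mem_iota add0n => /= ->.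
  rewrite count_predT size_iota (@eq_in_count _ _ pred0) ?count_pred0 ?addn0 // => i.
  by rewrite mem_iota /=; lia.
apply: PT_if; [by apply: PT_pos| |by pt].
apply: PT_count; first exact: PT_iota0.
by apply: PT_leq; [apply: PT_muln|]; pt; [apply: PT_comp Hg|apply: PT_comp Hf]; pt.
Qed.

Lemma PT_modn f g : PT f -> PT g -> PT (fun x => f x %% g x).
Proof.
move=> Hf Hg; apply: (PT_ext (f := fun x => f x - f x %/ g x * g x)).
  by move=> x; rewrite {1}(divn_eq (f x) (g x)); lia.
by apply: PT_subn => //; apply: PT_muln => //; exact: PT_divn.
Qed.
End Division.

(** * Bit strings *)

Definition load :=
  Seq (While t0 (@isSome _)
         (If t0 is_true_bit (Seq (Pop t0) (Push t2 true)) (Seq (Pop t0) (Push t2 false))))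
      (Seq (Push t0 false)
           (unload (fun b => Seq (pushes (ser (enc b))) (Push t0 true)))).

Lemma ex_load s :
  ex load [:: s; [::]; [::]; [::]] (20 * size s + 10) (config2 false (ser (enc s)) [::] [::] [::]).
Proof.
apply: (@ex_weaken _ _ ((5 * size s + 1) + (2 + ((9 + 3) * size (rev s) + 1)))).
  by rewrite size_rev; lia.
have L u : ex (While t0 (@isSome _)
     (If t0 is_true_bit (Seq (Pop t0) (Push t2 true)) (Seq (Pop t0) (Push t2 false))))
     [:: s; [::]; u; [::]] (5 * size s + 1) [:: [::]; [::]; rev s ++ u; [::]].
  elim: s u => [|b s IH] u; first exact: ex_whileF.
  rewrite rev_cons cat_rcons.
  apply: (@ex_weaken _ _ ((3).+1 + (5 * size s + 1)).+1) => /=; first lia.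
  apply: ex_whileT (IH (b :: u)); first by [].
  by apply: ex_if; case: b => /=; exact: (ex_seq (ex_pop _ _) (ex_push _ _ _)).
apply: ex_seq (L [::]) _; rewrite cats0.
apply: ex_seq (ex_push _ _ _) _.
have := @ex_unload (fun b => Seq (pushes (ser (enc b))) (Push t0 true)) 9
  (fun s u => config2 false (ser (enc s)) [::] u [::]) [::] (rev s).
rewrite revK cats0; apply => // b s' u.
apply: (@ex_weaken _ _ ((2 * size (ser (enc b)) + 1) + 2)); first by case: b.
exact: ex_seq (ex_pushes _ _ _ _ _) (ex_push _ _ _).
Qed.

Definition store_bits :=
  Seq (While t0 is_true_bit
    (Seq (Pop t0) (If t0 is_true_bit
       (Seq (Pop t0) (Seq (Pop t0) (Seq (Pop t0) (Push t2 true))))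
       (Seq (Pop t0) (Push t2 false)))))
  (Seq (Pop t0) (unload (Push t0))).

Lemma ex_store_bits s :
  ex store_bits (config2 false (ser (enc s)) [::] [::] [::]) (20 * size s + 10)
     [:: s; [::]; [::]; [::]].
Proof.
apply: (@ex_weaken _ _ ((8 * size s + 1) + (1 + ((2 + 3) * size (rev s) + 1)))).
  by rewrite size_rev; lia.
have L u : ex (While t0 is_true_bit
    (Seq (Pop t0) (If t0 is_true_bit
       (Seq (Pop t0) (Seq (Pop t0) (Seq (Pop t0) (Push t2 true))))
       (Seq (Pop t0) (Push t2 false)))))
     [:: ser (enc s); [::]; u; [::]] (8 * size s + 1) [:: [:: false]; [::]; rev s ++ u; [::]].
  elim: s u => [|b s IH] u; first exact: ex_whileF.
  rewrite rev_cons cat_rcons.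
  apply: (@ex_weaken _ _ ((1 + (5).+1) + (8 * size s + 1)).+1) => /=; first lia.
  apply: ex_whileT (IH (b :: u)); first by [].
  apply: ex_seq (ex_pop _ _) _; apply: ex_if; case: b => /=.
    by do 3 apply: ex_seq (ex_pop _ _) _; exact: ex_push.
  apply: (@ex_weaken _ _ 3) => //.
  exact: (ex_seq (ex_pop _ _) (ex_push _ _ _)).
apply: ex_seq (L [::]) _; rewrite cats0.
apply: ex_seq (ex_pop _ _) _.
have := @ex_unload (Push t0) 2 (fun s u => [:: s; [::]; u; [::]]) [::] (rev s).
by rewrite revK cats0; apply => // b s' u; exact: ex_push.
Qed.

Lemma sz_bits (s : seq bool) : size s < sz s <= 4 * size s + 1.
Proof.
rewrite size_le_sz /=; elim: s => //= b s IH; rewrite sz_cons.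
by have := sz_bool b; lia.
Qed.

Lemma PT_poly_time f : PT f -> poly_time f.
Proof.
move=> Hf; have [c [b Hb Hc]] := Hf.
have pbs : pb (fun s : seq bool => size s).
  by apply: pb_le pb_sz => s; have /andP[H _] := sz_bits s; exact: ltnW.
have [k Hk] : pb (fun s => (20 * size s + 10) + (b s + (20 * size (f s) + 10))).
  have L (g : seq bool -> nat) : pb g -> pb (fun s => 20 * g s + 10).
    by move=> Hg; apply: pb_add; [apply: pb_mul|]; try exact: pb_const.
  apply: pb_add; first exact: L; apply: pb_add => //; apply: L.
  by apply: pb_le (PT_pb Hf) => s; have /andP[H _] := sz_bits (f s); exact: ltnW.
(* The factor 3 absorbs the recoding of the input, as [sz s + 2 <= 4 * (size s + 2) <= (size s + 2)
   ^ 3]. *)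
apply: (@run_poly_time (Seq load (Seq c store_bits)) (3 * k)) => s; exists [:: [::]; [::]; [::]].
apply: (@ex_weaken _ _ ((20 * size s + 10) + (b s + (20 * size (f s) + 10)))).
  apply: leq_trans (Hk s) _; rewrite expnM; have /andP[_ H] := sz_bits s.
  case: (k) => // k'; rewrite leq_exp2r // !expnS expn0 muln1.
  by apply: (@leq_trans (4 * (size s + 2))); [lia|rewrite mulnA leq_mul2r; nia].
apply: ex_seq (ex_load s) _.
have := Hc s [::] [::]; rewrite !cats0 => H.
exact: ex_seq H (ex_store_bits _).
Qed.

Section HasAny.
Context (X A : Type) {EX : Enc X} {EA : Enc A}.
Lemma PT_has (P : X -> A -> bool) (l : X -> seq A) :
  PT l -> PT (fun p : A * X => P p.2 p.1) -> PT (fun x => has (P x) (l x)).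
Proof.
move=> Hl HP; apply: (PT_ext (f := fun x => ~~ all (fun e => ~~ P x e) (l x))).
  by move=> x; rewrite -has_predC; apply: eq_has => e /=; rewrite negbK.
by apply: PT_negb; apply: PT_all => //; exact: PT_negb.
Qed.
End HasAny.

Lemma PT_nat_of_bool X {EX : Enc X} (f : X -> bool) :
  PT f -> PT (fun x => nat_of_bool (f x)).
Proof. by move=> H; apply: PT_recode H => x; case: (f x). Qed.

Ltac pt_lib ::= first
  [ simple apply PT_flatten | simple apply PT_rev
  | simple apply PT_cat
  | lazymatch goal with
    | |- PT (fun x => size (@?l x)) => apply: PT_size
    | |- PT (fun x => nilp (@?l x)) => apply: PT_nilp
    | |- PT (fun x => map (@?g x) (@?l x)) => apply: PT_map
    | |- PT (fun x => all (@?g x) (@?l x)) => apply: PT_all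
    | |- PT (fun x => has (@?g x) (@?l x)) => apply: PT_has
    | |- PT (fun x => find (@?g x) (@?l x)) => apply: PT_find
    | |- PT (fun x => count (@?g x) (@?l x)) => apply: PT_count
    | |- PT (fun x => mkseq (@?g x) (@?l x)) => apply: PT_mkseq
    end
  | simple apply PT_iota0 | simple apply PT_sumn
  | simple apply PT_addn | simple apply PT_subn | simple apply PT_muln
  | simple apply PT_nat_of_bool | simple apply PT_leq | simple apply PT_eqn | simple apply PT_minn
  | simple apply PT_nth | simple apply PT_drop
  | simple apply PT_divn | simple apply PT_modn
  | progress cbv beta ].

Section Numbers.
Context (X : Type) {EX : Enc X}.

Lemma PT_odd (f : X -> nat) : PT f -> PT (fun x => odd (f x)).
Proof.
move=> Hf; apply: (PT_ext (f := fun x => f x %% 2 == 1)); last by pt.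
by move=> x; rewrite modn2; case: odd.
Qed.

Lemma PT_half (f : X -> nat) : PT f -> PT (fun x => (f x)./2).
Proof.
move=> Hf; apply: (PT_ext (f := fun x => f x %/ 2)); last by pt.
by move=> x; rewrite divn2.
Qed.

Lemma PT_horner (p : {poly nat}) (f : X -> nat) : PT f -> PT (fun x => p.[f x]%R).
Proof.
move=> Hf; rewrite /poly.horner; elim: (poly.polyseq p) => [|a s IH] /=; first by pt.
by apply: PT_addn; [apply: PT_muln|]; pt.
Qed.
End Numbers.

Lemma horner_leq (p : {poly nat}) m n : m <= n -> p.[m]%R <= p.[n]%R.
Proof.
move=> mn; rewrite /poly.horner; elim: (poly.polyseq p) => //= a s IH.
by apply: leq_add => //; exact: leq_mul.
Qed.

Lemma bits0 : bits 0 = [::]. Proof. by []. Qed.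
Lemma bits_half n : 0 < n -> bits n = odd n :: bits n./2.
Proof.
move=> n0; rewrite /bits up_log2S //= /mkseq /= -[1]addn0 iotaDl -map_comp.
rewrite expn0 divn1; congr (_ :: _); apply: eq_map => i /=.
by rewrite expnD expn1 divnMA divn2.
Qed.

Section Bits.
Let halve (p : nat * seq bool) := if 0 < p.1 then (p.1./2, odd p.1 :: p.2) else p.

Lemma iter_halve n m out : m <= n -> rev (iter n halve (m, out)).2 = rev out ++ bits m.
Proof.
elim: n m out => [|n IH] m out.
  by rewrite leqn0 => /eqP -> /=; rewrite bits0 cats0.
move=> mn; rewrite iterSr /halve /=; case: posnP => m0.
  by rewrite m0 -/halve IH.
rewrite -/halve IH /=; last lia.
by rewrite (bits_half m0) rev_cons cat_rcons.
Qed.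

Lemma PT_bits X {EX : Enc X} (f : X -> nat) : PT f -> PT (fun x => bits (f x)).
Proof.
move=> Hf.
apply: (PT_ext (f := fun x => rev (iter (f x) halve (f x, [::])).2)).
  by move=> x; rewrite iter_halve.
apply: PT_rev; apply: PT_snd.
apply: (PT_iter (G := fun x => sz (f x) + (4 * f x + 2))) => //; first by pt.
- by rewrite /halve; pt; [apply: PT_half; pt|apply: PT_odd; pt].
- by apply: pb_add; [exact: PT_pb|apply: pb_add; [apply: pb_mul; [|exact: pb_nat]|]]; exact: pb_const.
- move=> x i ix; have [H1 H2] : (iter i halve (f x, [::])).1 <= f x /\ size (iter i halve (f x, [::])).2 <= i.
    elim: i {ix} => // i [IH1 IH2]; rewrite iterS.
    case: (iter i halve _) IH1 IH2 => m out /= IH1 IH2; rewrite /halve /=.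
    by case: ifP => _ /=; split; lia.
  case: (iter _ _ _) H1 H2 => m out /= H1 H2; rewrite sz_pair !sz_nat.
  by have /andP[_] := sz_bits out; lia.
Qed.

Lemma PT_delimit X {EX : Enc X} (f : X -> seq bool) : PT f -> PT (fun x => delimit (f x)).
Proof. by move=> Hf; rewrite /delimit; pt. Qed.
End Bits.

(** * The reduction *)

Definition encode_numbers (v : nat) (l : seq nat) : seq bool :=
  nseq v true ++ false :: flatten [seq delimit (bits n) | n <- l].

Definition has_literal (b : bool) (phi : seq (seq (bool * nat))) R i :=
  has (fun l => (l.1 == b) && (l.2 == i)) (nth [::] phi R).

Lemma has_literalE b phi R i : has_literal b phi R i = ((b, i) \in nth [::] phi R).
Proof.
apply/hasP/idP => [[[c j] H /= /andP[/eqP <- /eqP <-]]|H] //.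
by exists (b, i) => //=; rewrite !eqxx.
Qed.

Lemma satisfies_cnf (phi : seq (seq (bool * nat))) n a :
  (forall cl l, cl \in phi -> l \in cl -> l.2 < n) ->
  satisfies (size phi) n (has_literal true phi) (has_literal false phi) a <->
  sat_cnf a phi.
Proof.
move=> lt_n; have L R i : lit (has_literal true phi) (has_literal false phi) a R i =
    ((a i, i) \in nth [::] phi R).
  by rewrite /lit !has_literalE; case: (a i); rewrite ?andbT ?andbF ?orbF.
split=> [H|/allP H R Rm].
  apply/(all_nthP [::]) => R /H[i _]; rewrite L => il.
  by apply/hasP; exists (a i, i).
have /H/hasP[[b i] bl /eqP E] := mem_nth [::] Rm.
exists i; first exact: (lt_n _ _ (mem_nth [::] Rm) bl).
by rewrite L E.
Qed.

Lemma interdiction_max_le x z :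
  budget x <= z -> threshold x <= z -> (forall e, @weight x e <= z) ->
  (forall e, @icost x e <= z) -> interdiction_max x <= z.
Proof.
move=> Bz kz wz cz; rewrite /interdiction_max !geq_max Bz kz /=.
by apply/bigmax_leqP => e _; rewrite geq_max wz cz.
Qed.

Section Reduction.
Variables (M : TM) (p q : {poly nat}).

Definition known (s : seq bool) := delimit s.
Definition guessed (s : seq bool) := q.[size s]%R.
(** The first two summands leave room for the input on the tape, as [T_large] demands; the last one
    bounds the running time for every admissible certificate. *)
Definition run_time s := size (known s) + guessed s + p.[size (known s) + guessed s]%R.
Definition formula s := cnf M (run_time s) (guessed s) (known s).
Definition nvars s := num_vars M (run_time s).
Definition nclauses s := size (formula s).
Definition width s := 4 * nvars s + 3.
Definition last_cell s := (nclauses s * (4 * width s)).-1.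
Definition pos_lit s := has_literal true (formula s).
Definition neg_lit s := has_literal false (formula s).
Definition nedges s := last_cell s + ((last_cell s).+1 - width s).

Definition edge_numbers s e :=
  [:: helix_tail (last_cell s) e; helix_head (last_cell s) (width s) e;
      if e < last_cell s then hw (nvars s) (pos_lit s) (neg_lit s) e
      else vw (nvars s) (e - last_cell s);
      if e < last_cell s then hc (nclauses s) (nvars s) e
      else vc (nclauses s) (nvars s) (e - last_cell s)].

Definition reduction s := encode_numbers (last_cell s).+1
  (budget_of (nclauses s) (nvars s) :: threshold_of (nclauses s) (nvars s) ::
   flatten [seq edge_numbers s e | e <- iota 0 (nedges s)]).

Section Time.
Context (X : Type) {EX : Enc X}.
Implicit Types (f : X -> seq bool) (g : X -> nat).

Lemma PT_known f : PT f -> PT (fun x => known (f x)).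
Proof. exact: PT_delimit. Qed.
Lemma PT_guessed f : PT f -> PT (fun x => guessed (f x)).
Proof. by move=> Hf; apply: PT_horner; pt. Qed.
Lemma PT_run_time f : PT f -> PT (fun x => run_time (f x)).
Proof.
move=> Hf; have H1 := PT_known Hf; have H2 := PT_guessed Hf.
by rewrite /run_time; pt; apply: PT_horner; pt.
Qed.
End Time.

Ltac pt_lib2 := first
  [ simple apply PT_known | simple apply PT_guessed | simple apply PT_run_time | pt_step ].

Lemma PT_formula X {EX : Enc X} (f : X -> seq bool) : PT f -> PT (fun x => formula (f x)).
Proof.
move=> Hf; rewrite /formula /cnf /transition /initial /contiguous /variable.
repeat pt_lib2.
all: by apply: PT_comp Hf; pt.
Qed.

Ltac pt2 := repeat first
  [ simple apply PT_known | simple apply PT_guessed | simple apply PT_run_time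
  | simple apply PT_formula | pt_step ].

Section Time2.
Context (X : Type) {EX : Enc X}.
Implicit Types (f : X -> seq bool) (g : X -> nat).

Lemma PT_nvars f : PT f -> PT (fun x => nvars (f x)).
Proof. by move=> Hf; rewrite /nvars /num_vars; pt2. Qed.
Lemma PT_nclauses f : PT f -> PT (fun x => nclauses (f x)).
Proof. by move=> Hf; rewrite /nclauses; pt2. Qed.
Lemma PT_literal b f g h : PT f -> PT g -> PT h ->
  PT (fun x => has_literal b (formula (f x)) (g x) (h x)).
Proof.
move=> Hf Hg Hh; rewrite /has_literal; pt2.
by apply: (PT_comp (f := fun p : (bool * nat) * X => p.2)) Hh; pt.
Qed.
End Time2.

Ltac pt3 := repeat first
  [ simple apply PT_nvars | simple apply PT_nclauses | simple apply PT_literal | pt_step ].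

Section Time3.
Context (X : Type) {EX : Enc X}.
Implicit Types (f : X -> seq bool) (g : X -> nat).

Lemma PT_width f : PT f -> PT (fun x => width (f x)).
Proof. by move=> Hf; rewrite /width; pt3. Qed.
Lemma PT_last_cell f : PT f -> PT (fun x => last_cell (f x)).
Proof. by move=> Hf; rewrite /last_cell /width; pt3. Qed.
Lemma PT_budget f : PT f -> PT (fun x => budget_of (nclauses (f x)) (nvars (f x))).
Proof. by move=> Hf; rewrite /budget_of; pt3. Qed.
Lemma PT_hw f g : PT f -> PT g ->
  PT (fun x => hw (nvars (f x)) (pos_lit (f x)) (neg_lit (f x)) (g x)).
Proof.
move=> Hf Hg.
rewrite /hw /hweight /clause_of /row_of /var_of /col_of /pos_lit /neg_lit.
pt3.
Qed.
Lemma PT_vw f g : PT f -> PT g -> PT (fun x => vw (nvars (f x)) (g x)).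
Proof. by move=> Hf Hg; rewrite /vw /vweight /row_of /var_of /col_of; pt3. Qed.
Lemma PT_hc f g : PT f -> PT g -> PT (fun x => hc (nclauses (f x)) (nvars (f x)) (g x)).
Proof. by move=> Hf Hg; rewrite /hc /hcost /budget_of /row_of /col_of; pt3. Qed.
Lemma PT_vc f g : PT f -> PT g -> PT (fun x => vc (nclauses (f x)) (nvars (f x)) (g x)).
Proof. by move=> Hf Hg; rewrite /vc /vcost /budget_of /row_of /var_of /col_of; pt3. Qed.
End Time3.

Ltac pt4 := repeat first
  [ simple apply PT_width | simple apply PT_last_cell | simple apply PT_budget
  | simple apply PT_hw | simple apply PT_vw | simple apply PT_hc | simple apply PT_vc
  | simple apply PT_nvars | simple apply PT_nclauses | simple apply PT_bits
  | simple apply PT_delimit | pt_step ].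

Lemma PT_encode_numbers X {EX : Enc X} (g : X -> nat) (l : X -> seq nat) :
  PT g -> PT l -> PT (fun x => encode_numbers (g x) (l x)).
Proof.
move=> Hg Hl; rewrite /encode_numbers.
apply: (PT_ext (f := fun x => [seq true | _ <- iota 0 (g x)] ++
   false :: flatten [seq delimit (bits n) | n <- l x])); last by pt4.
by move=> x; rewrite -{2}(size_iota 0 (g x)); elim: (iota _ _) => //= a s IH; congr (_ :: _).
Qed.

Lemma PT_reduction : PT reduction.
Proof.
have Hs : PT (fun s : seq bool => s) by exact: PT_id.
rewrite /reduction; apply: PT_encode_numbers; first by pt4.
rewrite /nedges /edge_numbers /helix_tail /helix_head /threshold_of.
pt4.
Qed.

Lemma nclauses_gt0 s : 0 < nclauses s.
Proof. by apply: cnf_size_gt0; rewrite /run_time leq_addr. Qed.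

Definition grid_instance s : interdiction :=
  let m0 := nclauses_gt0 s in
  @Interdiction (last_cell s).+1 (nedges s) (@helix_ends _ _)
    (@eweight (nclauses s) (nvars s) (pos_lit s) (neg_lit s))
    (@ecost (nclauses s) (nvars s))
    (budget_of (nclauses s) (nvars s)) (threshold_of (nclauses s) (nvars s))
    (helix_simple (W_gt2 _) (W_odd _) (W_le _ m0))
    (helix_bipartite (W_gt2 _) (W_odd _) (W_le _ m0))
    (helix_planar (W_gt2 _) (W_odd _) (W_le _ m0))
    (ltac:(rewrite /budget_of muln_gt0 m0 addn1 //)).

Lemma grid_encode s : interdiction_encode (grid_instance s) = reduction s.
Proof.
rewrite /interdiction_encode /reduction /encode_numbers; congr (_ ++ _ :: flatten (map _ (_ :: _ :: _))).
rewrite -(val_enum_ord (nedges s)) -map_comp; congr flatten; apply: eq_map => e /=.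
by rewrite !inordK ?helix_tail_lt ?helix_head_lt ?W_le ?W_gt2 ?W_odd ?nclauses_gt0.
Qed.

Lemma grid_yes s :
  nuE (@ends (grid_instance s)) (@weight (grid_instance s)) (@icost (grid_instance s))
    (budget (grid_instance s)) < threshold (grid_instance s) <->
  exists a, sat_cnf a (formula s).
Proof.
have T : size (known s) + guessed s <= run_time s by exact: leq_addr.
apply: iff_trans (layout_nuE _ _ _ (nclauses_gt0 s)) _.
apply: iff_trans (layout_correct _ _ _ _) _.
have H cl l : cl \in formula s -> l \in cl -> l.2 < nvars s by exact: cnf_vars.
by split=> -[a Ha]; exists a; apply/(satisfies_cnf a H).
Qed.

Lemma size_delimit b : size (delimit b) = (size b).*2.+1.
Proof.
rewrite /delimit size_cat addn1; congr _.+1.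
by elim: b => //= x b IH; rewrite IH.
Qed.

Lemma size_encode_numbers v l : v + size l < size (encode_numbers v l).
Proof.
rewrite /encode_numbers size_cat size_nseq /= addnS ltnS leq_add2l size_flatten.
by elim: l => //= n l IH; rewrite size_delimit; move: IH; rewrite /shape; lia.
Qed.

(** All numbers are linear in the number of cells. The threshold may exceed that number itself, so
    the four tokens of every edge have to be counted as well; they account for the factor 5 in
    [L]. *)
Lemma grid_max s : interdiction_max (grid_instance s) <= size (interdiction_encode (grid_instance s)).
Proof.
have m0 := nclauses_gt0 s.
have Enl : (last_cell s).+1 = nclauses s * (4 * width s) by exact/esym/cells_gt0.
have L : 5 * (nclauses s * (4 * width s)) <= size (interdiction_encode (grid_instance s)) + 1.
  rewrite grid_encode; apply: leq_trans (_ : _ <= (last_cell s).+1 + (2 + 4 * nedges s) + 1 + 1) _.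
    by rewrite -Enl /nedges; lia.
  rewrite leq_add2r addn1; apply: leq_trans (size_encode_numbers _ _).
  have F (r : seq nat) : size (flatten [seq edge_numbers s e | e <- r]) = 4 * size r.
    by elim: r => //= e r ->; rewrite mulnS.
  rewrite ltnS leq_add2l -[size (_ :: _ :: _)]/((size _).+2) F size_iota add2n.
  exact: leqnn.
have [B1 B2 B3] : [/\ budget_of (nclauses s) (nvars s) < size (interdiction_encode (grid_instance s)),
   threshold_of (nclauses s) (nvars s) <= size (interdiction_encode (grid_instance s)) &
   7 <= size (interdiction_encode (grid_instance s))].
  move: L m0; rewrite /budget_of /threshold_of /width; case: (nclauses s) => // k.
  move: (size _) (nvars s) => z n; clear=> L _; split; lia.
move: (size _) B1 B2 B3 {L Enl} => z B1 B2 B3.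
apply: interdiction_max_le => [||e|e]; [exact: ltnW B1|exact: B2| |].
  rewrite /= /eweight; apply: leq_trans B3; case: ifP => _; first exact: hw_le.
  exact: leq_trans (vw_le _ _) _.
rewrite /= /ecost; apply: leq_trans B1; case: ifP => _.
  by rewrite /hc /hcost; case: ifP.
by rewrite /vc /vcost; case: ifP.
Qed.
End Reduction.

(** * Parsing and binary arithmetic *)

(** State: whether a data bit is expected, the reversed current token, and the
    reversed list of complete tokens. *)
Definition tok_step (st : bool * (seq bool * seq (seq bool))) (b : bool) :=
  if st.1 then (false, (b :: st.2.1, st.2.2))
  else if b then (true, st.2) else (false, ([::], rev st.2.1 :: st.2.2)).
Definition tokens s := rev (foldl tok_step (false, ([::], [::])) s).2.2.

Lemma foldl_tok_out p cur out r :
  (foldl tok_step (p, (cur, out)) r).2.2 = (foldl tok_step (p, (cur, [::])) r).2.2 ++ out.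
Proof.
elim: r p cur out => //= b r IH p cur out; rewrite /tok_step /=.
case: p => /=; first by rewrite IH.
by case: b => /=; rewrite IH // [in RHS]IH -catA.
Qed.

Lemma tokens_delimit t r : tokens (delimit t ++ r) = t :: tokens r.
Proof.
have E cur out : foldl tok_step (false, (cur, out)) (delimit t ++ r) =
    foldl tok_step (false, ([::], (rev cur ++ t) :: out)) r.
  rewrite /delimit; elim: t cur => [|b t IH] cur; first by rewrite /= cats0.
  by rewrite /= IH rev_cons cat_rcons.
by rewrite /tokens E foldl_tok_out rev_cat.
Qed.

Lemma tokens_flatten L : tokens (flatten [seq delimit t | t <- L]) = L.
Proof. by elim: L => //= t L IH; rewrite tokens_delimit IH. Qed.

Definition bval (b : seq bool) : nat := foldr (fun (x : bool) n => x + n.*2) 0 b.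

Lemma bval_bits n : bval (bits n) = n.
Proof.
have [k] := ubnP n; elim: k n => // k IH n nk.
case: (posnP n) => [->|n0] //; rewrite bits_half //= IH; last lia.
exact: odd_double_half.
Qed.

Lemma bits_inj : injective bits.
Proof. by move=> m n /(congr1 bval); rewrite !bval_bits. Qed.

Lemma last_bits n : last true (bits n).
Proof.
have [k] := ubnP n; elim: k n => // k IH n nk.
case: (posnP n) => [->|n0] //; rewrite bits_half //=.
have := IH n./2; case: (posnP n./2) => [h0 _|h0].
  by rewrite h0 bits0 /=; move: (odd_double_half n); rewrite h0; case: odd => //=; lia.
by rewrite (bits_half h0) /=; apply; lia.
Qed.

(** The last bit is the most significant one, so the condition excludes leading zeros; the default
    [true] admits the empty string for 0. *)
Lemma bits_bval b : last true b -> bits (bval b) = b.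
Proof.
elim: b => //= x b IH lb.
have lb' : last true b by case: b lb {IH} => //= y b.
have pos : 0 < x + (bval b).*2.
  case: x lb => //= lb; have := IH lb'; case: (bval b) => // Eb.
  by rewrite bits0 in Eb; rewrite -Eb in lb.
rewrite bits_half // oddD odd_double addbF half_bit_double IH //.
by case: x {lb pos}.
Qed.

Lemma bval_rcons s b : bval (rcons s b) = bval s + 2 ^ size s * b.
Proof.
elim: s => [|x s IH] /=; first by rewrite expn0; lia.
by rewrite IH expnS; lia.
Qed.

Lemma size_bits_leq m n : m <= n -> size (bits m) <= size (bits n).
Proof. by move=> mn; rewrite !size_mkseq; apply: leq_up_log. Qed.

(** A full adder: the carry is the majority, and [a == (b == c)] is the parity of three bits. Sums
    may get leading zeros, which is harmless as only [bval] of them is used. *)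
Definition add_step (st : bool * (seq bool * (seq bool * seq bool))) :=
  let c := st.1 in let x := st.2.1 in let y := st.2.2.1 in
  let a := head false x in let b := head false y in
  ((a && b) || (a && c) || (b && c),
   (behead x, (behead y, (a == (b == c)) :: st.2.2.2))).
Definition add_bits x y :=
  rev (iter (size x + size y).+1 add_step (false, (x, (y, [::])))).2.2.2.

Lemma bval_head x : bval x = head false x + (bval (behead x)).*2.
Proof. by case: x. Qed.

Lemma iter_add_step n c x y out : size x <= n -> size y <= n ->
  bval (rev (iter n.+1 add_step (c, (x, (y, out)))).2.2.2) =
  bval (rev out) + 2 ^ size out * (c + bval x + bval y).
Proof.
elim: n c x y out => [|n IH] c x y out.
  by rewrite !leqn0 !size_eq0 => /eqP -> /eqP -> /=; rewrite rev_cons bval_rcons size_rev; case: c; lia.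
move=> xn yn; rewrite iterSr {1}/add_step; cbn [fst snd].
rewrite IH; try by rewrite size_behead /=; lia.
rewrite rev_cons bval_rcons size_rev [size _]/= expnS (bval_head x) (bval_head y).
move: (head false x) (head false y) (bval (behead x)) (bval (behead y)) (2 ^ _).
by move=> a b u v P; case: a; case: b; case: c; rewrite ?(eqb_id, eqbF_neg) /=; clear; lia.
Qed.

Lemma bval_addb x y : bval (add_bits x y) = bval x + bval y.
Proof. by rewrite /add_bits iter_add_step /=; lia. Qed.

Lemma size_addb x y : size (add_bits x y) = (size x + size y).+1.
Proof.
rewrite /add_bits size_rev; set n := _.+1.
suff H k st : size (iter k add_step st).2.2.2 = k + size st.2.2.2 by rewrite H addn0.
by elim: k => //= k ->.
Qed.

Definition bsum (l : seq (seq bool)) := foldl add_bits [::] l.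

Lemma bval_bsum l : bval (bsum l) = sumn (map bval l).
Proof.
rewrite /bsum -[RHS]add0n -[0]/(bval [::]); elim: l [::] => [|x l IH] a /=; first by rewrite addn0.
by rewrite IH bval_addb addnA.
Qed.

(** Low bits come first, so a later difference overrides the verdict so far. *)
Definition leq_step (st : bool * (seq bool * seq bool)) :=
  let a := head false st.2.1 in let b := head false st.2.2 in
  (if a == b then st.1 else b, (behead st.2.1, behead st.2.2)).
Definition leqb x y := (iter (size x + size y) leq_step (true, (x, y))).1.

Lemma iter_leq_step n r x y : size x <= n -> size y <= n ->
  (iter n leq_step (r, (x, y))).1 = (bval x < bval y + r).
Proof.
elim: n r x y => [|n IH] r x y.
  by rewrite !leqn0 !size_eq0 => /eqP -> /eqP -> /=; case: r.
move=> xn yn; rewrite iterSr {1}/leq_step; cbn [fst snd].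
rewrite IH; try by rewrite size_behead /=; lia.
rewrite (bval_head x) (bval_head y).
move: (head false x) (head false y) (bval (behead x)) (bval (behead y)).
by move=> a b u v; case: a; case: b; case: r; rewrite ?(eqb_id, eqbF_neg) /=; clear; lia.
Qed.

Lemma leqbE x y : leqb x y = (bval x <= bval y).
Proof. by rewrite /leqb iter_leq_step ?leq_addr ?leq_addl // addn1. Qed.

Section Time.
Context (X : Type) {EX : Enc X}.
Implicit Types (f g : X -> seq bool).

Lemma sz_bits_le (s : seq bool) : sz s <= 4 * size s + 1.
Proof. by have /andP[] := sz_bits s. Qed.

Lemma pb_size f : PT f -> pb (fun x => size (f x)).
Proof. by move=> /PT_pb; apply: pb_le => x; rewrite ltnW // size_le_sz. Qed.

Lemma PT_eqbits f g : PT f -> PT g -> PT (fun x => f x == g x).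
Proof.
move=> Hf Hg; apply: (PT_ext (f := fun x => (size (f x) == size (g x)) &&
   all (fun i => nth false (f x) i == nth false (g x) i) (iota 0 (size (f x))))).
  move=> x; apply/andP/eqP => [[/eqP E /allP H]|-> //].
    by apply: (eq_from_nth E) => i ix; apply/eqP/H; rewrite mem_iota.
  by split=> //; apply/allP.
by pt; [apply: PT_comp Hf|apply: PT_comp Hg]; pt.
Qed.

Lemma PT_tokens f : PT f -> PT (fun x => tokens (f x)).
Proof.
move=> Hf; rewrite /tokens; apply: PT_rev; apply: PT_snd; apply: PT_snd.
apply: (PT_foldl_add (d := fun=> 6)) => //.
- by pt.
- by rewrite /tok_step; pt.
- exact: pb_const.
move=> x [p [cur out]] l1 b l2 _; rewrite /tok_step /=.
have E1 : sz true = 3 by [].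
have E0 : sz false = 1 by [].
have := sz_bool b; case: p; rewrite /= !sz_pair ?E1 ?E0; first by rewrite sz_cons; lia.
by case: b => /=; rewrite !sz_pair ?sz_cons ?sz_rev ?sz_nil ?E1 ?E0; lia.
Qed.

Lemma PT_addb f g : PT f -> PT g -> PT (fun x => add_bits (f x) (g x)).
Proof.
move=> Hf Hg; rewrite /add_bits; apply: PT_rev; do 3 apply: PT_snd.
apply: (PT_iter (G := fun x => 8 * (size (f x) + size (g x)) + 20)); try by pt.
- by rewrite /add_step; pt.
- apply: pb_add; last exact: pb_const; apply: pb_mul; first exact: pb_const.
  by apply: pb_add; exact: pb_size.
move=> x i ile.
have : [/\ size (iter i add_step (false, (f x, (g x, [::])))).2.1 <= size (f x),
   size (iter i add_step (false, (f x, (g x, [::])))).2.2.1 <= size (g x) &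
   size (iter i add_step (false, (f x, (g x, [::])))).2.2.2 <= i].
  elim: i {ile} => // i [H1 H2 H3]; rewrite iterS.
  case: (iter i _ _) H1 H2 H3 => c [a [b o]] /= H1 H2 H3.
  by rewrite !size_behead; split; lia.
case: (iter i _ _) => c [a [b o]] /= [H1 H2 H3]; rewrite !sz_pair.
have := sz_bits_le a; have := sz_bits_le b; have := sz_bits_le o; have := sz_bool c.
lia.
Qed.

Lemma PT_leqb f g : PT f -> PT g -> PT (fun x => leqb (f x) (g x)).
Proof.
move=> Hf Hg; rewrite /leqb; apply: PT_fst.
apply: (PT_iter (G := fun x => 4 * (size (f x) + size (g x)) + 20)); try by pt.
- by rewrite /leq_step; pt.
- apply: pb_add; last exact: pb_const; apply: pb_mul; first exact: pb_const.
  by apply: pb_add; exact: pb_size.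
move=> x i ile.
have : size (iter i leq_step (true, (f x, g x))).2.1 <= size (f x) /\
   size (iter i leq_step (true, (f x, g x))).2.2 <= size (g x).
  elim: i {ile} => // i [H1 H2]; rewrite iterS.
  case: (iter i _ _) H1 H2 => c [a b] /= H1 H2.
  by rewrite !size_behead; split; lia.
case: (iter i _ _) => c [a b] /= [H1 H2]; rewrite !sz_pair.
have := sz_bits_le a; have := sz_bits_le b; have := sz_bool c; lia.
Qed.
End Time.

Lemma PT_bsum X {EX : Enc X} (l : X -> seq (seq bool)) : PT l -> PT (fun x => bsum (l x)).
Proof.
move=> Hl; rewrite /bsum; apply: (PT_foldl (G := fun x => 4 * sz (l x) + 1)) => //; first by pt.
- by apply: PT_addb; pt.
- by apply: pb_add; [apply: pb_mul; [|exact: PT_pb]|]; exact: pb_const.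
move=> x l1 l2 /= ->; apply: leq_trans (sz_bits_le _) _.
enough (size (foldl add_bits [::] l1) <= sz l1).
  by pose proof (sz_cat l1 l2); pose proof (size_le_sz l2); lia.
elim/last_ind: l1 => // l1 e IH; rewrite foldl_rcons size_addb sz_rcons.
by pose proof (size_le_sz e); lia.
Qed.

(** * The verifier *)

Definition encode_tokens (v : nat) (l : seq (seq bool)) : seq bool :=
  nseq v true ++ false :: flatten [seq delimit t | t <- l].

Lemma encode_numbers_tokens v l : encode_numbers v l = encode_tokens v [seq bits n | n <- l].
Proof. by rewrite /encode_tokens -map_comp. Qed.

(** The number of vertices is read in unary, then the numbers as tokens: budget,
    threshold, and four tokens for every edge. *)
Definition vcount s := find negb s.
Definition toks s := tokens (drop (vcount s).+1 s).
Definition tok s j := nth [::] (toks s) j.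
Definition ecount s := (size (toks s) - 2) %/ 4.
Definition etok s e j := tok s (2 + (4 * e + j)).
(** A token is looked up rather than evaluated, since its value in unary could be exponentially
    large. An unknown token yields [vcount s], which [well_formed] rejects. *)
Definition vertex s t := find (fun i => bits i == t) (iota 0 (vcount s)).
Definition end1 s e := vertex s (etok s e 0).
Definition end2 s e := vertex s (etok s e 1).

Lemma vcount_encode v l : vcount (encode_tokens v l) = v.
Proof. by rewrite /vcount find_cat has_nseq andbF /= size_nseq addn0. Qed.

Lemma toks_encode v l : toks (encode_tokens v l) = l.
Proof.
rewrite /toks vcount_encode /encode_tokens drop_cat size_nseq ltnNge leqnSn /=.
by rewrite subSnn /= drop0 tokens_flatten.
Qed.

Lemma nth_flatten4 (A : Type) (d : A) (h : nat -> nat -> A) m n j r : j < n -> r < 4 ->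
  nth d (flatten [seq [:: h e 0; h e 1; h e 2; h e 3] | e <- iota m n]) (4 * j + r) =
  h (m + j) r.
Proof.
elim: n m j => // n IH m [|j] jn r4.
  by rewrite addn0 muln0 add0n {IH}; case: r r4 => [|[|[|[|r]]]].
by rewrite mulnS -addnA /= IH // addnS addSn.
Qed.

Lemma size_flatten4 (A : Type) (h : nat -> nat -> A) (l : seq nat) :
  size (flatten [seq [:: h e 0; h e 1; h e 2; h e 3] | e <- l]) = 4 * size l.
Proof. by elim: l => //= e l ->; rewrite mulnS. Qed.

(** Encoding the parsed data again must give [s] back, which rules out malformed tails; the last
    bits exclude leading zeros, and the empty token would be budget 0. *)
Definition well_formed s :=
  [&& encode_tokens (vcount s) (toks s) == s, size (toks s) == 2 + 4 * ecount s,
      all (fun t => last true t) (toks s), 0 < size (tok s 0) &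
      all (fun e => (end1 s e < vcount s) && (end2 s e < vcount s)) (iota 0 (ecount s))].

(** The flag lets one verifier serve both the full problem and its subproblem with numbers at most
    the input length. *)
Definition small_numbers (b : bool) s :=
  b ==> all (fun t => leqb t (bits (size s))) (toks s).

(** Certificate [C]: the sides, the interdiction set, the potentials in binary, and
    the rotation of every dart in unary. *)
Definition ctok (C : seq (seq bool)) j := nth [::] C j.
Definition cut C e := nth false (ctok C 1) e.
Definition pot C i := ctok C (2 + i).
Definition rotation s C d := size (ctok C (2 + vcount s + d)).

Definition graph_ok s C :=
  [&& simple_check (ecount s) (end1 s) (end2 s),
      bipartite_check (ecount s) (end1 s) (end2 s) (ctok C 0) &
      planar_check (ecount s) (end1 s) (end2 s) (rotation s C)].

Definition solution_ok s C :=
  [&& leqb (bsum [seq if cut C e then etok s e 3 else [::] | e <- iota 0 (ecount s)]) (tok s 0),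
      ~~ leqb (tok s 1) (bsum [seq pot C i | i <- iota 0 (vcount s)]) &
      all (fun e => cut C e || leqb (etok s e 2) (add_bits (pot C (end1 s e)) (pot C (end2 s e))))
          (iota 0 (ecount s))].

Definition check_instance b s C :=
  [&& well_formed s, small_numbers b s, graph_ok s C & solution_ok s C].

Definition verify b str := check_instance b (head [::] (tokens str)) (behead (tokens str)).

(** * The verifier on encodings of instances *)

Section Parsed.
Variable x : interdiction.
Let s := interdiction_encode x.
Notation end1x e := (@ends x e).1.
Notation end2x e := (@ends x e).2.

Definition edge_entry (e j : nat) : nat :=
  if insub e is Some e' then nth 0 [:: nat_of_ord (end1x e'); nat_of_ord (end2x e'); weight e'; icost e'] j else 0.

Lemma edge_entryE (e : 'I_(ne x)) j :
  edge_entry e j = nth 0 [:: nat_of_ord (end1x e); nat_of_ord (end2x e); weight e; icost e] j.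
Proof. by rewrite /edge_entry (valK e). Qed.

Lemma encode_parsed : s = encode_tokens (nv x)
  [seq bits n | n <- [:: budget x, threshold x &
     flatten [seq [:: edge_entry e 0; edge_entry e 1; edge_entry e 2; edge_entry e 3]
             | e <- iota 0 (ne x)]]].
Proof.
rewrite -encode_numbers_tokens /s /interdiction_encode /encode_numbers.
congr (_ ++ _ :: flatten (map _ (_ :: _ :: flatten _))).
by rewrite -(val_enum_ord (ne x)) -map_comp; apply: eq_map => e; rewrite /= !edge_entryE.
Qed.

Lemma vcount_parsed : vcount s = nv x.
Proof. by rewrite encode_parsed vcount_encode. Qed.

Lemma toks_parsed : toks s = bits (budget x) :: bits (threshold x) ::
  flatten [seq [:: bits (edge_entry e 0); bits (edge_entry e 1);
                   bits (edge_entry e 2); bits (edge_entry e 3)] | e <- iota 0 (ne x)].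
Proof.
rewrite encode_parsed toks_encode /=; congr (_ :: _ :: _).
by rewrite map_flatten -map_comp.
Qed.

Lemma ecount_parsed : ecount s = ne x.
Proof.
rewrite /ecount toks_parsed /= (size_flatten4 (fun e j => bits (edge_entry e j))) size_iota.
by rewrite !subSS subn0 mulKn.
Qed.

Lemma etok_parsed (e : 'I_(ne x)) j : j < 4 -> etok s e j =
  bits (nth 0 [:: nat_of_ord (end1x e); nat_of_ord (end2x e); weight e; icost e] j).
Proof.
move=> j4; rewrite /etok /tok toks_parsed /=.
by rewrite (nth_flatten4 _ (fun e j => bits (edge_entry e j))) // add0n edge_entryE.
Qed.

Lemma vertex_bits (i : 'I_(nv x)) : vertex s (bits i) = i.
Proof.
rewrite /vertex vcount_parsed.
have H : has (fun k => bits k == bits i) (iota 0 (nv x)).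
  by apply/hasP; exists (i : nat); rewrite ?mem_iota ?add0n ?ltn_ord.
have := nth_find 0 H; rewrite nth_iota ?add0n; first by move/eqP/bits_inj.
by move: H; rewrite has_find size_iota.
Qed.

Lemma end1_parsed (e : 'I_(ne x)) : end1 s e = end1x e.
Proof. by rewrite /end1 etok_parsed // vertex_bits. Qed.
Lemma end2_parsed (e : 'I_(ne x)) : end2 s e = end2x e.
Proof. by rewrite /end2 etok_parsed // vertex_bits. Qed.

Lemma bipartite_of : bipartite (@ends x). Proof. by case: x. Qed.
Lemma simple_of : simple_graph (@ends x). Proof. by case: x. Qed.
Lemma planar_of : planar (@ends x). Proof. by case: x. Qed.
Lemma budget_gt0 : 0 < budget x. Proof. by case: x. Qed.

Lemma well_formed_parsed : well_formed s.
Proof.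
apply/and5P; split.
- by rewrite {2}encode_parsed {1 2}encode_parsed vcount_encode toks_encode.
- rewrite ecount_parsed toks_parsed /= (size_flatten4 (fun e j => bits (edge_entry e j))).
  by rewrite size_iota.
- rewrite encode_parsed toks_encode all_map; apply/allP => n _; exact: last_bits.
- by rewrite /tok toks_parsed /= bits_half // budget_gt0.
- rewrite ecount_parsed vcount_parsed all_ord; apply/forallP => e.
  by rewrite end1_parsed end2_parsed !ltn_ord.
Qed.

Lemma small_numbers_parsed b :
  small_numbers b s = (b ==> (interdiction_max x <= size s)).
Proof.
rewrite /small_numbers; case: b => //=.
have nvs : nv x <= size s by rewrite encode_parsed size_cat size_nseq leq_addr.
rewrite encode_parsed toks_encode -encode_parsed all_map.
rewrite (eq_all (a2 := fun n => n <= size s)) => [|n]; last by rewrite /= leqbE !bval_bits.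
rewrite /interdiction_max !geq_max /= -andbA; congr (_ && (_ && _)).
apply/allP/bigmax_leqP => [H e _|H n /flattenP[l /mapP[k]]].
  rewrite geq_max; apply/andP; split; apply: H; apply/flattenP;
    (exists [:: edge_entry e 0; edge_entry e 1; edge_entry e 2; edge_entry e 3];
     first by apply: map_f; rewrite mem_iota add0n ltn_ord);
    by rewrite !edge_entryE !inE eqxx ?orbT.
rewrite mem_iota add0n => kn ->; have := H (Ordinal kn) isT; rewrite geq_max => /andP[Hw Hc].
rewrite -[k]/(nat_of_ord (Ordinal kn)) !edge_entryE !inE.
(* The ends of edges are tokens as well, although [interdiction_max] ignores them; they are below
   the number of vertices, which is written in unary. *)
case/or4P => /eqP -> //=; by apply: leq_trans nvs; rewrite ltnW.
Qed.

Lemma sumn_iota n (F : nat -> nat) : sumn [seq F i | i <- iota 0 n] = \sum_(i < n) F i.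
Proof. by rewrite sumnE big_map -[n in LHS]subn0 -/(index_iota 0 n) big_mkord. Qed.

Lemma solution_ok_yes C : solution_ok s C -> yes (p := planar_matching_interdiction) x.
Proof.
case/and3P; rewrite !leqbE !bval_bsum -!map_comp !sumn_iota.
rewrite ecount_parsed vcount_parsed -ltnNge /tok toks_parsed /= !bval_bits => cI sy.
rewrite all_ord => /forallP cov; apply/(nuE_ltP _ _ _ _ bipartite_of).
exists (fun e : 'I_(ne x) => cut C e), (fun i : 'I_(nv x) => bval (pot C i)); split=> //.
  rewrite big_mkcond /=; apply: leq_trans cI; apply: leq_sum => e _.
  by case: ifP => // _; rewrite etok_parsed // bval_bits.
move=> e ne; have := cov e; rewrite (negbTE ne) /= leqbE bval_addb.
by rewrite end1_parsed end2_parsed etok_parsed // bval_bits.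
Qed.

Definition certificate col (I : pred 'I_(ne x)) (y : 'I_(nv x) -> nat) (rots : seq nat) :=
  [:: col, [seq I e | e <- enum 'I_(ne x)] &
     [seq bits (y i) | i <- enum 'I_(nv x)] ++ [seq nseq r true | r <- rots]].

Lemma cut_certificate col I y rots (e : 'I_(ne x)) : cut (certificate col I y rots) e = I e.
Proof. by rewrite /cut /= (nth_map e) ?size_enum_ord // nth_ord_enum. Qed.

Lemma pot_certificate col I y rots (i : 'I_(nv x)) :
  pot (certificate col I y rots) i = bits (y i).
Proof.
rewrite /pot /ctok /= add0n nth_cat size_map size_enum_ord ltn_ord.
by rewrite (nth_map i) ?size_enum_ord // nth_ord_enum.
Qed.

Lemma rotation_certificate col I y rots d :
  rotation s (certificate col I y rots) d = nth 0 rots d.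
Proof.
rewrite /rotation /ctok vcount_parsed /= ?add0n nth_cat size_map size_enum_ord ltnNge leq_addr /= addKn.
case: (ltnP d (size rots)) => H; first by rewrite (nth_map 0) // size_nseq.
by rewrite !nth_default // size_map.
Qed.

Lemma certificate_solution col I y rots :
  \sum_(e | I e) icost e <= budget x -> \sum_v y v < threshold x ->
  (forall e, ~~ I e -> weight e <= y (end1x e) + y (end2x e)) ->
  solution_ok s (certificate col I y rots).
Proof.
move=> cI sy cov; apply/and3P; split.
- rewrite leqbE bval_bsum -map_comp sumn_iota ecount_parsed /tok toks_parsed /= bval_bits.
  apply: leq_trans cI; rewrite [X in _ <= X]big_mkcond /=; apply: leq_sum => e _.
  by rewrite cut_certificate; case: ifP => // _; rewrite etok_parsed // bval_bits.
- rewrite leqbE bval_bsum -map_comp sumn_iota vcount_parsed /tok toks_parsed /= bval_bits -ltnNge.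
  by under eq_bigr => i _ do rewrite pot_certificate bval_bits.
- rewrite ecount_parsed all_ord; apply/forallP => e.
  rewrite cut_certificate; case: (boolP (I e)) => //= nI.
  rewrite leqbE bval_addb end1_parsed end2_parsed !pot_certificate etok_parsed //.
  by rewrite !bval_bits /=; exact: cov.
Qed.
End Parsed.

Lemma min_step_ext N f f' g g' l : f =1 f' -> g =1 g' -> min_step N f g l = min_step N f' g' l.
Proof. by move=> Ef Eg; apply: eq_map => d; rewrite Ef Eg. Qed.

Lemma min_labels_ext N f f' g g' : f =1 f' -> g =1 g' -> min_labels N f g = min_labels N f' g'.
Proof. by move=> Ef Eg; apply: eq_iter => l; exact: min_step_ext. Qed.

Lemma planar_check_ext m u w R R' : R =1 R' -> planar_check m u w R = planar_check m u w R'.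
Proof.
move=> E; rewrite /planar_check /perm_check /euler_check.
have E2 : (fun d => R (flip_num d)) =1 (fun d => R' (flip_num d)) by move=> d; rewrite E.
rewrite !(min_labels_ext _ E E) (min_labels_ext _ E2 E2) (min_labels_ext _ E (frefl flip_num)).
congr (_ && _ && (_ && _)).
  by apply: eq_all => d; rewrite E.
by apply: eq_all => d; apply: eq_all => d'; rewrite !E.
Qed.

Definition accepted (b : bool) (s : seq bool) := exists x : interdiction,
  [/\ interdiction_encode x = s, yes (p := planar_matching_interdiction) x &
      b -> interdiction_max x <= size s].

Lemma check_instance_sound b s C : check_instance b s C -> accepted b s.
Proof.
case/and4P => /and5P[/eqP Es /eqP szT canon B0 inrange] sm /and3P[G1 G2 G3] sol.
have rng (e : 'I_(ecount s)) : (end1 s e < vcount s) && (end2 s e < vcount s).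
  by move: inrange; rewrite all_ord => /forallP; apply.
have r1 (e : 'I_(ecount s)) : end1 s (nat_of_ord e) < vcount s by have /andP[] := rng e.
have r2 (e : 'I_(ecount s)) : end2 s (nat_of_ord e) < vcount s by have /andP[] := rng e.
pose ends (e : 'I_(ecount s)) := (Ordinal (r1 e), Ordinal (r2 e)).
have simp : simple_graph ends by rewrite -(@simple_checkE _ _ ends (end1 s) (end2 s)).
have bip : bipartite ends by apply: (@bipartite_check_sound _ _ ends (end1 s) (end2 s)) G2.
have plan : planar ends by apply: (@planar_check_sound _ _ ends (end1 s) (end2 s)) G3.
have canonT t : t \in toks s -> bits (bval t) = t by move/(allP canon); exact: bits_bval.
have mem_tok j : j < size (toks s) -> tok s j \in toks s by exact: mem_nth.
have B1 : 0 < bval (tok s 0).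
  have := canonT _ (mem_tok 0 _); rewrite szT => /(_ isT).
  by case: (bval _) => // E; move: B0; rewrite -E.
pose x := Interdiction (fun e : 'I_(ecount s) => bval (etok s (nat_of_ord e) 2))
  (fun e : 'I_(ecount s) => bval (etok s (nat_of_ord e) 3)) (bval (tok s 1)) simp bip plan B1.
have Ex : interdiction_encode x = s.
  rewrite encode_parsed -[RHS]Es; congr encode_tokens.
  apply: (@eq_from_nth _ [::]) => [|k].
    by rewrite size_map /= (size_flatten4 (edge_entry x)) size_iota szT.
  rewrite size_map /= (size_flatten4 (edge_entry x)) size_iota => kT.
  have kT' : k < size (toks s) by rewrite szT.
  case: k kT kT' => [|[|k]] kT kT'; [exact: canonT (mem_tok _ _)..|].
  have kE : k = 4 * (k %/ 4) + k %% 4 by rewrite mulnC -divn_eq.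
  have j_lt : k %/ 4 < ecount s by rewrite ltn_divLR // mulnC.
  rewrite /= (nth_map 0); last by rewrite (size_flatten4 (edge_entry x)) size_iota.
  rewrite {1}kE (nth_flatten4 0 (edge_entry x)) ?ltn_mod // add0n.
  rewrite (edge_entryE (x := x) (Ordinal j_lt)) /=.
  have := ltn_pmod k (isT : 0 < 4).
  have -> : nth [::] (toks s) k.+2 = etok s (k %/ 4) (k %% 4).
    by rewrite /etok /tok -kE.
  have inT r : r < 4 -> etok s (k %/ 4) r \in toks s.
    by move=> r4; apply: mem_tok; rewrite szT; lia.
  have vb t : vertex s t < vcount s -> bits (vertex s t) = t.
    move=> H; have Hh : has (fun i => bits i == t) (iota 0 (vcount s)).
      by rewrite has_find size_iota.
    by have := nth_find 0 Hh; rewrite nth_iota // => /eqP.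
  case: (k %% 4) => [|[|[|[|r]]]] //= _.
  - by apply: vb; exact: (r1 (Ordinal j_lt)).
  - by apply: vb; exact: (r2 (Ordinal j_lt)).
  - by apply: canonT; exact: inT.
  - by apply: canonT; exact: inT.
exists x; split=> //.
  by apply: (@solution_ok_yes x C); rewrite Ex.
by move=> bt; have := small_numbers_parsed x b; rewrite Ex sm bt /= => /esym.
Qed.

Lemma size_flatten_delimit (C : seq (seq bool)) L :
  all (fun t => size t <= L) C -> size (flatten [seq delimit t | t <- C]) <= size C * (2 * L + 1).
Proof.
elim: C => //= t C IH /andP[tL /IH]; rewrite size_cat size_delimit mulSn => H.
by apply: leq_add => //; lia.
Qed.

Lemma size_encode_tokens v l : v + size l < size (encode_tokens v l).
Proof.
rewrite /encode_tokens size_cat size_nseq /= addnS ltnS leq_add2l size_flatten.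
by elim: l => //= t l IH; rewrite size_delimit; move: IH; rewrite /shape; lia.
Qed.

Lemma mem_size_encode v l t : t \in l -> size t <= size (encode_tokens v l).
Proof.
move=> tl; rewrite /encode_tokens size_cat /= size_flatten /shape -map_comp.
apply: leq_trans (leq_trans (leqnSn _) (leq_addl _ _)).
elim: l tl => //= a l IH; rewrite inE => /orP[/eqP <-|/IH]; rewrite size_delimit; lia.
Qed.

Lemma check_instance_complete b s : accepted b s ->
  exists2 C, check_instance b s C &
    size (flatten [seq delimit t | t <- C]) <= (size s + 5) ^ 3.
Proof.
case=> x [<- {s} yx mx].
have /(nuE_ltP _ _ _ _ (bipartite_of x))[I [y [cI sy cov]]] := yx.
have u1 (e : 'I_(ne x)) := end1_parsed e; have u2 (e : 'I_(ne x)) := end2_parsed e.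
have [col szcol Hcol] := bipartite_check_complete u1 u2 (bipartite_of x).
have [rots [szrots rlt] Hrots] := planar_check_complete u1 u2 (planar_of x).
set s := interdiction_encode x in u1 u2 Hcol Hrots mx *.
exists (certificate col I y rots).
  apply/and4P; split.
  - exact: well_formed_parsed.
  - by rewrite small_numbers_parsed; apply/implyP.
  - apply/and3P; split; rewrite ecount_parsed.
    + by rewrite (simple_checkE u1 u2) simple_of.
    + exact: Hcol.
    + by rewrite (planar_check_ext _ _ _ (rotation_certificate col I y rots)).
  - exact: certificate_solution.
have [nvs nes] : nv x <= size s /\ ne x <= size s.
  have := size_encode_tokens (nv x) [seq bits n | n <- [:: budget x, threshold x &
     flatten [seq [:: edge_entry x e 0; edge_entry x e 1; edge_entry x e 2; edge_entry x e 3]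
             | e <- iota 0 (ne x)]]].
  rewrite -encode_parsed -/s size_map /= (size_flatten4 (edge_entry x)) size_iota; lia.
have ks : size (bits (threshold x)) <= size s.
  rewrite /s encode_parsed; apply: mem_size_encode.
  by rewrite /= !inE eqxx orbT.
apply: leq_trans (size_flatten_delimit (L := 2 * size s) _) _.
  rewrite /certificate /= all_cat szcol size_map size_enum_ord !all_map.
  apply/and4P; split; [lia|lia| |].
    (* Each potential is below the threshold, which occurs in [s]; so its binary length is at most
       that of [s]. *)
    apply/allP => i _ /=; apply: leq_trans (_ : _ <= size s) _; last lia.
    apply: leq_trans ks; apply: size_bits_leq; apply: leq_trans (ltnW sy).
    by rewrite (bigD1 i) //= leq_addr.
  apply/allP => r rr /=; rewrite size_nseq; have := allP rlt r rr; lia.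
have -> : size (certificate col I y rots) = (nv x + (ne x).*2).+2.
  by rewrite -szrots /certificate -[size _]/((size _).+2) size_cat 2!size_map size_enum_ord.
move: (size s) (nv x) (ne x) nvs nes => n a c; clear=> an cn.
(* There are at most [3 * n + 2] tokens of at most [2 * n] bits, each taking at most [4 * n + 1]
   bits when delimited. *)
apply: (@leq_trans ((3 * n + 2) * (4 * n + 1))); first by apply: leq_mul; lia.
by rewrite !expnS expn0 muln1; nia.
Qed.

Lemma verify_pair b s y : verify b (pair_string s y) = check_instance b s (tokens y).
Proof. by rewrite /verify /pair_string tokens_delimit. Qed.

(** * NP-completeness *)

Lemma sz_seq_nat N (l : seq nat) : all (fun k => k <= N) l -> sz l <= size l * (2 * N + 2) + 1.
Proof.
elim: l => //= k l IH /andP[kN /IH]; rewrite sz_cons sz_nat mulSn.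
by rewrite -!mul2n; lia.
Qed.

(** Labels only decrease, so the list keeps [N x] entries of at most [N x] through all rounds. *)
Lemma PT_min_labels X {EX : Enc X} (N : X -> nat) (f g : X -> nat -> nat) :
  PT N -> PT (fun p : nat * X => f p.2 p.1) -> PT (fun p : nat * X => g p.2 p.1) ->
  PT (fun x => min_labels (N x) (f x) (g x)).
Proof.
move=> HN Hf Hg; rewrite /min_labels.
apply: (PT_iter (G := fun x => N x * (2 * N x + 2) + 1)); try by pt.
- rewrite /min_step; pt.
  + by apply: (PT_comp (f := fun p : seq nat * X => p.2)) HN; pt.
  + by apply: (PT_comp (f := fun p : nat * (seq nat * X) => (p.1, p.2.2))) Hf; pt.
  + by apply: (PT_comp (f := fun p : nat * (seq nat * X) => (p.1, p.2.2))) Hg; pt.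
- have pN := pb_nat HN.
  by apply: pb_add; [apply: pb_mul => //; apply: pb_add; [apply: pb_mul|]|]; try exact: pb_const.
move=> x i _; have [sl al] : size (iter i (min_step (N x) (f x) (g x)) (iota 0 (N x))) = N x /\
   all (fun k => k <= N x) (iter i (min_step (N x) (f x) (g x)) (iota 0 (N x))).
  elim: i => [|i [IH1 IH2]].
    by rewrite size_iota; split=> //; apply/allP => k; rewrite mem_iota => /andP[_ /ltnW].
  rewrite iterS {1}/min_step size_map size_iota; split=> //.
  apply/allP => k /mapP[d]; rewrite mem_iota add0n => /andP[_ dN] ->.
  rewrite geq_min; apply/orP; left; apply: (allP IH2).
  by rewrite mem_nth // IH1.
by have := sz_seq_nat al; rewrite sl.
Qed.

Section Time.
Context (X : Type) {EX : Enc X}.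
Implicit Types (f : X -> seq bool) (g h : X -> nat) (C : X -> seq (seq bool)).

Lemma PT_vcount f : PT f -> PT (fun x => vcount (f x)).
Proof. by move=> Hf; rewrite /vcount; pt. Qed.

Lemma PT_toks f : PT f -> PT (fun x => toks (f x)).
Proof.
move=> Hf; rewrite /toks; apply: PT_tokens; apply: PT_drop => //.
by apply: PT_succ; exact: PT_vcount.
Qed.

Lemma PT_tok f g : PT f -> PT g -> PT (fun x => tok (f x) (g x)).
Proof. by move=> Hf Hg; apply: PT_nth => //; exact: PT_toks. Qed.

Lemma PT_ecount f : PT f -> PT (fun x => ecount (f x)).
Proof. by move=> Hf; have H := PT_toks Hf; rewrite /ecount; pt. Qed.

Lemma PT_etok f g h : PT f -> PT g -> PT h -> PT (fun x => etok (f x) (g x) (h x)).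
Proof. by move=> Hf Hg Hh; rewrite /etok; apply: PT_tok => //; pt. Qed.

Lemma PT_vertex f f' : PT f -> PT f' -> PT (fun x => vertex (f x) (f' x)).
Proof.
move=> Hf Hf'; rewrite /vertex; apply: PT_find.
  by apply: PT_iota0; exact: PT_vcount.
apply: PT_eqbits; first by apply: PT_bits; pt.
by apply: (PT_comp (f := fun p : nat * X => p.2)) Hf'; pt.
Qed.

Lemma PT_end1 f g : PT f -> PT g -> PT (fun x => end1 (f x) (g x)).
Proof. by move=> Hf Hg; apply: PT_vertex => //; apply: PT_etok => //; pt. Qed.
Lemma PT_end2 f g : PT f -> PT g -> PT (fun x => end2 (f x) (g x)).
Proof. by move=> Hf Hg; apply: PT_vertex => //; apply: PT_etok => //; pt. Qed.

Lemma PT_double g : PT g -> PT (fun x => (g x).*2).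
Proof.
move=> Hg; apply: (PT_ext (f := fun x => 2 * g x)); last by pt.
by move=> x; rewrite mul2n.
Qed.
Lemma PT_last f : PT f -> PT (fun x => last true (f x)).
Proof.
move=> Hf; apply: (PT_ext (f := fun x => head true (rev (f x)))); last by pt.
by move=> x; case/lastP: (f x) => // s b; rewrite rev_rcons last_rcons.
Qed.
End Time.

Lemma PT_encode_tokens X {EX : Enc X} (g : X -> nat) (l : X -> seq (seq bool)) :
  PT g -> PT l -> PT (fun x => encode_tokens (g x) (l x)).
Proof.
move=> Hg Hl; rewrite /encode_tokens.
apply: (PT_ext (f := fun x => mkseq (fun=> true) (g x) ++
   false :: flatten [seq delimit t | t <- l x])) => [x|].
  by congr (_ ++ _); rewrite /mkseq -[g x in RHS](size_iota 0); elim: (iota _ _) => //= k s ->.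
by pt; apply: PT_delimit; pt.
Qed.

Ltac ptv := repeat first
  [ simple apply PT_vcount | simple apply PT_toks | simple apply PT_tok
  | simple apply PT_ecount | simple apply PT_etok | simple apply PT_end1
  | simple apply PT_end2 | simple apply PT_double | simple apply PT_last
  | simple apply PT_odd | simple apply PT_half | simple apply PT_eqbits
  | simple apply PT_encode_tokens | simple apply PT_leqb | simple apply PT_bsum | simple apply PT_addb
  | simple apply PT_bits | simple apply PT_delimit | apply: PT_min_labels | pt_step ].

Definition instance_of (str : seq bool) := head [::] (tokens str).
Definition hints_of (str : seq bool) := behead (tokens str).

Section Final.
Context (X : Type) {EX : Enc X}.
Implicit Types (f : X -> seq bool) (g : X -> nat).

Lemma PT_instance_of f : PT f -> PT (fun x => instance_of (f x)).
Proof. by move=> Hf; have H := PT_tokens Hf; rewrite /instance_of; pt. Qed.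
Lemma PT_hint f g : PT f -> PT g -> PT (fun x => ctok (hints_of (f x)) (g x)).
Proof. by move=> Hf Hg; have H := PT_tokens Hf; rewrite /ctok /hints_of; pt. Qed.
End Final.

Ltac ptw := repeat first [ simple apply PT_instance_of | simple apply PT_hint | progress ptv ].

Section VerifyTime.
Let Hs : PT (fun str : seq bool => str). Proof. exact: PT_id. Qed.

Lemma PT_well_formed : PT (fun str => well_formed (instance_of str)).
Proof. by rewrite /well_formed; ptw. Qed.

Lemma PT_small_numbers b : PT (fun str => small_numbers b (instance_of str)).
Proof. by rewrite /small_numbers; ptw. Qed.

Lemma PT_simple_check : PT (fun str => simple_check (ecount (instance_of str))
  (end1 (instance_of str)) (end2 (instance_of str))).
Proof. by rewrite /simple_check; ptw. Qed.

Lemma PT_bipartite_check : PT (fun str => bipartite_check (ecount (instance_of str))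
  (end1 (instance_of str)) (end2 (instance_of str)) (ctok (hints_of str) 0)).
Proof. by rewrite /bipartite_check; ptw. Qed.

Lemma PT_solution_ok : PT (fun str => solution_ok (instance_of str) (hints_of str)).
Proof. by rewrite /solution_ok /cut /pot; ptw. Qed.

Lemma PT_planar_check : PT (fun str => planar_check (ecount (instance_of str))
  (end1 (instance_of str)) (end2 (instance_of str)) (rotation (instance_of str) (hints_of str))).
Proof.
rewrite /planar_check; apply: PT_andb; [|apply: PT_andb].
- by rewrite /perm_check /rotation; ptw.
- by rewrite /rotation_check /tail_num /rotation; ptw.
- by rewrite /euler_check /fixed_points /rotation /flip_num; ptw.
Qed.

Lemma PT_verify b : PT (verify b).
Proof.
rewrite /verify /check_instance /graph_ok.
apply: PT_andb; first exact: PT_well_formed.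
apply: PT_andb; first exact: PT_small_numbers.
apply: PT_andb; last exact: PT_solution_ok.
by do 2 (apply: PT_andb; [exact: PT_simple_check || exact: PT_bipartite_check|]); exact: PT_planar_check.
Qed.
End VerifyTime.

Lemma in_NP_ext (L L' : seq bool -> Prop) : (forall s, L s <-> L' s) -> in_NP L -> in_NP L'.
Proof.
move=> E [V [q [PV HV]]]; exists V, q; split=> // s.
by split=> [/E/HV|/HV/E].
Qed.

Lemma accepted_in_NP b : in_NP (accepted b).
Proof.
exists (verify b), (('X + 5%N%:P) ^+ 3)%R; split.
  apply: PT_poly_time; apply: PT_cons; first exact: PT_verify.
  exact: PT_const.
move=> s; have -> : (('X + 5%N%:P) ^+ 3).[size s]%R = (size s + 5) ^ 3.
  by rewrite poly.horner_exp poly.hornerD poly.hornerX poly.hornerC.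
split=> [/check_instance_complete[C HC sC]|[y [_]]].
  by exists (flatten [seq delimit t | t <- C]); rewrite verify_pair tokens_flatten.
by rewrite verify_pair; exact: check_instance_sound.
Qed.

Lemma language_accepted s :
  accepted false s <-> language planar_matching_interdiction s.
Proof. by split=> [[x [Ex yx _]]|[x [Ex yx]]]; exists x. Qed.

Lemma bounded_accepted s :
  accepted true s <-> language (bounded planar_matching_interdiction 'X%R) s.
Proof.
split=> [[x [Ex yx mx]]|[[x mx] [/= Ex yx]]].
  have mx' : max_number (x : instance planar_matching_interdiction) <=
      ('X).[size (encode (x : instance planar_matching_interdiction))]%R.
    by rewrite poly.hornerX /= Ex; exact: mx.
  by exists (exist _ x mx').
by exists x; split=> // _; move: mx; rewrite poly.hornerX /= Ex.
Qed.

Lemma accepted_np_hard L : in_NP L -> exists f, poly_time f /\ forall s, L s <-> accepted true (f s).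
Proof.
case=> V [q [[M [p HM]] HV]].
exists (reduction M p q); split; first by apply: PT_poly_time; exact: PT_reduction.
move=> s; set x := grid_instance M p q s.
have Ex : interdiction_encode x = reduction M p q s by exact: grid_encode.
have T : size (known s) + guessed q s <= run_time p q s by exact: leq_addr.
(* The horizon exceeds the running time and halted configurations are fixed, so at the horizon the
   symbol under the head of tape 0 is the answer. *)
have acc y : size y <= guessed q s ->
    accepts M (run_time p q s) (known s) y <-> V (pair_string s y).
  move=> yq; rewrite /accepts /run_from -/(pair_string s y).
  have [] := HM (pair_string s y); set c := iter _ _ _ => hc out.
  have le : p.[size (pair_string s y)]%R <= run_time p q s.
    rewrite /run_time /pair_string size_cat; apply: leq_trans (leq_addl _ _).
    by apply: horner_leq; rewrite leq_add2l.
  rewrite -(subnK le) iterD -/c iter_halted //= ffunE /=.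
  case: (c.2 ord0).2 out => [|[[b|w]|] r] //= [Eb _].
  by rewrite Eb; split=> [[]|->].
split=> [/HV[y [yq Vy]]|[x' [Ex' yx' _]]].
  exists x; split=> [//||_]; last by rewrite -Ex; exact: grid_max.
  apply/grid_yes; apply: (cnf_complete T (y := y)) => //.
  exact/acc.
(* The instance [x'] may differ from [x], as only their encodings agree. A certificate for [x']
   refers to the string alone and so carries over to [x], without proving the encoding injective. *)
have [C _ sol] : exists2 C, true & solution_ok (reduction M p q s) C.
  have acc' : accepted false (reduction M p q s) by exists x'.
  by have [C /and4P[_ _ _ sol] _] := check_instance_complete acc'; exists C.
have /grid_yes[a Ha] : yes (p := planar_matching_interdiction) x.
  by apply: (@solution_ok_yes x C); rewrite Ex.
by have [y yq /(acc y yq) Vy] := cnf_sound T Ha; apply/HV; exists y.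
Qed.

Theorem theorem5 : strongly_np_complete planar_matching_interdiction.
Proof.
split; first exact: in_NP_ext language_accepted (accepted_in_NP false).
(* The identity is large enough: the grid instances contain no number above the length of their
   encoding. *)
exists 'X%R; split; first exact: in_NP_ext bounded_accepted (accepted_in_NP true).
move=> L /accepted_np_hard[f [Pf Hf]]; exists f; split=> // s.
by split=> [/Hf/bounded_accepted|/bounded_accepted/Hf].
Qed.
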